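(* Let $$f\colon \mathbb{A}^3_{\mathbb{Q}}\longrightarrow\mathbb{A}^3_{\mathbb{Q}},\qquad (x,y,z)\mapsto(y,\;x+y-y^3,\;2z-y).$$ Then the following statements hold. (1) The morphism $f$ is an automorphism, and $d_1(f)=d_2(f)=3$. (2) For any $n\ge1$, $\mathrm{Per}_n(f,\mathbb{A}^3(\overline{\mathbb{Q}}))$ is finite; thus all periodic points of $f$ are isolated. (3) There is a sequence $\{P_i\}_{i\ge1}$ of points of $\mathrm{Per}(f,\mathbb{A}^3(\overline{\mathbb{Q}}))$ such that $\lim_{i\to\infty}h(P_i)=\infty$ and $\{P_i\mid i\ge1\}$ is Zariski dense in $\mathbb{A}^3_{\overline{\mathbb{Q}}}$.
   Context: $\mathrm{Per}_n(f,\mathbb{A}^3(\overline{\mathbb{Q}}))=\{P\in\mathbb{A}^3(\overline{\mathbb{Q}})\mid f^n(P)=P\}$ and $\mathrm{Per}(f,\mathbb{A}^3(\overline{\mathbb{Q}}))=\{P\in\mathbb{A}^3(\overline{\mathbb{Q}})\mid f^n(P)=P\text{ for some }n\ge1\}$. A periodic point $P$ is isolated if for all $n\ge 1$ it is not in the Zariski closure of $\mathrm{Per}_n(f,\mathbb{A}^3(\overline{\mathbb{Q}}))\setminus\{P\}$. $h\colon\mathbb{A}^3(\overline{\mathbb{Q}})\to\mathbb{R}$ is the restriction to $\mathbb{A}^3$ of the naive logarithmic height function on $\mathbb{P}^3$. $d_i(f)$ is the $i$-th dynamical degree of $f$ regarded as a (bi)rational self-map of $\mathbb{P}^3$: $d_i(f)=\lim_{n\to\infty}\big((f^n)^*H^i\cdot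 H^{3-i}\big)^{1/n}$ with $H$ a hyperplane, computed on the graph of $f^n$; $d_1(f)=\lim_n\deg(f^n)^{1/n}$, where $\deg$ is the maximum of the total degrees of the coordinate functions. *)

(* Defs.v *)
Set Warnings "-all".
From HB Require Import structures.
From mathcomp Require Import all_boot all_order all_algebra all_field.
From mathcomp Require Import finmap mpoly complex.
From mathcomp Require Import boolp classical_sets functions cardinality fsbigop.
From mathcomp Require Import reals topology normedtype sequences exp.
Set Warnings "all".

Set Implicit Arguments.
Unset Strict Implicit.
Unset Printing Implicit Defensive.

Import Order.TTheory GRing.Theory Num.Theory.
Import numFieldNormedType.Exports.

Local Open Scope classical_set_scope.
Local Open Scope card_scope.
Local Open Scope ring_scope.

(* The field \overline{Q} is algC; the points of A^d(\overline{Q}) are row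
   vectors of length d. *)
Notation affine d := ('rV[algC]_d).

(* Morphisms A^d -> A^d over Q, given by their coordinate functions. *)
Notation endo d := (d.-tuple {mpoly rat[d]}).

Section AffineMaps.
Variable d : nat.
Implicit Types (f g : endo d) (P : affine d) (n : nat).

Definition endo_id : endo d := [tuple 'X_i | i < d].

Definition endo_comp f g : endo d := [tuple tnth f i \mPo g | i < d].

Definition is_automorphism f :=
  exists g, endo_comp f g = endo_id /\ endo_comp g f = endo_id.

Definition endo_app f P : affine d := \row_i (map_mpoly ratr (tnth f i)).@[P 0].

Definition Per_n f n : set (affine d) := [set P | iter n (endo_app f) P = P].

Definition Per f : set (affine d) :=
  [set P | exists n, (1 <= n)%N /\ Per_n f n P].

Definition zariski_closure (S : set (affine d)) : set (affine d) :=
  [set P | forall p : {mpoly algC[d]},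
             (forall Q, S Q -> p.@[Q 0] = 0) -> p.@[P 0] = 0].

Definition zariski_dense (S : set (affine d)) := zariski_closure S = setT.

Definition isolated_periodic f P :=
  forall n, (1 <= n)%N -> ~ zariski_closure (Per_n f n `\ P) P.

End AffineMaps.

(* The embedding A^d -> P^d, P |-> [1 : P], in homogeneous coordinates. *)
Definition homog_coords d (P : affine d) : 'rV[algC]_(1 + d) := row_mx 1%:M P.

Section IntersectionNumbers.
Variable d : nat.
Notation coords := ('rV[algC]_(1 + d)).
Implicit Types (S G : set (coords * coords)) (i : nat).

Definition bihomogeneous (a b : nat) (F : {mpoly algC[(1 + d) + (1 + d)]}) :=
  forall m, m \in msupp F ->
    (\sum_k m (lshift (1 + d) k) = a)%N /\ (\sum_k m (rshift (1 + d) k) = b)%N.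

(* Zariski closure in P^d x P^d: sets of pairs of points are represented by
   pairs of homogeneous coordinate vectors, and the closure consists of all the
   coordinate vectors of the points of the closure. *)
Definition biproj_closure S : set (coords * coords) :=
  [set w | [/\ w.1 != 0, w.2 != 0 &
     forall a b F, bihomogeneous a b F ->
       (forall u, S u -> F.@[(row_mx u.1 u.2) 0] = 0) ->
       F.@[(row_mx w.1 w.2) 0] = 0]].

(* The graph, in P^d x P^d, of the rational self-map of P^d induced by a
   self-map of A^d. *)
Definition proj_graph (phi : affine d -> affine d) : set (coords * coords) :=
  biproj_closure [set (homog_coords P, homog_coords (phi P)) | P in [set: affine d]].

(* The rows of A are the equations of d hyperplanes of P^d.  The points of G
   whose second projection is on each of the first i hyperplanes and whose first
   projection is on each of the d - i others; a point of P^d is a line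
   <[u]> of \overline{Q}^(1+d). *)
Definition linear_section G i (A : 'M[algC]_(d, 1 + d)) :
    set ({vspace coords} * {vspace coords}) :=
  [set (<[w.1]>%VS, <[w.2]>%VS) | w in
    [set w | G w /\
       forall j : 'I_d, row j A *m (if (j < i)%N then w.2 else w.1)^T = 0]].

(* Q holds on a nonempty Zariski open set of matrices. *)
Definition for_general m n (Q : 'M[algC]_(m, n) -> Prop) :=
  exists2 D : {mpoly algC[m * n]}, D != 0 &
    forall A, D.@[(mxvec A) 0] != 0 -> Q A.

(* For G closed of pure dimension d, N is the intersection number on G of
   (p_2^* H)^i and (p_1^* H)^(d - i).  The linear systems |p_1^* H| and
   |p_2^* H| are base point free, so in characteristic 0 general members meet
   transversally on G (Bertini) and every point counts with multiplicity 1. *)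
Definition intersection_number G i (N : nat) :=
  for_general (fun A => linear_section G i A #= `I_N).

End IntersectionNumbers.

(* l = lim_n ((f^n)^* H^i . H^(d - i))^(1/n); this asserts that the limit
   exists. *)
Definition is_dynamical_degree (R : realType) d (f : endo d) (i : nat) (l : R) :=
  exists delta : nat -> nat,
    (forall n, (1 <= n)%N ->
       intersection_number (proj_graph (iter n (endo_app f))) i (delta n)) /\
    (fun n => (delta n)%:R `^ n%:R^-1 : R) @ \oo --> l.

Section Height.
Variable R : realType.

Section Places.
Variable K : fieldExtType rat.
Implicit Types (v : K -> int) (x : K).

(* Sum over the archimedean places: each embedding K -> C occurs once, so that a
   complex place, i.e. a pair of conjugate embeddings, has weight 2. *)
Definition complex_embeddings : set (K -> R[i]) :=
  range (fun s : {rmorphism K -> R[i]} => s : K -> R[i]).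

(* The finite places of K, as normalized discrete valuations.  The value at 0,
   which should be +oo, is set to 0 so that a place is a single function. *)
Definition finite_places : set (K -> int) :=
  [set v | [/\ v 0 = 0,
     forall x y, x != 0 -> y != 0 -> v (x * y) = v x + v y,
     forall x y, x != 0 -> y != 0 -> x + y != 0 ->
       Num.min (v x) (v y) <= v (x + y) &
     exists2 x, x != 0 & v x = 1]].

Definition valuation_ring v : set K := [set x | x = 0 \/ 0 <= v x].

Definition valuation_ideal v : set K := [set x | x = 0 \/ 0 < v x].

Definition residue_field v : set (set K) :=
  [set [set y | valuation_ideal v (y - x)] | x in valuation_ring v].

Definition residue_card v : nat := #|` fset_set (residue_field v)|.

(* The normalized absolute value, that is |x|_v to the power [K_v : Q_v]. *)
Definition finite_norm v x : R :=
  if x == 0 then 0 else (residue_card v)%:R ^ (- v x).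

(* 1 / [K : Q] * \sum_v [K_v : Q_v] log max_i |x_i|_v *)
Definition height_over (s : seq K) : R :=
  (\dim {:K})%:R^-1 *
  (\sum_(e \in complex_embeddings)
      ln (\big[Num.max/0]_(x <- s) Normc.normc (e x)) +
   \sum_(v \in finite_places)
      ln (\big[Num.max/0]_(x <- s) finite_norm v x)).

End Places.

(* The logarithmic height on P^(n - 1)(\overline{Q}), computed over the number
   field K generated by the coordinates. *)
Definition proj_height n (u : 'rV[algC]_n) : R :=
  let: existT K (existT _ (exist2 s _ _)) :=
    num_field_exists [seq u 0 i | i <- enum 'I_n] in
  @height_over K s.

Definition height d (P : affine d) : R := proj_height (homog_coords P).

End Height.

Definition henon_skew : endo 3 :=
  let x := 'X_0 in let y := 'X_1 in let z := 'X_2 in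
  [tuple y; x + y - y ^+ 3; 2 * z - y].

(* Main.v *)
(* An orbit of f is a sequence with y_(k+2) = y_k + y_(k+1) - y_(k+1)^3 and z_(k+1) = 2 z_k - y_k.

   (1) The iterates of f and of f^-1 are given, after homogenization, by forms of degree 3^n, exactly
   one of which is not identically 0 at infinity, where it equals c X_e^(3^n). Hence a general line
   meets the preimage of a general plane in the roots of a separable polynomial of degree 3^n, and
   there are no solutions at infinity; for d_2 this is applied to f^-1.

   (2) Along a cycle w_i^3 = w_(i-1) + w_i - w_(i+1), so all monomials in the w_i are combinations
   of those with exponents < 3 and each w_i is an eigenvalue of a matrix that does not depend on w.

   (3) Let q_0 = 0, q_1 = X, q_(k+2) = q_k + q_(k+1) - q_(k+1)^3 in Z[X]. The involution reversing
   the orbits shows that a root t of q_m, m even, gives a cycle of length 2m, on which z has the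
   denominator 2^(2m) - 1, and 3^(k+1) divides 2^(2m) - 1 for m = 2 3^k. Modulo 3 the recurrence is
   additive: q_m = U - U^3 with U the sum of the q_i, i < m odd, the derivative of q_m is a nonzero
   constant, and the numerator of z is +-U at the roots of q_m. So the factor U^2 - 1 of q_m, of
   relative degree 2/3, yields unramified places over 3 at which z has a pole of order at least
   k + 1, and an irreducible factor of q_m can be chosen for which these places have total degree at
   least 2/3 of the degree of Q(t). This bounds the height from below by (2/3)(k + 1) ln 3.
   If a polynomial vanished at the points, one could take it with rational coefficients; the
   coefficient of its highest power of z would then vanish modulo 3 at (q_j, q_(j+1)) in infinitely
   many residue fields, hence identically on the curve (q_j, q_(j+1)) over F_3, for every j. *)

Require Import Defs.
Set Warnings "-all".
From HB Require Import structures.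
From mathcomp Require Import all_boot all_order all_algebra all_field.
From mathcomp Require Import finmap mpoly complex.
From mathcomp Require Import boolp classical_sets functions cardinality fsbigop.
From mathcomp Require Import reals topology normedtype sequences exp.
From mathcomp Require Import zify ring.
Set Warnings "all".
Import Order.TTheory GRing.Theory Num.Theory.
Import numFieldNormedType.Exports.
Local Open Scope classical_set_scope.
Local Open Scope ring_scope.

Set Implicit Arguments.
Unset Strict Implicit.
Unset Printing Implicit Defensive.

(** The prime 3 is chosen because cubing is the Frobenius map in characteristic 3, so that the
    reductions of the q_k are additive polynomials, and because 2 = -1 there, which turns the
    numerator of z into an alternating sum along the cycle. The half period m = 2 3^k meets four
    requirements: it is even, for the reflection of orbits; it is not divisible by 4, which keeps
    q_m separable modulo 3; the power of 3 in 2^(2m) - 1 grows with k; and each half period divides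
    the later ones with a quotient divisible by 3. By the last property the factors of U^2 - 1 at
    different levels are distinct. How q_m splits over Q is left open; a factor is selected by
    counting degrees alone. Places are built directly from Z[X] evaluated at a root, in place of a
    ring of integers. The height bound is uniform in the orbit index j, which leaves j free for
    density: a polynomial is excluded on the curve (q_j, q_(j+1)) once 3^j exceeds its degree in the
    first variable. *)

(** * The inverse automorphism *)

Definition henon_skew_inv : endo 3 :=
  let x := 'X_0 in let y := 'X_1 in let z := 'X_2%R in
  [tuple y - x + x ^+ 3; x; 2^-1%:MP * (z + x)].

Lemma ord3_ind (Q : 'I_3 -> Prop) : Q 0 -> Q 1 -> Q 2 -> forall i, Q i.
Proof.
move=> Q0 Q1 Q2 [[|[|[|//]]] lt_i]; [move: Q0|move: Q1|move: Q2];
  by congr Q; apply: val_inj.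
Qed.

Lemma henon_skew_automorphism : is_automorphism henon_skew.
Proof.
have half2 : 2^-1%:MP * 2 = 1 :> {mpoly rat[3]}.
  by rewrite -[2 in X in _ * X]/(2%:R) -(rmorph_nat (@mpolyC 3 rat)) -mpolyCM mulVf.
exists henon_skew_inv; split; apply: eq_from_tnth; elim/ord3_ind;
  rewrite !tnth_mktuple /tnth /=.
- by rewrite comp_mpolyXU.
- rewrite comp_mpolyB comp_mpolyD rmorphXn /= !comp_mpolyXU /=; ring.
- rewrite comp_mpolyB rmorphM rmorph_nat /= !comp_mpolyXU /= mulrA [2 * _]mulrC half2; ring.
- rewrite comp_mpolyD comp_mpolyB rmorphXn /= !comp_mpolyXU /=; ring.
- by rewrite comp_mpolyXU.
- by rewrite rmorphM /= comp_mpolyC comp_mpolyD /= !comp_mpolyXU /= subrK mulrA half2 mul1r.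
Qed.

Lemma endo_app_henon_skew P : endo_app henon_skew P =
  \row_i [tuple P 0 1; P 0 0 + P 0 1 - P 0 1 ^+ 3; 2 * P 0 2 - P 0 1]`_i.
Proof.
apply/rowP; elim/ord3_ind; rewrite !mxE /tnth /=.
- by rewrite map_mpolyX mevalXU.
- by rewrite !(rmorphB, rmorphD, rmorphXn) /= !map_mpolyX !mevalXU.
- by rewrite !(rmorphB, rmorphM) !rmorph_nat /= !map_mpolyX !mevalXU.
Qed.

(** * Finiteness of the periodic points *)

(** Replacing a factor [w i ^+ 3] by the linear right-hand side lowers the total degree by 2. The
    coefficients are quantified before [w], since the same ones must serve all solutions. *)
Lemma cubic_monomial_reduction (F : comNzRingType) n (a b : 'I_n -> 'I_n) (e : 'I_n -> nat) :
  exists c : {ffun 'I_n -> 'I_3} -> F, forall w : 'I_n -> F,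
    (forall i, w i ^+ 3 = w (a i) + w i - w (b i)) ->
    \prod_i w i ^+ e i = \sum_f c f * \prod_i w i ^+ f i.
Proof.
have [N] := ubnP (\sum_i e i)%N; elim: N e => // N IHN e ltN.
have [small|] := boolP [forall i, (e i < 3)%N]; last first.
  rewrite negb_forall => /existsP[j]; rewrite -leqNgt; move: j => i e_i.
  (* The exponents after one factor [w i ^+ 3] is replaced by [w k]. *)
  pose e' k j := ((if j == i then e i - 3 else e j) + (j == k))%N.
  have lt_e' k : (\sum_j e' k j < N)%N.
    rewrite big_split /= -[X in (_ + X)%N]big_mkcond /= sum1_card card1.
    move: ltN; rewrite (bigD1 i) //= => ltN.
    rewrite (bigD1 i) //= eqxx (eq_bigr e) => [|j /negPf -> //].
    by move: ltN; move: (\sum_(j < n | _) _)%N => s; lia.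
  have [ca Dca] := IHN _ (lt_e' (a i)); have [ci Dci] := IHN _ (lt_e' i).
  have [cb Dcb] := IHN _ (lt_e' (b i)).
  exists (fun f => ca f + ci f - cb f) => w Dw.
  rewrite [RHS](eq_bigr _ (fun f _ => mulrBl _ _ _)) sumrB.
  rewrite [X in _ = X - _](eq_bigr _ (fun f _ => mulrDl _ _ _)) big_split /= -Dca // -Dci // -Dcb //.
  have De' k : \prod_j w j ^+ e' k j = \prod_j w j ^+ (if j == i then e i - 3 else e j)%N * w k.
    under eq_bigr do rewrite exprD.
    rewrite big_split /=; congr (_ * _); rewrite (bigD1 k) //= eqxx expr1.
    by rewrite big1 ?mulr1 // => j /negPf ->.
  rewrite !De' -mulrDr -mulrBr -Dw [LHS](bigD1 i) //= [X in _ = X * _](bigD1 i) //= eqxx.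
  rewrite -[in LHS](subnK e_i) exprD mulrAC; congr (_ * _ * _).
  by apply: eq_bigr => j /negPf ->.
have lt3 i : (e i < 3)%N by move: i; apply/fintype.forallP.
exists (fun f => (f == [ffun i => Ordinal (lt3 i)])%:R) => w _.
rewrite [RHS](bigD1 [ffun i => Ordinal (lt3 i)]) //= eqxx mul1r [X in _ = _ + X]big1 ?addr0.
  by apply: eq_bigr => i _; rewrite ffunE.
by move=> f /negPf ->; rewrite mul0r.
Qed.

Lemma finite_poly_roots (p : {poly algC}) : p != 0 -> finite_set [set x | root p x].
Proof.
move=> p0; have [rs Dp] := closed_field_poly_normal p.
apply: (sub_finite_set _ (finite_seq rs)) => x /=.
by rewrite Dp rootZ ?lead_coef_eq0 // root_prod_XsubC.
Qed.

Lemma finite_cubic_solutions n (a b : 'I_n -> 'I_n) (i : 'I_n) :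
  finite_set [set w i | w in [set w : 'I_n -> algC |
    forall i, w i ^+ 3 = w (a i) + w i - w (b i)]].
Proof.
pose M (f : {ffun 'I_n -> 'I_3}) (w : 'I_n -> algC) := \prod_j w j ^+ f j.
have /all_sig[c Dc] (f : {ffun 'I_n -> 'I_3}) := cid (@cubic_monomial_reduction algC n a b (fun j => (f j + (j == i))%N)).
pose A : 'M[algC]_#|{ffun 'I_n -> 'I_3}| := \matrix_(k, l)
  c (enum_val l : {ffun 'I_n -> 'I_3}) (enum_val k : {ffun 'I_n -> 'I_3}).
apply: (sub_finite_set _ (finite_poly_roots (monic_neq0 (char_poly_monic A)))) => _ [w /= Dw <-].
rewrite -eigenvalue_root_char; apply/eigenvalueP.
exists (\row_k M (enum_val k) w).
  apply/rowP=> l; rewrite !mxE; transitivity (\prod_j w j ^+ (enum_val l j + (j == i))).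
    rewrite Dc // [RHS](reindex _ (onW_bij _ (@enum_val_bij _))) /=.
    by apply: eq_bigr => k _; rewrite !mxE mulrC.
  under eq_bigr do rewrite exprD; rewrite big_split mulrC; congr (_ * _).
  rewrite (bigD1 i) //= eqxx expr1 big1 ?mulr1 // => j /negPf ->; exact: expr0.
(* The vector of monomial values is nonzero because its entry at the monomial 1 is 1. *)
apply/eqP=> /rowP/(_ (enum_rank [ffun=> 0])).
rewrite !mxE enum_rankK /M big1 => [/eqP|j _]; first by rewrite oner_eq0.
by rewrite ffunE expr0.
Qed.

Lemma endo_app_iter_skew (P : affine 3) k : let w k := iter k (endo_app henon_skew) P in
  [/\ w k.+1 0 0 = w k 0 1, w k.+1 0 1 = w k 0 0 + w k 0 1 - w k 0 1 ^+ 3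
    & w k.+1 0 2 = 2 * w k 0 2 - w k 0 1].
Proof. by rewrite /= endo_app_henon_skew !mxE. Qed.

Lemma Per_henon_skew_finite n : (1 <= n)%N -> finite_set (Per_n henon_skew n).
Proof.
case: n => // n _; set f := endo_app henon_skew.
pose S : set ('I_n.+1 -> algC) :=
  [set w | forall i, w i ^+ 3 = w (ord_pred i) + w i - w (ordS i)].
pose Z : set algC := [set w 0 | w in S].
have finZ : finite_set Z by apply: finite_cubic_solutions.
(* Along a cycle x_k = y_(k-1), so the recurrence for y becomes the cubic relation between cyclic
   neighbours. *)
have PerZ P : Per_n henon_skew n.+1 P -> Z (P 0 1).
  move=> perP; exists (fun i : 'I_n.+1 => iter i f P 0 1) => //= i.
  have itS k : iter (k %% n.+1) f P = iter k f P.
    rewrite [in RHS](divn_eq k n.+1) addnC iterD; congr iter.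
    by elim: (k %/ _)%N => // j IHj; rewrite mulSn iterD -IHj perP.
  have -> : iter (ordS i) f P = iter i.+1 f P by rewrite -[RHS]itS.
  have -> : iter (ord_pred i) f P = iter (n + i) f P by rewrite -[RHS]itS /= addnS addnC.
  have [_ -> _] := endo_app_iter_skew P i.
  have -> : iter i f P 0 0 = iter (n + i) f P 0 1.
    have [<- _ _] := endo_app_iter_skew P (n + i).
    by rewrite -/f -addSn addnC iterD perP.
  rewrite -/f; ring.
have perf P : Per_n henon_skew n.+1 P -> Per_n henon_skew n.+1 (f P).
  by rewrite /Per_n /= => perP; rewrite -iterSr /= perP.
have PerZ0 P : Per_n henon_skew n.+1 P -> Z (P 0 0).
  move=> perP; have : Z (iter n f P 0 1).
    have perfk k : Per_n henon_skew n.+1 (iter k f P) by elim: k => //= k; apply: perf.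
    exact: PerZ.
  have [<- _ _] := endo_app_iter_skew P n.
  by rewrite -/f perP.
pose pr (P : affine 3) := (P 0 0, P 0 1).
(* For equal x and y the difference of the z-coordinates doubles at each step; as it returns after
   [n.+1] steps, 2^(n+1) - 1 annihilates it. *)
have inj_pr : {in Per_n henon_skew n.+1 &, injective pr}.
  move=> P Q; rewrite !inE => perP perQ [eq0 eq1].
  have eq_it k : [/\ iter k f P 0 0 = iter k f Q 0 0, iter k f P 0 1 = iter k f Q 0 1
      & iter k f P 0 2 - iter k f Q 0 2 = 2 ^+ k * (P 0 2 - Q 0 2)].
    elim: k => [|k [IH0 IH1 IH2]]; first by rewrite expr0 mul1r.
    have [-> -> ->] := endo_app_iter_skew P k.
    have [-> -> ->] := endo_app_iter_skew Q k.
    rewrite -/f IH0 IH1; split=> //.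
    by rewrite [2 ^+ k.+1]exprS -mulrA -IH2; ring.
  have [_ _ /eqP] := eq_it n.+1.
  rewrite perP perQ -subr_eq0 -[X in X - _]mul1r -mulrBl mulf_eq0 !subr_eq0.
  rewrite eq_sym -natrX (eqr_nat _ _ 1) gtn_eqF ?(ltn_exp2l 0) //= => /eqP eq2.
  by apply/rowP; elim/ord3_ind.
rewrite -(eq_finite_set (inj_card_eq inj_pr)).
apply: (sub_finite_set _ (finite_setX finZ finZ)) => _ [P perP <-].
by split; [apply: PerZ0 | apply: PerZ].
Qed.

(** A point P outside S is excluded by a product of linear polynomials, one for each Q in S,
    vanishing at Q and not at P. *)
Lemma finite_zariski_closed d (S : set (affine d)) : finite_set S ->
  zariski_closure S `<=` S.
Proof.
move=> /finite_seqP[s ->] P clP; apply: contrapT => /negP/= sP.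
pose sep (Q : affine d) : {mpoly algC[d]} :=
  if [pick k | P 0 k != Q 0 k] is Some k then 'X_k - (Q 0 k)%:MP else 0.
have /eqP : (\prod_(Q <- s) sep Q).@[P 0] = 0.
  apply: clP => Q /= sQ.
  rewrite rmorph_prod /= (perm_big _ (perm_to_rem sQ)) /= big_cons /sep.
  by case: pickP => [k _|_]; rewrite ?mevalB ?mevalXU ?mevalC ?subrr ?meval0 mul0r.
rewrite rmorph_prod /= prodf_seq_eq0 => /hasP[Q sQ] /=.
rewrite /sep; case: pickP => [k ne_k|eqPQ _].
  by rewrite mevalB mevalXU mevalC subr_eq0 (negPf ne_k).
case/negP: sP; suff -> : P = Q by [].
by apply/rowP=> k; apply/eqP; rewrite -[_ == _]negbK eqPQ.
Qed.

Lemma finite_Per_isolated d (f : endo d) :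
  (forall n, (1 <= n)%N -> finite_set (Per_n f n)) -> forall P, isolated_periodic f P.
Proof.
by move=> finf P n n_gt0 /(finite_zariski_closed (finite_setD _ (finf n n_gt0)))[_ /=]; apply.
Qed.

(** * Finite places of number fields *)

(* [phi] is the reduction of the order [iota A] of [K] modulo a prime [P] over [p] that is
   unramified: [c], which is outside [P], multiplies [P] into [p A]. *)
Section PlaceOfResidueMap.

Variables (K : fieldExtType rat) (kappa : finFieldType) (A : comNzRingType).
Variables (iota : {rmorphism A -> K}) (phi : {rmorphism A -> kappa}) (p c : A).
Hypotheses (p_neq0 : iota p != 0) (phip : phi p = 0) (phic : phi c != 0).
Hypothesis iota_phi0 : forall a, iota a = 0 -> phi a = 0.
Hypothesis phi_surj : forall x, exists a, phi a = x.
Hypothesis iota_frac : forall x, exists n s a,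
  phi s != 0 /\ iota s * (iota p ^+ n * x) = iota a.
Hypothesis kerP : forall a, phi a = 0 -> exists b, iota (c * a) = iota (p * b).

(** [x] is [iota p ^ e] times a quotient of elements outside the prime; this [e] will be the value
    of [x]. *)
Let is_val x e := exists s u,
  [/\ phi s != 0, phi u != 0 & iota s * x = iota p ^ e * iota u].

(** As long as the reduction vanishes, multiplication by [c] allows a factor [p] to be split off. A
    denominator [p ^+ m] of the inverse of [iota a] bounds the number of rounds: after [m] of them
    [c ^+ m * s] and [a' * b] have the same image, with [a'] in the prime but [c] and [s]
    outside. *)
Let is_val_iota a : iota a != 0 -> exists e, is_val (iota a) e.
Proof.
move=> a0; have [m [s [b [s0 Db]]]] := iota_frac (iota a)^-1.
have step N : (exists e, is_val (iota a) e) \/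
    exists2 a', phi a' = 0 & iota (c ^+ N * a) = iota (p ^+ N * a').
  elim: N => [|N [|[a' phia' Da']]]; [|by left|].
    have [a_0|nz] := eqVneq (phi a) 0; first by right; exists a.
    by left; exists 0, 1, a; rewrite !rmorph1 oner_neq0 mul1r.
  have [a2 Da2] := kerP phia'.
  have Da2' : iota (c ^+ N.+1 * a) = iota (p ^+ N.+1 * a2).
    rewrite exprS -mulrA [LHS]rmorphM Da' -rmorphM mulrCA [LHS]rmorphM Da2 -rmorphM.
    by rewrite mulrA -exprSr.
  have [?|nz] := eqVneq (phi a2) 0; first by right; exists a2.
  left; exists N.+1, (c ^+ N.+1), a2; rewrite rmorphXn expf_neq0 //; split=> //.
  by rewrite -exprnP -rmorphXn -!rmorphM Da2'.
have [//|[a' phia' Da']] := step m.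
have : iota (c ^+ m * s) = iota (a' * b).
  apply: (mulIf a0); apply: (mulfI (expf_neq0 m p_neq0)).
  rewrite [iota (a' * b)]rmorphM -Db; set P := iota p ^+ m.
  transitivity (P * iota s * iota (c ^+ m * a)); first by rewrite !rmorphM; ring.
  by rewrite Da' rmorphM rmorphXn -/P; field.
move/eqP; rewrite -subr_eq0 -rmorphB => /eqP/iota_phi0/eqP.
by rewrite rmorphB !rmorphM phia' mul0r subr0 rmorphXn mulf_eq0 expf_eq0 (negPf phic) andbF (negPf s0).
Qed.

Let is_val_ex (x : K) : x != 0 -> exists e, is_val x e.
Proof.
move=> x0; have [n [s [a [s0 Da]]]] := iota_frac x.
have is0 : iota s != 0 by apply: contraNneq s0 => /iota_phi0 ->.
have [|e [s' [u [s0' u0 Dx]]]] := @is_val_iota a.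
  by rewrite -Da !mulf_neq0 ?expf_neq0.
exists (e - n%:Z), (s' * s), u; rewrite rmorphM mulf_neq0 //; split=> //.
have De : iota p ^+ n * iota p ^ (e - n%:Z) = iota p ^ e.
  by rewrite exprnP -expfzDr // addrC subrK.
by apply: (mulfI (expf_neq0 n p_neq0)); rewrite [RHS]mulrA De -Dx -Da rmorphM; ring.
Qed.

Let is_val_le x e e' : is_val x e -> is_val x e' -> (e <= e')%R.
Proof.
case=> s [u [s0 u0 Dx]] [s' [u' [s0' u0' Dx']]]; rewrite leNgt.
apply/negP=> lt_e'e; have [k Dk] : exists k : nat, e = e' + k.+1%:Z.
  by exists `|e - e'|.-1; lia.
have : iota (s * u') = iota (s' * (u * p ^+ k.+1)).
  apply: (mulfI (expfz_neq0 e' p_neq0)).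
  rewrite !rmorphM mulrCA -Dx' mulrCA Dx Dk expfzDr // -exprnP rmorphXn; ring.
move/eqP; rewrite -subr_eq0 -rmorphB => /eqP/iota_phi0/eqP.
by rewrite rmorphB !rmorphM rmorphXn phip expr0n !mulr0 subr0 mulf_eq0 (negPf s0) (negPf u0').
Qed.

Let is_val_inj x e e' : is_val x e -> is_val x e' -> e = e'.
Proof. by move=> v v'; apply/eqP; rewrite eq_le (is_val_le v v') (is_val_le v' v). Qed.

Lemma place_of_residue_map : exists v : K -> int,
  [/\ finite_places v, residue_card v = #|kappa|, v (iota p) = 1 &
    forall a, [/\ 0 <= v (iota a), phi a != 0 -> v (iota a) = 0
               & phi a = 0 -> iota a != 0 -> 0 < v (iota a)]].
Proof.
have /choice[v0 Dv0] (x : K) : exists e, x != 0 -> is_val x e.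
  by have [->|/is_val_ex[e]] := eqVneq x 0; [exists 0 | exists e].
pose v (x : K) : int := if x == 0 then 0 else v0 x.
have valP (x : K) : x != 0 -> is_val x (v x).
  by move=> x0; rewrite /v (negPf x0); apply: Dv0.
have v_eq (x : K) e : x != 0 -> is_val x e -> v x = e.
  by move=> /valP; apply: is_val_inj.
have iota_neq0 a : phi a != 0 -> iota a != 0.
  by apply: contraNneq => /iota_phi0 ->.
have v_unit a : phi a != 0 -> v (iota a) = 0.
  move=> a0; apply: v_eq; first exact: iota_neq0.
  by exists 1, a; rewrite !rmorph1 oner_neq0 expr0z.
have v_ge0 a : 0 <= v (iota a).
  have [->|a0] := eqVneq (iota a) 0; first by rewrite /v eqxx.
  have [s [u [s0 u0 Dx]]] := valP _ a0.
  rewrite leNgt; apply/negP=> /= lt0; have [k Dk] : exists k : nat, v (iota a) = - k.+1%:Z.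
    by exists `|v (iota a)|.-1; lia.
  have : iota u = iota (p ^+ k.+1 * (s * a)).
    by rewrite !rmorphM Dx mulrA Dk -exprnN rmorphXn mulfV ?mul1r ?expf_neq0.
  move/eqP; rewrite -subr_eq0 -rmorphB => /eqP/iota_phi0/eqP.
  by rewrite rmorphB rmorphM rmorphXn phip expr0n mul0r subr0 (negPf u0).
have v_gt0 a : phi a = 0 -> iota a != 0 -> 0 < v (iota a).
  move=> phia a0; rewrite lt_def v_ge0 andbT; apply/eqP => va.
  have [s [u [s0 u0]]] := valP _ a0; rewrite va expr0z mul1r -rmorphM => /eqP.
  rewrite -subr_eq0 -rmorphB => /eqP/iota_phi0/eqP.
  by rewrite rmorphB rmorphM phia mulr0 sub0r oppr_eq0 (negPf u0).
have vM (x y : K) : x != 0 -> y != 0 -> v (x * y) = v x + v y.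
  move=> x0 y0; have [s [u [s0 u0 Dx]]] := valP x x0.
  have [s' [u' [s0' u0' Dy]]] := valP y y0.
  apply: v_eq; first by rewrite mulf_neq0.
  exists (s * s'), (u * u'); rewrite !rmorphM !mulf_neq0 //; split=> //.
  by rewrite mulrACA Dx Dy expfzDr // mulrACA.
have vp : v (iota p) = 1.
  by apply: v_eq => //; exists 1, 1; rewrite !rmorph1 oner_neq0 expr1z mul1r mulr1.
have vD (x y : K) : x != 0 -> y != 0 -> x + y != 0 -> Num.min (v x) (v y) <= v (x + y).
  wlog le_xy : x y / v x <= v y => [W|] x0 y0 xy0.
    have [le_v|/ltW le_v] := leP (v x) (v y).
      by have := W x y le_v x0 y0 xy0; rewrite min_l.
    by have := W y x le_v y0 x0; rewrite addrC min_l //; apply.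
  rewrite min_l //; have [s [u [s0 u0 Dx]]] := valP x x0.
  have [s' [u' [s0' u0' Dy]]] := valP y y0.
  have [k Dk] : exists k : nat, v y = v x + k%:Z
    by exists `|v y - v x|%N; rewrite gez0_abs ?subr_ge0 //; ring.
  pose w := s' * u + s * (p ^+ k * u').
  have Dw : iota (s * s') * (x + y) = iota p ^ v x * iota w.
    transitivity (iota s' * (iota s * x) + iota s * (iota s' * y)); first by rewrite rmorphM; ring.
    rewrite Dx Dy Dk expfzDr // -[iota p ^ k%:Z]/(iota p ^+ k) /w (rmorphD iota) !(rmorphM iota).
    rewrite (rmorphXn iota).
    by move: (_ ^ v x) => P; clear; ring.
  have ss0 : phi (s * s') != 0 by rewrite rmorphM mulf_neq0.
  have w0 : iota w != 0.
    have : iota (s * s') * (x + y) != 0 by rewrite mulf_neq0 // iota_neq0.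
    by rewrite Dw mulf_eq0 negb_or => /andP[].
  have [s2 [u2 [s20 u20 Dw2]]] := valP _ w0.
  rewrite (@v_eq (x + y) (v x + v (iota w))) //; first by rewrite lerDl.
  exists (s2 * (s * s')), u2; rewrite rmorphM mulf_neq0 //; split=> //.
  by rewrite rmorphM -mulrA Dw mulrCA Dw2 mulrA -expfzDr.
have place_v : finite_places v.
  by split=> //; [rewrite /v eqxx | exists (iota p)].
exists v; split=> //; last first.
  by move=> a; split; [exact: v_ge0 | exact: v_unit | exact: v_gt0].
have idealE a : valuation_ideal v (iota a) <-> phi a = 0.
  split=> [[/iota_phi0 //|va]|phia]; last first.
    by have [|a0] := eqVneq (iota a) 0; [left | right; apply: v_gt0].
  by apply: contraTeq va => /v_unit ->; rewrite ltxx.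
have idealD (x y : K) : valuation_ideal v x -> valuation_ideal v y -> valuation_ideal v (x + y).
  move=> [->|vx] [->|vy]; rewrite ?addr0 ?add0r; [by left|by right|by right|].
  have [->|x0] := eqVneq x 0; first by rewrite add0r; right.
  have [->|y0] := eqVneq y 0; first by rewrite addr0; right.
  have [|xy0] := eqVneq (x + y) 0; first by left.
  by right; apply: lt_le_trans (vD _ _ x0 y0 xy0); rewrite lt_min vx.
have vN1 : v (-1) = 0 by rewrite -(rmorph1 iota) -rmorphN v_unit // rmorphN1 oppr_eq0 oner_neq0.
have idealN (x : K) : valuation_ideal v x -> valuation_ideal v (- x).
  move=> [->|vx]; first by left; rewrite oppr0.
  have [->|x0] := eqVneq x 0; first by left; rewrite oppr0.
  by right; rewrite -mulN1r vM ?oppr_eq0 ?oner_neq0 // vN1 add0r.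
have /choice[lift Dlift] x : exists a, phi a = x by apply: phi_surj.
pose cls x : set K := [set y | valuation_ideal v (y - iota (lift x))].
have cls_inj : injective cls.
  move=> x y eq_xy; have : cls y (iota (lift x)).
    by rewrite -eq_xy /cls /= subrr; left.
  rewrite /cls /= -rmorphB => /idealE/eqP; rewrite rmorphB !Dlift subr_eq0 => /eqP //.
suff Dres : residue_field v = cls @` [set: kappa].
  rewrite /residue_card Dres; apply/card_fset_set.
  apply: (card_eq_trans (inj_card_eq (in2W cls_inj))).
  rewrite card_eq_sym; apply: (card_eq_trans card_II).
  have <- : enum_rank @` [set: kappa] = [set: 'I_#|kappa|].
    by apply/seteqP; split=> // k _; exists (enum_val k) => //; apply: enum_valK.
  exact: (inj_card_eq (in2W enum_rank_inj)).
apply/seteqP; split=> [_ [x Vx <-]|_ [x _ <-]]; last first.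
  by exists (iota (lift x)) => //; right.
(* For x = p^k u / s and [s'] inverse to [s] modulo the prime, x differs from s' p^k u by (1 - s' s)
   x, which has positive value. *)
have [a Da] : exists a, valuation_ideal v (x - iota a).
  have [->|x0] := eqVneq x 0; first by exists 0; rewrite rmorph0 subrr; left.
  have {}Vx : 0 <= v x by case: Vx => // /eqP; rewrite (negPf x0).
  have [s [u [s0 u0 Dx]]] := valP x x0.
  have [k Dk] : exists k : nat, v x = k%:Z by exists `|v x|%N; lia.
  have [s' Ds'] := phi_surj (phi s)^-1.
  exists (s' * (p ^+ k * u)); rewrite !rmorphM rmorphXn exprnP -Dk -Dx mulrA -rmorphM.
  rewrite -[X in X - _]mul1r -mulrBl -(rmorph1 iota) -rmorphB.
  have : valuation_ideal v (iota (1 - s' * s)).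
    by apply/idealE; rewrite rmorphB rmorphM Ds' mulVf // rmorph1 subrr.
  case=> [->|vs]; first by left; rewrite mul0r.
  have [->|s1] := eqVneq (iota (1 - s' * s)) 0; first by left; rewrite mul0r.
  by right; rewrite vM // ltr_wpDr.
exists (phi a) => //.
have Dlift_a : valuation_ideal v (iota a - iota (lift (phi a))).
  by rewrite -rmorphB; apply/idealE; rewrite rmorphB Dlift subrr.
apply/seteqP; split=> y /=; rewrite /cls /= => Iy.
  have -> : y - x = (y - iota (lift (phi a))) - ((x - iota a) + (iota a - iota (lift (phi a)))) by ring.
  by apply: (idealD _ _ Iy); apply: idealN; apply: (idealD _ _ Da).
have -> : y - iota (lift (phi a)) = (y - x) + ((x - iota a) + (iota a - iota (lift (phi a)))) by ring.
by apply: (idealD _ _ Iy); apply: (idealD _ _ Da).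
Qed.

End PlaceOfResidueMap.

(** * Weak approximation and finiteness statements for places *)

Section FinitePlaces.

Variable K : fieldExtType rat.
Implicit Types (v w : K -> int) (x y : K) (n : nat).

Lemma natr_ext_eq0 n : (n%:R == 0 :> K) = (n == 0%N).
Proof. by rewrite -(rmorph_nat (in_alg K)) fmorph_eq0 pnatr_eq0. Qed.

Section OnePlace.
Variable v : K -> int.
Hypothesis place_v : finite_places v.

Lemma place0 : v 0 = 0. Proof. by case: place_v. Qed.

Lemma placeM x y : x != 0 -> y != 0 -> v (x * y) = v x + v y.
Proof. by case: place_v => _ + _ _; apply. Qed.

Lemma placeD x y : x != 0 -> y != 0 -> x + y != 0 -> Num.min (v x) (v y) <= v (x + y).
Proof. by case: place_v => _ _ + _; apply. Qed.

Lemma place1 : v 1 = 0.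
Proof.
have := @placeM 1 1 (oner_neq0 _) (oner_neq0 _).
by rewrite mulr1 => /eqP; rewrite -subr_eq0 opprD addNKr oppr_eq0 => /eqP.
Qed.

Lemma placeN x : v (- x) = v x.
Proof.
have [->|x0] := eqVneq x 0; first by rewrite oppr0.
have N1 : (-1 : K) != 0 by rewrite oppr_eq0 oner_neq0.
have := placeM N1 N1; rewrite mulrNN mulr1 place1 => vN1.
by rewrite -mulN1r placeM //; move: (v (-1)) vN1 => m; lia.
Qed.

Lemma placeV x : v x^-1 = - v x.
Proof.
have [->|x0] := eqVneq x 0; first by rewrite invr0 place0.
have := @placeM x x^-1 x0; rewrite invr_eq0 mulfV // place1 => /(_ x0).
by move: (v x^-1) (v x) => m m'; lia.
Qed.

Lemma placeX x n : v (x ^+ n) = v x *+ n.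
Proof.
have [->|x0] := eqVneq x 0; last first.
  by elim: n => [|n IHn]; rewrite ?place1 // exprS mulrS placeM ?expf_neq0 // IHn.
by rewrite expr0n place0 mul0rn; case: n => [|n] /=; rewrite ?place1 ?place0.
Qed.

Lemma placeD_lt x y : x != 0 -> (y != 0 -> v x < v y) -> x + y != 0 /\ v (x + y) = v x.
Proof.
move=> x0; have [->|y0 /(_ isT) lt_xy] := eqVneq y 0; first by rewrite addr0.
have xy0 : x + y != 0.
  by rewrite addr_eq0; apply: contraTneq lt_xy => ->; rewrite placeN ltxx.
split=> //; apply/le_anti; rewrite andbC.
have := placeD x0 y0 xy0; rewrite min_l ?(ltW lt_xy) // => -> /=.
have := @placeD (x + y) (- y) xy0; rewrite oppr_eq0 addrK placeN => /(_ y0 x0).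
by rewrite ge_min => /orP[//|]; rewrite leNgt lt_xy.
Qed.

Lemma place_add_gt x y (m : int) : (x != 0 -> m < v x) -> (y != 0 -> m < v y) ->
  x + y != 0 -> m < v (x + y).
Proof.
have [->|x0] := eqVneq x 0; first by rewrite add0r => _ + y0; apply.
have [->|y0 vx vy xy0] := eqVneq y 0; first by rewrite addr0 => + _ _; apply.
by apply: lt_le_trans (placeD x0 y0 xy0); rewrite lt_min vx ?vy.
Qed.

Lemma place_sum_gt (I : Type) (r : seq I) (P : pred I) (F : I -> K) (m : int) :
  (forall k, P k -> F k != 0 -> m < v (F k)) -> \sum_(k <- r | P k) F k != 0 ->
  m < v (\sum_(k <- r | P k) F k).
Proof.
move=> gtF; elim/big_rec: _ => [|k x Pk IHx]; first by rewrite eqxx.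
by apply: place_add_gt => //; apply: gtF.
Qed.

Lemma place_nat_ge0 n : 0 <= v n%:R.
Proof.
elim: n => [|n IHn]; first by rewrite place0.
have [->|n1] := eqVneq (n.+1%:R : K) 0; first by rewrite place0.
have [n0|n0] := eqVneq (n%:R : K) 0; first by rewrite -natr1 n0 add0r place1.
by rewrite -natr1; apply: le_trans (placeD n0 (oner_neq0 _) _); rewrite ?natr1 // le_min IHn place1.
Qed.

Lemma place_int_ge0 (a : int) : 0 <= v a%:~R.
Proof. by case: (intP a) => [|n|n]; rewrite ?mulrNz ?placeN ?place_nat_ge0. Qed.

(** By Bezout, positive values at both [a] and [p] would give 1 a positive value. *)
Lemma place_int_coprime (p : nat) (a : int) : prime p -> 0 < v p%:R -> ~~ (p %| `|a|)%N ->
  v a%:~R = 0.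
Proof.
move=> p_pr vp pa; apply/le_anti; rewrite place_int_ge0 andbT leNgt; apply/negP=> va.
have /eqP cop : coprimez a p by rewrite coprimez_sym coprimezE /= prime_coprime.
have [[b d] _ /= Dbd] : exists2 bd : int * int, True & bd.1 * a + bd.2 * p = 1.
  by have [b [d Dbd]] := Bezoutz a p; exists (b, d) => //; rewrite Dbd cop.
have pos (m c : int) : 0 < v c%:~R -> (m * c)%:~R != 0 :> K -> 0 < v (m * c)%:~R.
  rewrite intrM mulf_eq0 negb_or => vc /andP[m0 c0].
  by rewrite placeM //; apply: ltr_wpDl => //; apply: place_int_ge0.
have := @place_add_gt (b * a)%:~R (d * p)%:~R 0 (pos b a va) (pos d (p : int) vp).
by rewrite -intrD Dbd place1 ltxx oner_neq0 => /(_ isT).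
Qed.

End OnePlace.

(** Otherwise nonnegative values of [v] give nonnegative values of [w], so units of [v] are units of
    [w] and [w] is a multiple of [v]; as both take the value 1, they are equal. *)
Lemma place_dominates v w : finite_places v -> finite_places w -> v <> w ->
  exists a, [/\ a != 0, 0 <= v a & w a < 0].
Proof.
move=> pv pw neq_vw; apply: contrapT => no_a; apply: neq_vw.
have ge0 a : a != 0 -> 0 <= v a -> 0 <= w a.
  by move=> a0 va; rewrite leNgt; apply/negP=> wa; apply: no_a; exists a.
have eq0 a : a != 0 -> v a = 0 -> w a = 0.
  move=> a0 va; have := ge0 a a0; have := ge0 a^-1; rewrite invr_eq0 !placeV // va oppr0.
  by move=> /(_ a0); move: (w a) => m; lia.
have [_ _ _ [pi pi0 vpi]] := pv.
have wE a : a != 0 -> w a = w pi * v a.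
  move=> a0; have exp_w u n : u != 0 -> w (u ^+ n) = w u * n%:Z by move=> u0; rewrite placeX // pmulrn mulrzz.
  have [n Dn] : exists n : nat, v a = n%:Z \/ v a = - n%:Z.
    by exists `|v a|%N; move: (v a) => m; lia.
  have pin0 : pi ^+ n != 0 by rewrite expf_neq0.
  case: Dn => Dn.
    have := eq0 (a / pi ^+ n); rewrite mulf_neq0 ?invr_eq0 // !placeM ?invr_eq0 // !placeV // exp_w //.
    by rewrite placeX // vpi Dn natz subrr => /(_ isT erefl); lia.
  have := eq0 (a * pi ^+ n); rewrite mulf_neq0 // !placeM // exp_w //.
  by rewrite placeX // vpi Dn natz addNr => /(_ isT erefl); lia.
have [_ _ _ [x x0 wx]] := pw.
have wpi1 : w pi = 1.
  have := ge0 pi pi0; rewrite vpi => /(_ isT); have := wE x x0; rewrite wx.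
  move: (w pi) (v x) => m m' E m_ge0.
  have [m'_le0|m'_ge1] : m' <= 0 \/ 1 <= m' by lia.
    by nia.
  by nia.
apply: funext => a; have [->|a0] := eqVneq a 0; first by rewrite !place0.
by rewrite wE // wpi1 mul1r.
Qed.

Lemma separate_two_places v w : finite_places v -> finite_places w -> v <> w ->
  exists x, [/\ x != 0, v x < 0 & 0 < w x].
Proof.
move=> pv pw neq_vw; have [a [a0 va wa]] := place_dominates pv pw neq_vw.
have [b [b0 wb vb]] := place_dominates pw pv (nesym neq_vw).
exists (b / a); rewrite mulf_neq0 ?invr_eq0 //; split=> //.
  by rewrite placeM ?invr_eq0 // placeV //; lia.
by rewrite placeM ?invr_eq0 // placeV //; lia.
Qed.

(** Let x serve the first n places and y the new one. If x has value 0 at the new place,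
    [x ^+ m * y] works for large m. If its value there is negative, x^m is replaced by x^m / (1 +
    x^m), which has value 0 at [v] and at the new place and keeps the value of x^m at the others. *)
Lemma separate_places v (w : nat -> K -> int) n : finite_places v ->
  (forall i, (i < n)%N -> finite_places (w i) /\ v <> w i) ->
  exists x, [/\ x != 0, v x < 0 & forall i, (i < n)%N -> 0 < w i x].
Proof.
move=> pv; elim: n => [|n IHn] pw.
  have [_ _ _ [x x0 vx]] := pv; exists x^-1; rewrite invr_eq0; split=> //.
  by rewrite placeV // vx.
have [k lt_kn|x [x0 vx wx]] := IHn; first by apply: pw; apply: ltnW.
have [pwn neq_wn] := pw n (ltnSn n).
have pwk k : (k < n)%N -> finite_places (w k) by move=> lt_kn; have [] := pw k (ltnW lt_kn).
have [wnx|wnx] := ltP 0 (w n x).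
  exists x; split=> // k; rewrite ltnS leq_eqVlt => /predU1P[-> //|]; exact: wx.
have [y [y0 vy wny]] := separate_two_places pv pwn neq_wn.
pose m := (\sum_(k < n) `|w k y|).+1.
have big k : (k < n)%N -> 0 < w k x *+ m + w k y.
  move=> lt_kn; have := wx k lt_kn; have : (`|w k y| < m)%N.
    by rewrite ltnS (bigD1 (Ordinal lt_kn)) //= leq_addr.
  rewrite pmulrn mulrzz; move: m (w k x) (w k y) => m' a b; nia.
have xm0 : x ^+ m != 0 by rewrite expf_neq0.
move: wnx; rewrite le_eqVlt => /predU1P[wnx|wnx].
  exists (x ^+ m * y); rewrite mulf_neq0 //; split=> // [|k].
    by rewrite placeM // placeX // -[0]addr0; apply: ltrD => //; rewrite pmulrn_llt0.
  rewrite ltnS leq_eqVlt => /predU1P[->|lt_kn].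
    by rewrite placeM // placeX // wnx mul0rn add0r.
  by rewrite placeM ?placeX ?big //; apply: pwk.
have neg_den u : finite_places u -> u x < 0 -> 1 + x ^+ m != 0 /\ u (1 + x ^+ m) = u (x ^+ m).
  move=> pu ux; rewrite addrC; apply: placeD_lt => // _.
  by rewrite place1 // placeX // pmulrn_llt0.
have [den0 vden] := neg_den v pv vx; have [_ wden] := neg_den _ pwn wnx.
exists (x ^+ m / (1 + x ^+ m) * y); rewrite !mulf_neq0 ?invr_eq0 //; split=> // [|k].
  by rewrite !placeM ?mulf_neq0 ?invr_eq0 // placeV // vden subrr add0r.
rewrite ltnS leq_eqVlt => /predU1P[->|lt_kn].
  by rewrite !placeM ?mulf_neq0 ?invr_eq0 // placeV // wden subrr add0r.
have pk := pwk k lt_kn; rewrite !placeM ?mulf_neq0 ?invr_eq0 // placeV //.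
have [_ ->] : 1 + x ^+ m != 0 /\ w k (1 + x ^+ m) = w k 1.
  by apply: placeD_lt; rewrite ?oner_neq0 // => _; rewrite place1 // placeX // pmulrn_lgt0 // wx.
by rewrite place1 // subr0 placeX // big.
Qed.

(* By weak approximation there are elements that are units at exactly one of the places; these are
   linearly independent over Q. *)
Lemma places_over_prime_le (p r : nat) (v : nat -> K -> int) : prime p ->
  (forall i, (i < r)%N -> finite_places (v i) /\ 0 < v i p%:R) ->
  (forall i j, (i < r)%N -> (j < r)%N -> v i = v j -> i = j) ->
  (r <= \dim {:K})%N.
Proof.
move=> p_pr pv v_inj.
have sep (k : 'I_r) : exists y, [/\ y != 0, v k y = 0 & forall j : 'I_r, j != k -> 0 < v j y].
  have [pk _] := pv k (ltn_ord k).
  have lt_bump j : (j < r.-1)%N -> (bump k j < r)%N.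
    by move: (ltn_ord k); rewrite /bump; case: leqP; lia.
  have [j lt_jr|x [x0 vx wx]] := @separate_places (v k) (fun j => v (bump k j)) r.-1 pk.
    have [? _] := pv _ (lt_bump j lt_jr); split=> // /v_inj.
    by move=> /(_ (ltn_ord k) (lt_bump _ lt_jr))/eqP; rewrite (negPf (neq_bump _ _)).
  have [den0 vden] : x + 1 != 0 /\ v k (x + 1) = v k x.
    by apply: placeD_lt => // _; rewrite place1.
  (* Where x has a pole the quotient x / (x + 1) is a unit; where x has positive value, so does the
     quotient. *)
  exists (x / (x + 1)); rewrite mulf_neq0 ?invr_eq0 //; split=> //.
    by rewrite placeM ?invr_eq0 // placeV // vden subrr.
  move=> j neq_jk; have [pj _] := pv j (ltn_ord j).
  have vjx : 0 < v j x.
    have Dj : bump k (unbump k j) = j by apply: unbumpK; rewrite inE.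
    have := wx (unbump k j); rewrite Dj; apply.
    have := ltn_ord j; have := ltn_ord k.
    by have : (j != k :> nat) by []; rewrite /unbump; move: (nat_of_ord j) (nat_of_ord k); lia.
  have [_ vjden] : 1 + x != 0 /\ v j (1 + x) = v j 1.
    by apply: placeD_lt; rewrite ?oner_neq0 // place1.
  by rewrite placeM ?invr_eq0 // placeV // [x + 1]addrC vjden place1 // subr0.
have /choice[y Dy] := sep.
pose Y := [tuple y k | k < r].
suff /eqP DY : free Y by rewrite -(size_tuple Y) -DY; apply: dimvS; apply: subvf.
apply/freeP => a sum0 k; apply: contrapT => /eqP ak.
(* Integrality of a rational number is the same at all places over p. *)
have v_rat (i j : 'I_r) (q : rat) : q != 0 -> 0 <= v i q%:A -> 0 <= v j q%:A.
  move=> q0; have [pi vi] := pv i (ltn_ord i); have [pj vj] := pv j (ltn_ord j).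
  have Dq : q%:A = (numq q)%:~R / (denq q)%:~R :> K.
    by rewrite -[in LHS](divq_num_den q) -[_%:A]/(in_alg K _) fmorph_div !rmorph_int.
  have num0 : (numq q)%:~R != 0 :> K by rewrite -(rmorph_int (in_alg K)) fmorph_eq0 intr_eq0 numq_eq0.
  have den0 : (denq q)%:~R != 0 :> K by rewrite -(rmorph_int (in_alg K)) fmorph_eq0 intr_eq0 denq_eq0.
  rewrite Dq !placeM ?invr_eq0 // !placeV // => viq.
  have p_den : ~~ (p %| `|denq q|)%N.
    apply/negP=> p_den; have p_num : ~~ (p %| `|numq q|)%N.
      apply/negP=> p_num; have := coprime_num_den q; rewrite /coprime => /eqP cop.
      by have := dvdn_gcd p `|numq q| `|denq q|; rewrite p_num p_den cop gtnNdvd ?prime_gt1.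
    move: viq; rewrite (place_int_coprime pi p_pr vi p_num) leNgt sub0r oppr_lt0 => /negP; apply.
    have /dvdnP[m Dm] := p_den; have /gtz0_abs Dden := denq_gt0 q.
    move: den0; rewrite -Dden Dm PoszM intrM mulf_eq0 negb_or => /andP[m0 p0].
    by rewrite placeM // ltr_wpDl // place_int_ge0.
  by rewrite (place_int_coprime pj p_pr vj p_den) subr0 place_int_ge0.
(* Dividing the relation by a coefficient of least value makes all coefficients integral over p. At
   the place [l] the other terms then have positive value, but [y l] has value 0. *)
case: (@Order.TotalTheory.arg_minP _ _ _ k (fun l => a l != 0) (fun l => v k (a l)%:A)) => // l al minl.
have [pl vl] := pv l (ltn_ord l).
have inA0 (q : rat) : q != 0 -> q%:A != 0 :> K by rewrite scaler_eq0 oner_eq0 orbF.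
pose b j := a j / a l.
have Dyl : y l = - \sum_(j | j != l) (b j)%:A * y j.
  have : \sum_j a j *: y j = 0.
    by rewrite -[RHS]sum0; apply: eq_bigr => j _; rewrite -tnth_nth tnth_mktuple.
  rewrite (bigD1 l) //= => /eqP; rewrite addr_eq0 => /eqP Dal.
  have <- : (a l)^-1 *: (a l *: y l) = y l by rewrite scalerA mulVf // scale1r.
  rewrite Dal scalerN scaler_sumr; congr (- _); apply: eq_bigr => j _.
  by rewrite mulr_algl scalerA mulrC.
have [yl0 vyl _] := Dy l; have : 0 < v l (y l); last by rewrite vyl ltxx.
rewrite Dyl placeN //; apply: place_sum_gt => // [j neq_jl nz|]; last by rewrite -oppr_eq0 -Dyl.
have [_ _ vyj] := Dy j; have vlyj : 0 < v l (y j) by apply: vyj; rewrite eq_sym.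
move: nz; rewrite mulf_eq0 negb_or => /andP[bj0 yj0].
rewrite placeM //; apply: ltr_wpDl => //.
have bj_neq0 : b j != 0 by apply: contraNneq bj0 => ->; rewrite scale0r.
have [pk vk] := pv k (ltn_ord k).
apply: (v_rat k) => //; rewrite -[_%:A]/(in_alg K _) fmorph_div placeM ?invr_eq0 ?fmorph_eq0 //.
  rewrite placeV // subr_ge0; apply: minl.
  by apply: contraNneq bj_neq0; rewrite /b => ->; rewrite mul0r.
by apply: contraNneq bj_neq0; rewrite /b => ->; rewrite mul0r.
Qed.

Lemma finite_places_over_prime (p : nat) : prime p ->
  finite_set [set v : K -> int | finite_places v /\ 0 < v p%:R].
Proof.
move=> p_pr; apply: contrapT => inf; have [B subB ltB] := infinite_set_fset (\dim {:K}).+1 inf.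
pose v0 : K -> int := fun=> 0.
suff : (#|` B| <= \dim {:K})%N by rewrite leqNgt ltB.
apply: (@places_over_prime_le p _ (nth v0 (enum_fset B))) => // [j lt_jB|j k lt_jB lt_kB /eqP].
  by apply: subB; apply: mem_nth.
by rewrite nth_uniq ?fset_uniq // => /eqP.
Qed.

Lemma place_nat_gt0 v n : finite_places v -> 0 < v n%:R ->
  exists2 p, p \in primes n & 0 < v p%:R.
Proof.
move=> pv; have [m] := ubnP n; elim: m n => // m IHm n; rewrite ltnS => le_nm vn.
have n_gt1 : (1 < n)%N.
  by case: n vn {le_nm} => [|[|n]]; rewrite ?place0 ?place1 ?ltxx.
have p_pr := pdiv_prime n_gt1; have /dvdnP[d Dn] := pdiv_dvd n.
have n0 : (0 < n)%N by apply: ltnW.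
have d0 : (0 < d)%N by move: n0; rewrite Dn; case: (d).
have [vp|vp] := ltP 0 (v (pdiv n)%:R).
  by exists (pdiv n); rewrite // mem_primes p_pr n0 pdiv_dvd.
have [||q q_d vq] := IHm d; [| |exists q => //].
- by apply: leq_trans le_nm; rewrite Dn ltn_Pmulr ?prime_gt1.
- move: vn; rewrite [in n%:R]Dn natrM placeM ?natr_ext_eq0 -?lt0n ?pdiv_gt0 //.
  by move: vp; move: (v _) (v _) => a b; lia.
move: q_d; rewrite !mem_primes => /and3P[-> _ q_d] /=; rewrite n0 Dn /=.
exact: dvdn_mulr.
Qed.

Lemma integral_relation x : exists2 p : {poly int}, p != 0 & (map_poly intr p).[x] = 0.
Proof.
have [q Dq] := polyOver1P (minPolyOver 1 x); have [r [a a0 Dr]] := rat_poly_scale q.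
have q0 : q != 0.
  by have := monic_neq0 (monic_minPoly 1 x); rewrite Dq map_poly_eq0.
exists r; first by apply: contraNneq q0; rewrite Dr => ->; rewrite rmorph0 scaler0.
have Dr' : map_poly intr r = a%:~R *: q by rewrite Dr scalerA mulfV ?intr_eq0 // scale1r.
have : (map_poly (in_alg K) (map_poly intr r)).[x] = 0.
  rewrite Dr' map_polyZ /= -Dq hornerZ.
  by have /rootP -> := root_minPoly 1 x; rewrite mulr0.
rewrite -map_poly_comp; congr (_.[_] = 0); apply: eq_map_poly => m.
exact: (rmorph_int (in_alg K)).
Qed.

(** If the leading coefficient of an integral relation for [x] is a unit at a pole of [x], the
    leading term has smaller value than all the others, so they cannot cancel. Only places over the
    primes dividing that coefficient remain. *)
Lemma finite_places_neg x : finite_set [set v : K -> int | finite_places v /\ v x < 0].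
Proof.
have [q q0 qx] := integral_relation x.
pose N := `|lead_coef q|%N.
apply: (@sub_finite_set _ _ (\bigcup_(p in [set` primes N])
    [set v : K -> int | finite_places v /\ 0 < v p%:R])); last first.
  apply: bigcup_finite => [|p /=]; first exact: finite_seq.
  by rewrite mem_primes => /andP[/finite_places_over_prime].
move=> v /= [pv vx]; suff /(place_nat_gt0 pv)[p pN vp] : 0 < v N%:R by exists p.
have -> : v N%:R = v (lead_coef q)%:~R.
  rewrite /N; case: (lead_coef q) => n //.
  by rewrite NegzE mulrNz placeN.
rewrite lt_def place_int_ge0 // andbT; apply/negP => /eqP vlead.
have x0 : x != 0 by apply: contraTneq vx => ->; rewrite place0.
have lead0 : (lead_coef q)%:~R != 0 :> K.
  by rewrite -(rmorph_int (in_alg K)) fmorph_eq0 intr_eq0 lead_coef_eq0.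
have [d Dd] : exists d, size q = d.+1 by exists (size q).-1; rewrite prednK ?size_poly_gt0.
have := qx; rewrite (@horner_coef_wide _ d.+1) -?Dd ?size_poly // Dd big_ord_recr /=.
rewrite coef_map /= -[in q`_d](succnK d) -Dd -lead_coefE addrC => /eqP.
rewrite addr_eq0 => /eqP Dlead.
have : v x *+ d < v (lead_coef q)%:~R + v (x ^+ d).
  rewrite -placeM ?expf_neq0 // Dlead placeN //; apply: place_sum_gt => //; last first.
    by rewrite -oppr_eq0 -Dlead mulf_neq0 ?expf_neq0.
  move=> [j lt_jd] _ /=; rewrite coef_map mulf_eq0 negb_or => /andP[qj xj].
  rewrite placeM // placeX //; apply: ltr_wpDl; first exact: place_int_ge0.
  by rewrite !pmulrn !mulrzz; move: (v x) vx => m vx; nia.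
by rewrite vlead add0r placeX // ltxx.
Qed.

End FinitePlaces.

(** * Places obtained from factors of an integer polynomial modulo p *)

Section ReductionModPrime.

Variables (p : nat) (p_pr : prime p).

Lemma intr_Fp_eq0 (m : int) : (m%:~R == 0 :> 'F_p) = (p %| m)%Z.
Proof.
have nat_case (n : nat) : (n%:R == 0 :> 'F_p) = (p %| n)%N.
  by rewrite (dvdn_pcharf (pchar_Fp p_pr)).
by case: m => n; rewrite ?NegzE ?mulrNz ?oppr_eq0 ?dvdzN nat_case.
Qed.

Definition lift_Fp_poly (a : {poly 'F_p}) : {poly int} := map_poly (fun x : 'F_p => (x : nat)%:Z) a.

Lemma lift_Fp_polyK a : map_poly intr (lift_Fp_poly a) = a.
Proof.
apply/polyP=> k; rewrite coef_map coef_map_id0 //= -[RHS]natr_Zp.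
by rewrite pmulrn.
Qed.

Lemma reduction_eq0 (a : {poly int}) : map_poly intr a = 0 :> {poly 'F_p} ->
  exists b, a = p%:R * b.
Proof.
move=> a0; exists (\poly_(k < size a) (a`_k %/ p)%Z).
apply/polyP=> k; rewrite mulr_natl coefMn coef_poly -mulr_natr natz.
case: ltnP => [_|le_ak]; last by rewrite nth_default.
have /eqP := congr1 (fun b : {poly 'F_p} => b`_k) a0.
by rewrite coef_map coef0 intr_Fp_eq0 => /divzK.
Qed.

End ReductionModPrime.

Section ReductionModPsi.

Variables (p : nat) (psi : {poly 'F_p}) (mi_psi : monic_irreducible_poly psi).

Definition residue_poly (a : {poly int}) : {poly %/ psi with mi_psi} :=
  in_qpoly psi (map_poly intr a).

Lemma residue_poly_is_additive : zmod_morphism residue_poly.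
Proof. by move=> a b; rewrite /residue_poly rmorphB [LHS]raddfB. Qed.

Lemma residue_poly_is_multiplicative : monoid_morphism residue_poly.
Proof.
split=> [|a b]; rewrite /residue_poly; first by rewrite rmorph1; apply: in_qpoly1.
by rewrite rmorphM; apply: in_qpolyM.
Qed.

HB.instance Definition _ :=
  GRing.isZmodMorphism.Build {poly int} {poly %/ psi with mi_psi} residue_poly residue_poly_is_additive.
HB.instance Definition _ :=
  GRing.isMonoidMorphism.Build {poly int} {poly %/ psi with mi_psi} residue_poly
    residue_poly_is_multiplicative.

Lemma residue_poly_eq0 a : (residue_poly a == 0) = (psi %| map_poly intr a).
Proof.
rewrite -val_eqE /= (mk_monicE mi_psi) /dvdp.
by rewrite Pdiv.IdomainMonic.modpE // mi_psi.2.
Qed.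

End ReductionModPsi.

(** Pseudo-division by [g] multiplies [a] by a power of the leading coefficient, a unit modulo [p],
    and leaves remainder 0 by minimality of [g]. Hence reduction modulo [psi] is well defined on
    values at [t]. *)
Lemma dvdp_map_of_root (L : comNzRingType) (t : L) (g : {poly int}) (p : nat)
    (psi : {poly 'F_p}) :
    prime p -> psi %| map_poly intr g -> ~~ (p %| lead_coef g)%Z ->
    (map_poly intr g).[t] = 0 ->
    (forall a : {poly int}, (map_poly intr a).[t] = 0 -> (size a < size g)%N -> a = 0) ->
  forall a : {poly int}, (map_poly intr a).[t] = 0 -> psi %| map_poly intr a.
Proof.
move=> p_pr psi_g lead_g gt0 g_min a a0; have Da := Pdiv.Idomain.divp_eq a g.
have r0 : a %% g = 0.
  apply: g_min; last by rewrite ltn_modp; apply: contraNneq lead_g => ->; rewrite lead_coef0 dvdz0.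
  have := congr1 (fun b : {poly int} => (map_poly intr b).[t]) Da.
  by rewrite rmorphD rmorphM map_polyZ hornerD hornerM hornerZ a0 gt0 !mulr0 add0r.
have := congr1 (map_poly (intr : int -> 'F_p)) Da; rewrite r0 addr0 rmorphM map_polyZ /= => Da'.
have lead0 : (lead_coef g ^+ scalp a g)%:~R != 0 :> 'F_p.
  by rewrite rmorphXn expf_neq0 //= intr_Fp_eq0.
by rewrite -(dvdpZr _ _ lead0) Da' dvdp_mull.
Qed.

(** The order is Z[X] evaluated at [t] and the prime is (p, psi). A lift of [chi] plays the part of
    [c]: modulo p the product [psi * chi] is [g], which vanishes at [t], so it multiplies the prime
    into p times the order; it lies outside the prime by coprimality. *)
Lemma place_of_residue_factor (K : fieldExtType rat) (t : K) (g : {poly int}) (p : nat)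
    (psi chi : {poly 'F_p}) :
    prime p -> monic_irreducible_poly psi ->
    map_poly intr g = psi * chi -> coprimep psi chi -> ~~ (p %| lead_coef g)%Z ->
    (map_poly intr g).[t] = 0 ->
    (forall a : {poly int}, (map_poly intr a).[t] = 0 -> (size a < size g)%N -> a = 0) ->
    (forall x : K, exists a : {poly rat}, x = (map_poly (in_alg K) a).[t]) ->
  exists v : K -> int,
    [/\ finite_places v, residue_card v = (p ^ (size psi).-1)%N, v p%:R = 1 &
      forall a : {poly int}, let x := (map_poly intr a).[t] in
      [/\ 0 <= v x, ~~ (psi %| map_poly intr a) -> v x = 0
         & psi %| map_poly intr a -> x != 0 -> 0 < v x]].
Proof.
move=> p_pr mi Dg cop lead_g gt0 g_min K_gen.
pose iota : {rmorphism {poly int} -> K} := horner_eval t \o map_poly intr.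
pose phi : {rmorphism {poly int} -> {poly %/ psi with mi}} := @residue_poly p psi mi.
have polyC_int (m : int) : m%:P = m%:~R :> {poly int} by rewrite -{1}[m]intz rmorph_int.
have p0 : iota p%:R != 0 by rewrite rmorph_nat natr_ext_eq0 -lt0n prime_gt0.
have size_psi : (1 < size psi)%N by have [[]] := mi.
have phi_int (m : int) : (phi m%:~R == 0) = (p %| m)%Z.
  rewrite /phi /= residue_poly_eq0 rmorph_int -intr_Fp_eq0 // -(rmorph_int (@polyC 'F_p)).
  have [->|m0] := eqVneq; first by rewrite dvdp0.
  by apply/negbTE/negP => /dvdp_leq; rewrite polyC_eq0 m0 size_polyC m0 leqNgt size_psi => /(_ isT).
have phig : phi g = 0.
  by apply/eqP; rewrite /phi /= residue_poly_eq0 Dg dvdp_mulr.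
have phip : phi p%:R = 0 by apply/eqP; rewrite -[p%:R]/(p%:Z%:~R) phi_int dvdzz.
have iota_phi0 a : iota a = 0 -> phi a = 0.
  move=> a0; apply/eqP; rewrite /phi /= residue_poly_eq0.
  by apply: (dvdp_map_of_root p_pr _ lead_g gt0 g_min a0); rewrite Dg dvdp_mulr.
have phi_surj x : exists a, phi a = x.
  exists (lift_Fp_poly x); rewrite /phi /= /residue_poly lift_Fp_polyK; apply: val_inj.
  exact: in_qpoly_small (size_mk_monic x).
have iota_frac x : exists n s a, phi s != 0 /\ iota s * (iota p%:R ^+ n * x) = iota a.
  have [A ->] := K_gen x; have [B [m m0 ->]] := rat_poly_scale A.
  have absm0 : (0 < `|m|)%N by rewrite absz_gt0.
  have [m' cop_m' Dm] := pfactor_coprime p_pr absm0.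
  have m0K : m%:~R != 0 :> K by rewrite -(rmorph_int (in_alg K)) fmorph_eq0 intr_eq0.
  exists (logn p `|m|), m'%:R, ((sgz m)%:~R * B); split.
    by rewrite -[m'%:R]/(m'%:Z%:~R) phi_int /dvdz /= -prime_coprime.
  rewrite !rmorph_nat -natrX mulrA -natrM -Dm rmorphM rmorph_int.
  rewrite map_polyZ hornerZ -map_poly_comp.
  rewrite [map_poly (_ \o _) B](eq_map_poly (g := intr)) => [|k]; last first.
    exact: (rmorph_int (in_alg K)).
  rewrite (fmorphV (in_alg K)) (rmorph_int (in_alg K)) mulrA; congr (_ * _).
  apply: (mulIf m0K); rewrite mulfVK // -[LHS]/(`|m|%N%:Z%:~R) -intrM; congr _%:~R.
  by rewrite abszE normrEsg.
have kerP a : phi a = 0 -> exists b, iota (lift_Fp_poly chi * a) = iota (p%:R * b).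
  move/eqP; rewrite /phi /= residue_poly_eq0 => /dvdpP[B DB].
  have [|D /eqP] := @reduction_eq0 p p_pr (lift_Fp_poly chi * a - g * lift_Fp_poly B).
    by rewrite rmorphB !rmorphM /= !lift_Fp_polyK Dg DB; ring.
  rewrite subr_eq => /eqP ->; exists D; rewrite -[LHS]/(iota _) (rmorphD iota) (rmorphM iota g).
  by rewrite [iota g]gt0 mul0r addr0.
have [|v [pv card_v vp vP]] := place_of_residue_map p0 phip _ iota_phi0 phi_surj iota_frac kerP.
  rewrite /phi /= residue_poly_eq0 lift_Fp_polyK; apply/negP=> psi_chi.
  by have := coprimep_dvdl psi_chi cop; rewrite coprimepp gtn_eqF.
exists v; split=> //.
- by rewrite card_v card_qfpoly card_Fp.
- by move: vp; rewrite rmorph_nat.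
move=> a /=; have [v1 v2 v3] := vP a; split=> // [na|a_0].
  by apply: v2; rewrite /= residue_poly_eq0.
by apply: v3; apply/eqP; rewrite /= residue_poly_eq0.
Qed.

(** * A lower bound for the height *)

(** A sum over an infinite support is 0 by convention; finiteness of the support is what gives the
    right-hand side its intended meaning. *)
Lemma fsum_ge_seq (R : numDomainType) (I : choiceType) (P : set I) (F : I -> R) (L : seq I) :
    uniq L -> {in L, forall k, P k} -> (forall k, P k -> 0 <= F k) ->
    finite_set [set k | P k /\ F k != 0] ->
  \sum_(k <- L) F k <= \sum_(k \in P) F k.
Proof.
move=> uniqL LP F_ge0 finF.
pose S := [set k | P k /\ F k != 0] `|` [set` L].
have finS : finite_set S by rewrite /S finite_setU; split=> //; apply: finite_seq.
have SP : S `<=` P by move=> k [[]//|/= /LP].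
rewrite -(@fsbig_widen _ _ _ _ S P) // => [|k [/= Pk nSk]]; last first.
  by apply: contrapT => /eqP Fk; apply: nSk; left.
rewrite (fsbig_finite _ _ finS) /= [leRHS](bigID (mem L)) /= -[X in _ <= X + _]big_filter.
rewrite [X in _ <= X + _](perm_big L) /=; last first.
  apply: uniq_perm => // [|k]; first by rewrite filter_uniq ?fset_uniq.
  rewrite mem_filter; apply: andb_idr => Lk.
  by have := @in_fset_set _ S finS k => ->; apply/mem_set; right.
rewrite lerDl big_seq_cond sumr_ge0 // => k /andP[].
by have := @in_fset_set _ S finS k => -> /set_mem/SP/F_ge0.
Qed.

Section HeightLowerBound.

Variables (R : realType) (K : fieldExtType rat) (s : seq K).
Hypothesis s1 : 1 \in s.

Lemma finite_norm_le1 (v : K -> int) x : 0 <= v x -> finite_norm R v x <= 1.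
Proof.
rewrite /finite_norm; case: eqP => // _ vx.
have [n ->] : exists n : nat, v x = n%:Z by exists `|v x|%N; rewrite gez0_abs.
rewrite -exprnN -exprVn exprn_ile1 ?invr_ge0 //.
(* The value 0 is the default of [residue_card] for an infinite residue field. *)
by case: residue_card => [|q]; rewrite ?invr0 // invf_le1 ?ler1n ?ltr0n.
Qed.

Let local_norm (v : K -> int) : R := \big[Num.max/0]_(x <- s) finite_norm R v x.

Lemma local_norm_ge (v : K -> int) x : x \in s -> finite_norm R v x <= local_norm v.
Proof. by move=> sx; apply: le_bigmax_seq. Qed.

Lemma local_norm_ge1 (v : K -> int) : finite_places v -> 1 <= local_norm v.
Proof.
move=> pv; apply: le_trans (local_norm_ge v s1).
by rewrite /finite_norm oner_eq0 place1 // oppr0 expr0z.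
Qed.

Lemma finite_places_norm_neq1 :
  finite_set [set v : K -> int | finite_places v /\ ln (local_norm v) != 0].
Proof.
apply: (@sub_finite_set _ _ (\bigcup_(x in [set` s]) [set v | finite_places v /\ v x < 0])).
  move=> v [/= pv nz]; apply: contrapT => no_x; case/eqP: nz.
  suff -> : local_norm v = 1 by rewrite ln1.
  apply/le_anti; rewrite local_norm_ge1 // andbT /local_norm big_seq.
  apply: bigmax_le => // x sx; apply: finite_norm_le1; rewrite leNgt.
  by apply/negP=> vx; apply: no_x; exists x.
by apply: bigcup_finite => [|x _]; [apply: finite_seq | apply: finite_places_neg].
Qed.

(** With 1 among the coordinates every local term is nonnegative, so all terms except those of the
    places in [L] may be dropped. *)
Lemma height_over_ge (z : K) (e : nat) (L : seq (K -> int)) :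
    z \in s -> z != 0 -> uniq L ->
    {in L, forall v, [/\ finite_places v, (0 < residue_card v)%N & v z <= - e%:Z]} ->
  (\dim {:K})%:R^-1 * (e%:R * \sum_(v <- L) ln (residue_card v)%:R) <= height_over R s.
Proof.
move=> sz z0 uniqL LP; rewrite /height_over ler_wpM2l ?invr_ge0 ?ler0n //.
apply: ler_wpDl.
  apply: fsumr_ge0 => e' [sg _ <-]; apply: ln_ge0.
  have := @le_bigmax_seq _ R _ s 0 1 xpredT (fun x => Normc.normc (sg x)) s1 isT.
  by rewrite rmorph1 Normc.normc1.
rewrite mulr_sumr; apply: (le_trans _ (@fsum_ge_seq _ _ _ (fun v => ln (local_norm v)) L _ _ _ _)) => //.
- rewrite big_seq [leRHS]big_seq; apply: ler_sum => v /LP[pv q0 vz].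
  rewrite mulr_natl -lnXn ?ltr0n // ler_ln ?posrE ?exprn_gt0 ?ltr0n //.
    apply: le_trans (local_norm_ge v sz); rewrite /finite_norm (negPf z0).
    have [n Dn] : exists n : nat, - v z = n%:Z by exists `|v z|%N; lia.
    by rewrite Dn -exprnP; apply: ler_weXn2l; rewrite ?ler1n //; lia.
  by apply: lt_le_trans (local_norm_ge1 pv); apply: ltr01.
- by move=> v /LP[].
- by move=> v /local_norm_ge1; apply: ln_ge0.
exact: finite_places_norm_neq1.
Qed.

End HeightLowerBound.

(** * Symmetric cycles *)

Definition henon_seq (R : pzRingType) (y : nat -> R) :=
  forall k, y k.+2 = y k + y k.+1 - y k.+1 ^+ 3.

Section HenonSequence.

Variables (R : comPzRingType) (y : nat -> R) (m : nat).
Hypotheses (Hy : henon_seq y) (ym : y m = 0) (m_even : ~~ odd m).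

(** Read backwards, the recurrence turns into itself once signs alternate: the right-hand side
    satisfies it in j, and it agrees with [y (m + j)] at j = 0 and j = 1 because [y m] is 0. *)
Lemma henon_seq_reflect j : (j <= m)%N -> y (m + j) = - (-1) ^+ j * y (m - j).
Proof.
suff: ((j <= m)%N -> y (m + j) = - (-1) ^+ j * y (m - j)) /\
      ((j.+1 <= m)%N -> y (m + j.+1) = - (-1) ^+ j.+1 * y (m - j.+1)) by case.
elim: j => [|j [IHj IHj1]].
  split=> [_|lt0m]; first by rewrite addn0 subn0 ym mulr0.
  case: m lt0m ym => // m' _ ym'.
  by rewrite addn1 Hy ym' subn1 /=; ring.
split=> // lt_jm; have [p Dm] : exists p, m = (p + j.+2)%N by exists (m - j.+2)%N; rewrite subnK.
have E1 : (m - j.+2 = p)%N by lia.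
have E2 : (m - j.+1 = p.+1)%N by lia.
have E3 : (m - j = p.+2)%N by lia.
rewrite !addnS Hy -addnS IHj1 ?(ltnW lt_jm) // IHj ?(ltnW (ltnW lt_jm)) // E1 E2 E3 (Hy p).
rewrite !exprS; case: (boolP (odd j)) => odd_j; rewrite -signr_odd ?odd_j ?(negPf odd_j); ring.
Qed.

Hypothesis y0 : y 0%N = 0.

(** Reflection at [m] carries [y 0] and [y 1] to the positions 2m and 2m - 1. As [m] is even, [y 1]
    keeps its sign, and one more step of the recurrence gives y (2m + 1) = y 1. *)
Lemma henon_seq_periodic j : y (m.*2 + j) = y j.
Proof.
suff: y (m.*2 + j) = y j /\ y (m.*2 + j.+1) = y j.+1 by case.
elim: j => [|j [IHj IHj1]]; last first.
  by split=> //; rewrite !addnS Hy -addnS IHj IHj1 -Hy.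
have D0 : y m.*2 = y 0%N.
  by rewrite -addnn henon_seq_reflect // subnn y0 mulr0.
rewrite addn0 addn1 D0; split=> //; have [->//|m_gt0] := posnP m.
have Dm : m.*2 = (m + m.-1).+1 by rewrite -addnS prednK // addnn.
rewrite Dm Hy -Dm D0 y0 expr0n subr0 addr0 henon_seq_reflect ?leq_pred //.
have -> : (m - m.-1 = 1)%N by lia.
have -> : (-1) ^+ m.-1 = -1 :> R.
  by rewrite -signr_odd; move: m_even; rewrite -[in odd m](prednK m_gt0) /= negbK => ->.
by rewrite opprK mul1r.
Qed.

(** Reflection pairs the terms k and 2m - k: for even k they cancel, for odd k they are equal. *)
Lemma henon_seq_alternating_sum :
  \sum_(0 <= k < m.*2) (-1) ^+ k * y k = - \sum_(0 <= k < m | odd k) y k *+ 2.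
Proof.
rewrite (@big_cat_nat _ _ _ m) //=; last by rewrite -addnn leq_addr.
rewrite -{2}[m]add0n big_addn -addnn addnK.
have -> : \sum_(0 <= k < m) (-1) ^+ (k + m) * y (k + m)%N = - \sum_(0 <= k < m) y k.
  transitivity (- \sum_(0 <= k < m) y (m - k)%N).
    rewrite -sumrN; apply: eq_big_nat => k /andP[_ lt_km].
    rewrite addnC henon_seq_reflect ?(ltnW lt_km) // mulNr mulrN; congr (- _).
    rewrite mulrA -exprD -signr_odd -addnA addnn oddD odd_double addbF (negPf m_even).
    by rewrite mul1r.
  congr (- _); have := erefl (\sum_(0 <= k < m.+1) y k).
  rewrite [in LHS]big_nat_rev /= !big_nat_recr //= add0n subSS subnn y0 ym !addr0 => <-.
  by apply: eq_bigr => k _; rewrite subSS.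
rewrite -sumrB (bigID odd) /= [X in _ + X]big1 ?addr0 => [|k /negPf odd_k]; last first.
  by rewrite -signr_odd odd_k mul1r subrr.
rewrite -sumrN; apply: eq_bigr => k odd_k.
by rewrite -signr_odd odd_k mulr2n; ring.
Qed.

End HenonSequence.

(** * The polynomials q_k *)

Section QPoly.

Fixpoint qpair (k : nat) : {poly int} * {poly int} :=
  if k is k'.+1 then let: (a, b) := qpair k' in (b, a + b - b ^+ 3) else (0, 'X).

Definition qpol k := (qpair k).1.

Lemma qpol_henon : henon_seq qpol.
Proof. by move=> k; rewrite /qpol /=; case: (qpair k) => a b. Qed.

Lemma qpol0 : qpol 0 = 0. Proof. by []. Qed.
Lemma qpol1 : qpol 1 = 'X. Proof. by []. Qed.

Lemma rmorph_henon_seq (R S : pzRingType) (f : {rmorphism R -> S}) y :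
  henon_seq y -> henon_seq (f \o y).
Proof. by move=> Hy k /=; rewrite Hy rmorphB rmorphD rmorphXn. Qed.

Lemma size_lead_qpol k : size (qpol k.+1) = (3 ^ k).+1 /\ lead_coef (qpol k.+1) ^+ 2 = 1.
Proof.
suff: [/\ (size (qpol k) < size (qpol k.+1))%N, size (qpol k.+1) = (3 ^ k).+1 &
  lead_coef (qpol k.+1) ^+ 2 = 1] by case.
elim: k => [|k [lt_q sz_q lead_q]].
  by rewrite qpol0 qpol1 size_poly0 size_polyX lead_coefX expr1n.
have sz3 : size (qpol k.+1 ^+ 3) = (3 ^ k.+1).+1.
  have q_neq0 : qpol k.+1 != 0 by rewrite -size_poly_gt0 sz_q.
  by rewrite -[LHS]prednK ?size_poly_gt0 ?expf_neq0 // size_exp sz_q /= expnS mulnC.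
have lt_ab : (size (qpol k + qpol k.+1)%R < size (- qpol k.+1 ^+ 3)%R)%N.
  rewrite size_polyN sz3 (leq_ltn_trans (size_polyD _ _)) // gtn_max sz_q.
  have lt3 : (3 ^ k < 3 ^ k.+1)%N by rewrite ltn_exp2l.
  by rewrite [X in _ && X]ltnS lt3 andbT (ltn_trans lt_q) // sz_q ltnS.
rewrite qpol_henon addrC size_polyDl // lead_coefDl // size_polyN sz3 lead_coefN lead_coef_exp.
split=> //; last by rewrite sqrrN -exprM mulnC exprM lead_q expr1n.
by rewrite sz_q ltnS ltn_exp2l.
Qed.

Lemma lead_qpol_unit k p : prime p -> ~~ (p %| lead_coef (qpol k.+1))%Z.
Proof.
move=> p_pr; have [_ lead1] := size_lead_qpol k; apply/negP=> p_lead.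
have : (p %| lead_coef (qpol k.+1) ^+ 2)%Z by rewrite dvdz_exp // dvdz_mulr.
by rewrite lead1 dvdz1 /= => /eqP p1; rewrite p1 in p_pr.
Qed.

End QPoly.

(** * The recurrence in characteristic 3 *)

Section CharThree.

Variable R : comPzRingType.
Hypothesis char3 : 3%:R = 0 :> R.

Lemma char3_cubeD (x z : R) : (x + z) ^+ 3 = x ^+ 3 + z ^+ 3.
Proof.
have -> : (x + z) ^+ 3 = x ^+ 3 + z ^+ 3 + 3%:R * (x ^+ 2 * z + x * z ^+ 2) by ring.
by rewrite char3 mul0r addr0.
Qed.

Lemma char3_two : 2%:R = -1 :> R.
Proof. by apply/eqP; rewrite -addr_eq0 -[X in _ + X]/(1%:R) -natrD char3. Qed.

(** The inhomogeneous part of the z-coordinate: z_(k+1) = 2 z_k - y_k gives z_j = 2^j z_0 -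
    [double_sum y j]. *)
Fixpoint double_sum (S : pzRingType) (y : nat -> S) j : S :=
  if j is j'.+1 then 2 * double_sum y j' + y j' else 0.

Lemma char3_double_sum (y : nat -> R) j :
  double_sum y j = - (-1) ^+ j * \sum_(0 <= k < j) (-1) ^+ k * y k.
Proof.
elim: j => [|j IHj]; first by rewrite big_nil mulr0.
rewrite big_nat_recr //= IHj char3_two mulrDr exprS.
have sgn2 : (-1) ^+ j * (-1) ^+ j = 1 :> R by rewrite -exprMn mulrNN mulr1 expr1n.
by rewrite mulN1r opprK mulrA sgn2 mul1r; ring.
Qed.

(** The identity y (i + 2) - y i = y (i + 1) - y (i + 1)^3 telescopes over even i, and cubing is
    additive. *)
Lemma char3_henon_seq_even (y : nat -> R) m : henon_seq y -> y 0%N = 0 -> ~~ odd m ->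
  let u := \sum_(0 <= k < m | odd k) y k in y m = u - u ^+ 3.
Proof.
move=> Hy y0 m_even; rewrite -(even_halfK m_even); move: m./2 => {m_even}m.
elim: m => [|m IHm] /=; first by rewrite big_nil y0; ring.
have -> : \sum_(0 <= k < m.+1.*2 | odd k) y k = \sum_(0 <= k < m.*2 | odd k) y k + y m.*2.+1.
  rewrite doubleS big_mkcond /= !big_nat_recr //= odd_double /= addr0; congr (_ + _).
  by rewrite [RHS]big_mkcond.
by rewrite doubleS Hy IHm char3_cubeD; ring.
Qed.

End CharThree.

Section ReductionModThree.

Lemma Fp3_char : 3%:R = 0 :> {poly 'F_3}.
Proof. by rewrite -(rmorph_nat (@polyC 'F_3)); congr _%:P; apply: val_inj. Qed.

Definition Qbar k : {poly 'F_3} := map_poly intr (qpol k).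

Lemma Qbar_henon : henon_seq Qbar.
Proof. exact: (rmorph_henon_seq (map_poly (intr : int -> 'F_3)) qpol_henon). Qed.

Lemma deriv_Qbar_rec k : (Qbar k.+2)^`() = (Qbar k)^`() + (Qbar k.+1)^`().
Proof.
rewrite Qbar_henon derivB derivD deriv_exp -[RHS]subr0; congr (_ - _).
by rewrite -[LHS]mulr_natl Fp3_char mul0r.
Qed.

(** The derivatives satisfy the Fibonacci recurrence with initial terms 0 and 1. Modulo 3 these
    numbers change sign under a shift by 4 and vanish only at multiples of 4. *)
Lemma deriv_Qbar k : ~~ (4 %| k)%N -> exists2 c : 'F_3, c != 0 & (Qbar k)^`() = c%:P.
Proof.
have per j : (Qbar (4 + j))^`() = - (Qbar j)^`().
  rewrite !deriv_Qbar_rec; set a := (Qbar j)^`(); set b := (Qbar j.+1)^`().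
  by transitivity (- a + 3%:R * (a + b)); [ring | rewrite Fp3_char mul0r addr0].
elim/ltn_ind: k => -[|[|[|[|k]]]] IHk // ndvd.
- by exists 1; rewrite ?oner_neq0 // /Qbar qpol1 map_polyX derivX.
- exists 1; rewrite ?oner_neq0 // deriv_Qbar_rec /Qbar qpol0 qpol1 rmorph0 map_polyX.
  by rewrite deriv0 derivX add0r.
- exists (1 + 1) => //; rewrite !deriv_Qbar_rec /Qbar qpol0 qpol1 rmorph0 map_polyX.
  by rewrite deriv0 derivX add0r polyCD.
have [||c c0 Dc] := IHk k; first by rewrite ltnS ltnW // ltnW.
  by move: ndvd; rewrite -[k.+4]/(4 + k)%N dvdn_addr.
by exists (- c); rewrite ?oppr_eq0 // -[k.+4]/(4 + k)%N per Dc polyCN.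
Qed.

Lemma separable_Qbar k : ~~ (4 %| k)%N -> coprimep (Qbar k) (Qbar k)^`().
Proof.
by move=> /deriv_Qbar[c c0 ->]; rewrite -alg_polyC coprimepZr ?coprimep1.
Qed.

End ReductionModThree.

(** * Factors of [q_m] with many places over 3 *)

Section PolyFactors.

Variable F : fieldType.
Implicit Types a b h V : {poly F}.

(** By Bezout the product of the gcds of [a] and of [b] with [V] is, up to a unit, a combination of
    [a * b] and [V], hence divisible by their gcd. *)
Lemma size_gcdp_mul a b V : a != 0 -> b != 0 ->
  ((size (gcdp (a * b) V)).-1 <= (size (gcdp a V)).-1 + (size (gcdp b V)).-1)%N.
Proof.
move=> a0 b0; have [[u w] /= Dd] := Bezoutp a V; have [[u' w'] /= De] := Bezoutp b V.
have d0 : gcdp a V != 0 by rewrite gcdp_eq0 (negPf a0).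
have e0 : gcdp b V != 0 by rewrite gcdp_eq0 (negPf b0).
have : gcdp (a * b) V %| gcdp a V * gcdp b V.
  have DdDe := eqp_trans (eqp_mulr (u' * b + w' * V) Dd) (eqp_mull (gcdp a V) De).
  rewrite -(eqp_dvdr _ DdDe).
  have -> : (u * a + w * V) * (u' * b + w' * V) =
      (u * u') * (a * b) + (u * a * w' + w * (u' * b + w' * V)) * V by ring.
  by rewrite dvdp_add // dvdp_mull // ?dvdp_gcdl ?dvdp_gcdr.
move/dvdp_leq; rewrite mulf_neq0 // size_mul // => /(_ isT).
move: d0 e0; rewrite -!size_poly_gt0.
by move: (size _) (size _) (size _) => k l m; lia.
Qed.

Lemma irreducible_divisor h : (1 < size h)%N -> exists2 q, irreducible_poly q & q %| h.
Proof.
have [n] := ubnP (size h); elim: n h => // n IHn h le_hn h_gt1.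
have [irr|nirr] := pselect (irreducible_poly h); first by exists h.
have [q [q_neq1 q_h nq]] : exists q : {poly F}, [/\ size q != 1%N, q %| h & ~~ (q %= h)].
  apply: contrapT => no_q; apply: nirr; split=> // q q1 qh.
  by apply: contrapT => /negP nq; apply: no_q; exists q.
have h0 : h != 0 by rewrite -size_poly_gt0 ltnW.
have q0 : q != 0 by apply: contraNneq h0 => q0; move: q_h; rewrite q0 dvd0p.
have lt_qh : (size q < size h)%N.
  by rewrite ltn_neqAle (dvdp_leq h0 q_h) andbT dvdp_size_eqp.
have [||r irr_r r_q] := IHn q.
- exact: leq_trans lt_qh le_hn.
- by move: q0 q_neq1; rewrite -size_poly_gt0; move: (size q) => k; lia.
by exists r => //; apply: dvdp_trans q_h.
Qed.

Lemma monic_irreducible_divisor h : (1 < size h)%N ->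
  exists2 q, monic_irreducible_poly q & q %| h.
Proof.
move=> /irreducible_divisor[q irr_q q_h]; have q0 := irredp_neq0 irr_q.
have lead0 : (lead_coef q)^-1 != 0 by rewrite invr_eq0 lead_coef_eq0.
exists ((lead_coef q)^-1 *: q); last by rewrite dvdpZl.
split; last by rewrite monicE lead_coefZ mulVf // lead_coef_eq0.
case: irr_q => q_gt1 irr_q; split=> [|r r1]; first by rewrite size_scale.
rewrite dvdpZr // => /irr_q; move/(_ r1) => /eqp_trans; apply.
by rewrite eqp_sym eqp_scale.
Qed.

(** A repeated factor would divide both [h] and its derivative, so the irreducible factors are
    distinct and their degrees add up to that of [h]. *)
Lemma separable_monic_irreducible_divisors h : h != 0 -> coprimep h h^`() ->
  exists L : seq {poly F}, [/\ uniq L,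
    {in L, forall q, monic_irreducible_poly q /\ q %| h}
    & (\sum_(q <- L) (size q).-1 = (size h).-1)%N].
Proof.
have [n] := ubnP (size h); elim: n h => // n IHn h le_hn h0 sep_h.
have [h_gt1|h_le1] := ltnP 1 (size h); last first.
  by exists [::]; split=> //; rewrite big_nil; move: h_le1; lia.
have [q mi_q q_h] := monic_irreducible_divisor h_gt1.
have [q_gt1 _] := mi_q.1; have [r Dh] := dvdpP _ _ q_h.
have q0 : q != 0 by rewrite -size_poly_gt0 ltnW.
have r0 : r != 0 by apply: contraNneq h0 => r0; rewrite Dh r0 mul0r.
have Dsz : size h = (size r + size q).-1 by rewrite Dh size_mul.
have dh : h^`() = r^`() * q + r * q^`() by rewrite Dh derivM.
have sep_r : coprimep r r^`().
  apply/coprimepP => d d_r d_r'; apply: (coprimepP _ _ sep_h).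
    by rewrite Dh dvdp_mulr.
  by rewrite dh dvdp_add ?dvdp_mulr.
have ndvd : ~~ (q %| r).
  apply/negP=> q_r; have := coprimepP _ _ sep_h q q_h.
  rewrite dh dvdp_add ?(dvdp_mulr _ q_r) ?dvdp_mulIr // => /(_ isT).
  by rewrite -size_poly_eq1 => /eqP q1; rewrite q1 in q_gt1.
have [||//|L [uniqL LP sumL]] := IHn r; rewrite ?ltnS //.
  move: le_hn; rewrite ltnS; apply: leq_trans; move: q_gt1 r0 Dsz; rewrite -size_poly_gt0.
  by move: (size q) (size r) (size h) => k l m; lia.
exists (q :: L); split=> [|s|].
- by rewrite /= uniqL andbT; apply/negP=> /LP[_]; apply/negP.
- rewrite inE => /predU1P[-> //|/LP[? s_r]]; split=> //.
  by rewrite Dh dvdp_mulr.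
rewrite big_cons sumL Dsz; by move: r0 q_gt1; rewrite -size_poly_gt0; move: (size r) (size q) => k l; lia.
Qed.

End PolyFactors.

(* The ratio of the two degrees for a product is a mediant of those of the factors, so one of the
   irreducible factors does at least as well as [a]. *)
Lemma good_minimal_factor (p c1 c2 : nat) (V : {poly 'F_p}) (a : {poly int}) :
    prime p -> (0 < c1)%N -> ~~ (p %| lead_coef a)%Z -> (1 < size a)%N ->
    (c1 * (size a).-1 <= c2 * (size (gcdp (map_poly intr a) V)).-1)%N ->
  exists (g r : {poly int}) (t : algC), [/\ a = g * r, (map_poly intr g).[t] = 0,
    forall b : {poly int}, (map_poly intr b).[t] = 0 -> (size b < size g)%N -> b = 0
    & (c1 * (size g).-1 <= c2 * (size (gcdp (map_poly intr g) V)).-1)%N].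
Proof.
move=> p_pr c1_gt0; have [n] := ubnP (size a); elim: n a => // n IHn a le_an lead_a a_gt1 le_a.
have a0 : a != 0 by rewrite -size_poly_gt0 ltnW.
have inj_intr : injective (intr : int -> algC) by apply: intr_inj.
have szC b : size (map_poly intr b : {poly algC}) = size b by apply: size_map_inj_poly.
have [t at0] : exists t : algC, root (map_poly intr a) t.
  by apply/closed_rootP; rewrite szC gtn_eqF.
have [r [Dr mon_r] r_min] := minCpolyP t.
have DC b : map_poly ratr (map_poly intr b) = map_poly intr b :> {poly algC}.
  by rewrite -map_poly_comp; apply: eq_map_poly => k /=; rewrite ratr_int.
have r_a : r %| map_poly intr a by rewrite -r_min DC.
(* Gauss's lemma: a scalar multiple [g] of the minimal polynomial of [t] divides [a] over the
   integers. *)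
have [g [e e0 Dg] [b Da]] := dvdpP_rat_int r_a.
have szg : size g = size r by rewrite Dg size_scale // size_map_inj_poly //; apply: intr_inj.
have g0 : g != 0 by apply: contraNneq a0 => g0; rewrite Da g0 mul0r.
have b0 : b != 0 by apply: contraNneq a0 => b0; rewrite Da b0 mulr0.
have [le_g|lt_g] := leqP (c1 * (size g).-1) (c2 * (size (gcdp (map_poly intr g) V)).-1).
  exists g, b, t; split=> //.
    have : root (map_poly ratr r) t by rewrite r_min.
    rewrite Dg map_polyZ /= rootZ; first by rewrite DC => /rootP.
    by rewrite fmorph_eq0.
  move=> s /rootP; rewrite -DC r_min => r_s lt_s; apply/eqP; apply: contraTT lt_s => s0.
  rewrite -leqNgt szg; have := dvdp_leq _ r_s.
  rewrite size_map_inj_poly //; last exact: intr_inj.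
  by apply; rewrite map_poly_eq0_id0 // intr_eq0 lead_coef_eq0.
have lead_ab : ~~ (p %| lead_coef g)%Z /\ ~~ (p %| lead_coef b)%Z.
  move: lead_a; rewrite Da lead_coefM; split; move: lead_a; apply: contraNN => dv.
    by rewrite dvdz_mulr.
  by rewrite dvdz_mull.
have red_size (c : {poly int}) : ~~ (p %| lead_coef c)%Z ->
    size (map_poly intr c : {poly 'F_p}) = size c.
  by move=> lead_c; rewrite size_map_poly_id0 // intr_Fp_eq0.
have [lead_g lead_b] := lead_ab.
have red_neq0 (c : {poly int}) : ~~ (p %| lead_coef c)%Z -> c != 0 ->
    map_poly intr c != 0 :> {poly 'F_p}.
  by move=> lead_c; rewrite -!size_poly_gt0 red_size.
have := size_gcdp_mul V (red_neq0 _ lead_g g0) (red_neq0 _ lead_b b0).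
rewrite -rmorphM /= -Da => le_gcd.
have sz_a := size_mul g0 b0; rewrite -Da in sz_a.
have lt_b : (c1 * (size b).-1 < c2 * (size (gcdp (map_poly intr b) V)).-1)%N.
  move: (leq_mul (leqnn c2) le_gcd); rewrite mulnDr.
  have -> : (size b).-1 = ((size a).-1 - (size g).-1)%N.
    by move: g0 b0; rewrite -!size_poly_gt0 sz_a; move: (size g) (size b); clear; lia.
  have le_ga : (c1 * (size g).-1 <= c1 * (size a).-1)%N.
    rewrite leq_mul2l; apply/orP; right; move: g0 b0; rewrite -!size_poly_gt0 sz_a.
    by move: (size g) (size b); clear; lia.
  rewrite mulnBr; move: le_ga le_a lt_g.
  by move: (_ * (size a).-1)%N (_ * (size g).-1)%N (_ * (size (gcdp (map_poly intr a) V)).-1)%N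
    (_ * (size (gcdp (map_poly intr g) V)).-1)%N (_ * (size (gcdp (map_poly intr b) V)).-1)%N; clear; lia.
have b_gt1 : (1 < size b)%N.
  have := dvdp_leq (red_neq0 _ lead_b b0) (dvdp_gcdl _ V); rewrite red_size // => le_gb.
  rewrite ltnNge; apply/negP=> b_le1; move: lt_b; rewrite [X in (_ * X)%N]/predn.
  by have -> : (size (gcdp (map_poly intr b) V)).-1 = 0%N; [move: le_gb b_le1; move: (size _) (size b); clear; lia | rewrite muln0].
have g_gt1 : (1 < size g)%N.
  have rt0 : root (map_poly ratr r) t by rewrite r_min.
  by rewrite szg -(size_map_poly (ratr : rat -> algC)) (root_size_gt1 _ rt0) // map_poly_eq0 monic_neq0.
have [|g' [r' [t' [Db ? ? ?]]]] := IHn b _ lead_b b_gt1 (ltnW lt_b).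
  move: le_an; rewrite ltnS; apply: leq_trans; rewrite sz_a; move: g_gt1 b_gt1; move: (size g) (size b); clear; lia.
by exists g', (g * r'), t'; split=> //; rewrite Da Db mulrCA.
Qed.

(** * The factor U^2 - 1 and the numerator of z modulo 3 *)

Definition Ubar m : {poly 'F_3} := \sum_(0 <= k < m | odd k) Qbar k.

(* [z_j] is [qZ m j / (2 ^ 2m - 1)]. *)
Definition qZ m j : {poly int} :=
  2 ^+ j * double_sum qpol m.*2 - (2 ^+ m.*2 - 1) * double_sum qpol j.

Lemma qZS m j : qZ m j.+1 = 2 * qZ m j - (2 ^+ m.*2 - 1) * qpol j.
Proof. by rewrite /qZ exprS /=; ring. Qed.

Lemma rmorph_double_sum (R S : pzRingType) (f : {rmorphism R -> S}) (y : nat -> R) j :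
  f (double_sum y j) = double_sum (f \o y) j.
Proof. by elim: j => [|j IHj] /=; rewrite ?rmorph0 // rmorphD rmorphM rmorph_nat IHj. Qed.

Section CharThreeEvaluation.

Variables (F : fieldType) (phi : {rmorphism {poly int} -> F}) (m : nat).
Hypotheses (char3 : 3%:R = 0 :> F) (m_even : ~~ odd m) (phi_qm : phi (qpol m) = 0).

Let y := phi \o qpol.
Let Hy : henon_seq y. Proof. exact: rmorph_henon_seq qpol_henon. Qed.
Let y0 : y 0%N = 0. Proof. exact: rmorph0. Qed.

(** As 2 = -1, the double sum over the full cycle is minus the alternating sum, that is 2U = -U. *)
Lemma char3_phi_double_sum :
  phi (double_sum qpol m.*2) = - \sum_(0 <= k < m | odd k) phi (qpol k).
Proof.
rewrite rmorph_double_sum char3_double_sum // henon_seq_alternating_sum //.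
rewrite -signr_odd odd_double sumrMnl mulN1r opprK -mulr_natr char3_two // mulrN1.
by [].
Qed.

(** 2^(2m) - 1 vanishes modulo 3, so all numerators along the cycle agree up to sign. *)
Lemma char3_phi_qZ j : phi (qZ m j) = (-1) ^+ j * phi (double_sum qpol m.*2).
Proof.
rewrite rmorphB rmorphM rmorphXn rmorph_nat char3_two // [phi (_ * double_sum _ j)]rmorphM.
rewrite rmorphB rmorphXn rmorph_nat char3_two // -[in X in _ - X]signr_odd odd_double rmorph1.
by rewrite subrr mul0r subr0.
Qed.

Lemma phi_qpol_shift b j : y (b * m.*2 + j)%N = y j.
Proof.
by elim: b => [|b IHb]; rewrite ?mul0n // mulSn -addnA henon_seq_periodic.
Qed.

Lemma phi_alternating_sum_periods b : \sum_(0 <= k < (b * m.*2)%N) (-1) ^+ k * y k =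
  b%:R * \sum_(0 <= k < m.*2) (-1) ^+ k * y k.
Proof.
elim: b => [|b IHb]; first by rewrite mul0n big_nil mul0r.
rewrite mulSnr (big_cat_nat _ (n := (b * m.*2)%N)) ?leq_addr //= IHb.
rewrite -natr1 mulrDl mul1r; congr (_ + _).
rewrite -{1}[(b * m.*2)%N]add0n big_addn addKn; apply: eq_bigr => k _.
rewrite addnC phi_qpol_shift; congr (_ * _).
by rewrite -signr_odd oddD oddM odd_double andbF addFb signr_odd.
Qed.

(** By reflection at [3 * d * m] this sum equals the alternating sum over [3 * d] periods of length
    2m, which is a multiple of 3. *)
Lemma char3_phi_sum_multiple d :
  \sum_(0 <= k < (3 * d * m)%N | odd k) phi (qpol k) = 0.
Proof.
have m'_even : ~~ odd (3 * d * m) by rewrite oddM (negPf m_even) andbF.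
have D2 : ((3 * d * m).*2 = 3 * d * m.*2)%N by rewrite -!muln2 mulnA.
have qm' : y (3 * d * m)%N = 0.
  have [b []] : exists b, (3 * d * m = b * m.*2)%N \/ (3 * d * m = b * m.*2 + m)%N.
  - exists (3 * d)./2; rewrite -[in (3 * d * m)%N](odd_double_half (3 * d)) mulnDl.
    rewrite -muln2 -mulnA mul2n addnC; case: odd; [right | left]; by rewrite ?mul1n ?addn0.
  - by move=> ->; rewrite -[(_ * _)%N]addn0 phi_qpol_shift.
  - by move=> ->; rewrite phi_qpol_shift.
have := henon_seq_alternating_sum Hy qm' m'_even y0.
rewrite D2 phi_alternating_sum_periods natrM char3 !mul0r sumrMnl -mulr_natr char3_two // mulrN1.
by rewrite opprK => /esym.
Qed.

End CharThreeEvaluation.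

Lemma Qbar_factor m : ~~ odd m -> Qbar m = - (Ubar m * (Ubar m ^+ 2 - 1)).
Proof.
move=> m_even; rewrite (char3_henon_seq_even Fp3_char Qbar_henon) //; last first.
  by rewrite /Qbar qpol0 rmorph0.
rewrite -/(Ubar m); ring.
Qed.

Lemma size_Qbar m : (0 < m)%N -> size (Qbar m) = size (qpol m).
Proof.
case: m => // m _; rewrite size_map_poly_id0 // intr_Fp_eq0 //.
exact: lead_qpol_unit.
Qed.

Lemma size_Ubar m : ~~ odd m -> (1 < m)%N ->
  [/\ (1 < size (Ubar m))%N, size (Ubar m ^+ 2 - 1) = ((size (Ubar m)).-1 * 2).+1
    & (size (qpol m)).-1 = ((size (Ubar m)).-1 * 3)%N].
Proof.
move=> m_even m_gt1; have := size_Qbar (ltnW m_gt1); rewrite Qbar_factor // size_polyN.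
have [m' Dm] : exists m', m = m'.+2 by exists m.-2; lia.
have -> : size (qpol m) = (3 ^ m'.+1).+1 by rewrite Dm (size_lead_qpol _).1.
move=> sz; have U_gt1 : (1 < size (Ubar m))%N.
  rewrite ltnNge; apply/negP=> /size1_polyC DU; move: sz; rewrite DU.
  rewrite -polyC1 -rmorphXn -polyCB -polyCM size_polyC => sz3.
  have : ((3 ^ m'.+1).+1 <= 1)%N by rewrite -sz3 leq_b1.
  by rewrite ltnS leqn0 expn_eq0.
have U0 : Ubar m != 0 by rewrite -size_poly_gt0 ltnW.
have szU2 : size (Ubar m ^+ 2) = ((size (Ubar m)).-1 * 2).+1.
  by rewrite -[LHS]prednK ?size_poly_gt0 ?expf_neq0 // size_exp.
have szV : size (Ubar m ^+ 2 - 1) = ((size (Ubar m)).-1 * 2).+1.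
  rewrite size_polyDl szU2 // size_polyN size_poly1 ltnS muln_gt0 andbT.
  by rewrite -subn1 subn_gt0.
split=> //; rewrite -sz size_mul // -?size_poly_gt0 szV //=.
by move: (size _) U_gt1; clear; lia.
Qed.

Definition half_period k := (2 * 3 ^ k)%N.

Lemma half_period_even k : ~~ odd (half_period k).
Proof. by rewrite /half_period mul2n odd_double. Qed.

Lemma half_period_gt1 k : (1 < half_period k)%N.
Proof. by rewrite /half_period -[1%N]/(1 * 1)%N leq_pmulr ?expn_gt0. Qed.

Lemma half_period_ndvd4 k : ~~ (4 %| half_period k)%N.
Proof.
by rewrite /half_period (@dvdn_pmul2l 2 2) // dvdn2 negbK oddX orbT.
Qed.

(** Up to a constant [g] is the minimal polynomial of [t] over Q. The inequality says that the part
    of [g] modulo 3 where z acquires its poles has at least 2/3 of the degree. *)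
Definition good_factor k (g : {poly int}) (t : algC) :=
  [/\ exists r, qpol (half_period k) = g * r, ~~ (3 %| lead_coef g)%Z, (map_poly intr g).[t] = 0,
    forall b : {poly int}, (map_poly intr b).[t] = 0 -> (size b < size g)%N -> b = 0
    & (2 * (size g).-1 <=
       3 * (size (gcdp (map_poly intr g) (Ubar (half_period k) ^+ 2 - 1))).-1)%N].

Lemma good_factor_exists k : exists g t, good_factor k g t.
Proof.
have m_even := half_period_even k; have m_gt1 := half_period_gt1 k.
rewrite /good_factor; move: (half_period k) m_even m_gt1 => m m_even m_gt1.
have [U_gt1 szV szq] := size_Ubar m_even m_gt1.
have lead_q : ~~ (3 %| lead_coef (qpol m))%Z.
  by case: (m) m_gt1 => // m' _; apply: lead_qpol_unit.
have q_gt1 : (1 < size (qpol m))%N.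
  by move: szq U_gt1; move: (size (qpol m)) (size (Ubar m)); clear; lia.
have [|g [r [t [Dq gt0 g_min le_g]]]] :=
    @good_minimal_factor 3 2 3 (Ubar m ^+ 2 - 1) (qpol m) isT isT lead_q q_gt1.
  have /eqp_size -> : gcdp (map_poly intr (qpol m)) (Ubar m ^+ 2 - 1) %= Ubar m ^+ 2 - 1.
    by apply: dvdp_gcd_idr; rewrite -/(Qbar m) Qbar_factor // dvdpNr dvdp_mull.
  by rewrite szV szq /=; lia.
exists g, t; split=> //; first by exists r.
by move: lead_q; rewrite Dq lead_coefM; apply: contraNN => dv; rewrite dvdz_mulr.
Qed.

Lemma good_factor_Qbar k g t : good_factor k g t -> map_poly intr g %| Qbar (half_period k).
Proof. by case=> [[r Dq] _ _ _ _]; rewrite /Qbar Dq rmorphM dvdp_mulr. Qed.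

Lemma residue_qZ k (psi : {poly 'F_3}) j : monic_irreducible_poly psi ->
    psi %| Qbar (half_period k) -> psi %| Ubar (half_period k) ^+ 2 - 1 ->
  ~~ (psi %| map_poly intr (qZ (half_period k) j)).
Proof.
move=> mi psi_q psi_V; have m_even := half_period_even k; set m := half_period k in psi_q psi_V m_even *.
rewrite -(residue_poly_eq0 mi).
have char3 : 3%:R = 0 :> {poly %/ psi with mi}.
  by rewrite -(rmorph_nat (residue_poly mi)); apply/eqP; rewrite residue_poly_eq0 rmorph_nat Fp3_char dvdp0.
have qm : residue_poly mi (qpol m) = 0 by apply/eqP; rewrite residue_poly_eq0.
rewrite char3_phi_qZ // char3_phi_double_sum // mulf_neq0 ?expf_neq0 ?oppr_eq0 ?oner_neq0 //.
rewrite -rmorph_sum residue_poly_eq0 rmorph_sum /= -/(Ubar m).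
apply/negP=> psi_U; have : psi %| 1.
  rewrite -[1](subKr (Ubar m ^+ 2)) dvdp_sub //.
  by rewrite expr2 dvdp_mulr.
by have [[/gtn_eqF psi1 _] _] := mi; rewrite dvdp1 psi1.
Qed.

(** The half period of [l] is that of [k] times a multiple of 3, so U for [l] vanishes modulo [psi]
    and U^2 - 1 becomes -1. *)
Lemma divisor_distinct k l (psi : {poly 'F_3}) : (k < l)%N -> monic_irreducible_poly psi ->
    psi %| Qbar (half_period k) -> ~~ (psi %| Ubar (half_period l) ^+ 2 - 1).
Proof.
move=> lt_kl mi psi_q; have m_even := half_period_even k.
have [d Dl] : exists d, half_period l = (3 * d * half_period k)%N.
  exists (3 ^ (l - k.+1))%N; rewrite /half_period -expnS -subSn // subSS mulnCA -expnD.
  by rewrite subnK // ltnW.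
have char3 : 3%:R = 0 :> {poly %/ psi with mi}.
  by rewrite -(rmorph_nat (residue_poly mi)); apply/eqP; rewrite residue_poly_eq0 rmorph_nat Fp3_char dvdp0.
have qm : residue_poly mi (qpol (half_period k)) = 0 by apply/eqP; rewrite residue_poly_eq0.
have psi_U : psi %| Ubar (half_period l).
  have := char3_phi_sum_multiple char3 m_even qm d; rewrite -Dl -rmorph_sum => /eqP.
  by rewrite residue_poly_eq0 rmorph_sum.
apply/negP=> psi_V; have : psi %| 1.
  by rewrite -[1](subKr (Ubar (half_period l) ^+ 2)) dvdp_sub // expr2 dvdp_mulr.
by have [[/gtn_eqF psi1 _] _] := mi; rewrite dvdp1 psi1.
Qed.

(** Cubing 1 + 3^(k+1) b gains a factor 3; the start is 2^4 - 1 = 3 * 5. *)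
Lemma dvd_pow2_half_period k : exists c, (2 ^ (half_period k).*2 - 1 = 3 ^ k.+1 * c)%N.
Proof.
have [b Db] : exists b, (2 ^ (half_period k).*2 = 3 ^ k.+1 * b + 1)%N.
  elim: k => [|k [b Db]]; first by exists 5.
  have -> : (half_period k.+1).*2 = ((half_period k).*2 * 3)%N.
    by rewrite /half_period expnS -!muln2; lia.
  exists (b + 3 ^ k.+1 * b ^ 2 + 3 ^ k * 3 ^ k.+1 * b ^ 3)%N.
  by rewrite expnM Db !expnS; move: (3 ^ k)%N => e; ring.
by exists b; rewrite Db addnK.
Qed.

(** * The periodic orbits attached to the roots of q_m *)

Section OrbitPoints.

Variable t : algC.

Let ev : {rmorphism {poly int} -> algC} := horner_eval t \o map_poly intr.

(** The index of z is [j.+1], that of the second coordinate, because z_(i+1) = 2 z_i - q_i. *)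
Definition orbit_point k j : affine 3 :=
  \row_i [tuple (map_poly intr (qpol j)).[t]; (map_poly intr (qpol j.+1)).[t];
     (map_poly intr (qZ (half_period k) j.+1)).[t] / (2 ^+ (half_period k).*2 - 1)]`_i.

Lemma pow2_sub1_neq0 n : (0 < n)%N -> 2 ^+ n - 1 != 0 :> algC.
Proof.
by move=> n_gt0; rewrite subr_eq0 -natrX (eqr_nat _ _ 1) gtn_eqF // (ltn_exp2l 0).
Qed.

Lemma henon_skew_orbit_point k j :
  endo_app henon_skew (orbit_point k j) = orbit_point k j.+1.
Proof.
have N0 : 2 ^+ (half_period k).*2 - 1 != 0 :> algC.
  by rewrite pow2_sub1_neq0 // double_gt0 ltnW ?half_period_gt1.
rewrite endo_app_henon_skew; apply/rowP; elim/ord3_ind; rewrite !mxE //=.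
  by rewrite -![(_).[t]]/(ev _) (qpol_henon j) rmorphB rmorphD rmorphXn.
rewrite -![(_).[t]]/(ev _) [qZ _ j.+2]qZS.
move: (qZ _ j.+1) (qpol j.+1) (_.*2) N0 => Z q n N0.
by rewrite rmorphB !rmorphM rmorphB rmorphXn !rmorph_nat rmorph1; field.
Qed.

Lemma orbit_point_Per k j : (map_poly intr (qpol (half_period k))).[t] = 0 ->
  Per henon_skew (orbit_point k j).
Proof.
move=> qm0; set m := half_period k in qm0.
have m_gt0 : (0 < m.*2)%N by rewrite double_gt0 ltnW ?half_period_gt1.
exists m.*2; split=> //; rewrite /Per_n /=.
have it i : iter i (endo_app henon_skew) (orbit_point k j) = orbit_point k (i + j).
  by elim: i => //= i ->; rewrite henon_skew_orbit_point.
have Hy : henon_seq (ev \o qpol) by apply: rmorph_henon_seq qpol_henon.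
have per i : ev (qpol (m.*2 + i)) = ev (qpol i).
  exact: (henon_seq_periodic Hy qm0 (half_period_even k) (rmorph0 ev)).
have perD i : ev (double_sum qpol (m.*2 + i)) =
    2 ^+ i * ev (double_sum qpol m.*2) + ev (double_sum qpol i).
  elim: i => [|i IHi]; first by rewrite addn0 expr0 mul1r rmorph0 addr0.
  have dsS l : double_sum qpol l.+1 = 2 * double_sum qpol l + qpol l by [].
  rewrite addnS !dsS ![ev (_ + _)]rmorphD ![ev (2 * _)]rmorphM ![ev 2]rmorph_nat IHi per exprS.
  by ring.
have perZ i : ev (qZ m (m.*2 + i)) = ev (qZ m i).
  rewrite !rmorphB [ev (_ * double_sum _ (_ + _))]rmorphM perD.
  by rewrite !rmorphM !rmorphB !rmorphXn !rmorph_nat rmorph1 exprD; ring.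
rewrite it; apply/rowP; elim/ord3_ind; rewrite !mxE -?addnS /= -![(_).[t]]/(ev _) -/m ?per //.
by rewrite perZ.
Qed.

End OrbitPoints.

Section OrbitPointHeight.

Variables (R : realType) (k j : nat) (g : {poly int}) (t : algC).
Hypothesis good_gt : good_factor k g t.

(** The degree of [K] cancels: the logarithms of the residue cardinalities add up to deg h times ln
    3, where h is the gcd of [g] and U^2 - 1 modulo 3, and deg h is at least 2/3 of deg g, which in
    turn is at least [K : Q]. *)
Lemma height_orbit_point_ge : 2 / 3 * ln 3 * k.+1%:R <= height R (orbit_point t k j).
Proof.
have [_ lead_g gt0 g_min le_g] := good_gt.
set m := half_period k in le_g; set P := orbit_point t k j.
rewrite /height /proj_height.
case: (num_field_exists _) => K [QC [s Ds gen_s]].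
have in_s i : exists2 u, u \in s & QC u = homog_coords P 0 i.
  have : homog_coords P 0 i \in map QC s by rewrite Ds map_f ?mem_enum.
  by case/mapP=> u us ->; exists u.
have [one s_one] := in_s (lshift 3 0); rewrite row_mxEl mxE eqxx -(rmorph1 QC).
move=> /fmorph_inj D1; rewrite {one}D1 in s_one.
have [x s_x] := in_s (rshift 1 0); rewrite row_mxEr mxE /= => Dx.
have [y s_y] := in_s (rshift 1 1); rewrite row_mxEr mxE /= => Dy.
have [z s_z] := in_s (rshift 1 2); rewrite row_mxEr mxE /= => Dz.
have s_sub u : u \in s -> [\/ u = 1, u = x, u = y | u = z].
  move=> us; have : QC u \in map QC s by apply: map_f.
  rewrite Ds => /mapP[i _]; case: (split_ordP i) => i' ->.
    by rewrite row_mxEl (ord1 i') mxE eqxx -(rmorph1 QC) => /fmorph_inj; constructor.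
  rewrite row_mxEr mxE; move: i'; elim/ord3_ind => /=.
  - by rewrite -Dx => /fmorph_inj; constructor 2.
  - by rewrite -Dy => /fmorph_inj; constructor 3.
  - by rewrite -Dz => /fmorph_inj; constructor 4.
pose ev : {rmorphism {poly int} -> algC} := horner_eval t \o map_poly intr.
(* Running the recurrence backwards from two consecutive coordinates recovers t = q_1(t) inside the
   field generated by the point. *)
have [tk Dt] : exists tk, QC tk = t.
  elim: (j) x y Dx Dy {s_x s_y s_z z Dz s_sub in_s P Ds} => [|j' IHj] a b.
    by rewrite qpol1 map_polyX hornerX; exists b.
  rewrite -![(_).[t]]/(ev _) (qpol_henon j') => Da Db.
  apply: (IHj (b - a + a ^+ 3) a) => //.
  by rewrite -[RHS]/(ev _) rmorphD rmorphB rmorphXn Da Db (rmorphB ev) (rmorphD ev) (rmorphXn ev); ring.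
pose evK : {rmorphism {poly int} -> K} := horner_eval tk \o map_poly intr.
have QC_ev a : QC (evK a) = ev a.
  rewrite /evK /ev /= /horner_eval -Dt -horner_map /= -map_poly_comp; congr _.[_].
  by apply: eq_map_poly => b /=; rewrite rmorph_int.
have N0 : 2 ^+ m.*2 - 1 != 0 :> K.
  rewrite -(fmorph_eq0 QC) rmorphB rmorphXn rmorph_nat rmorph1.
  by rewrite pow2_sub1_neq0 // double_gt0 ltnW ?half_period_gt1.
have {}Dx : x = evK (qpol j) by apply: (fmorph_inj QC); rewrite Dx QC_ev.
have {}Dy : y = evK (qpol j.+1) by apply: (fmorph_inj QC); rewrite Dy QC_ev.
have {}Dz : z = evK (qZ m j.+1) / (2 ^+ m.*2 - 1).
  apply: (fmorph_inj QC); rewrite Dz fmorph_div QC_ev [QC (_ - 1)]rmorphB rmorphXn rmorph_nat rmorph1.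
  by [].
have gk0 : (map_poly intr g).[tk] = 0.
  by apply: (fmorph_inj QC); rewrite -[(_).[tk]]/(evK g) QC_ev rmorph0.
have gk_min a : (map_poly intr a).[tk] = 0 -> (size a < size g)%N -> a = 0.
  by move=> a0; apply: g_min; rewrite -[LHS]/(ev a) -QC_ev [evK a]a0 rmorph0.
have full_tk : <<1; tk>>%VS = fullv :> {vspace K}.
  apply/eqP; rewrite eqEsubv subvf -gen_s; apply/Fadjoin_seqP; split; first exact: subv_adjoin.
  have evK_in a : evK a \in <<1; tk>>%VS.
    apply: mempx_Fadjoin; apply/polyOverP=> i; rewrite coef_map /=.
    exact: rpred_int.
  move=> u /s_sub[] ->; rewrite ?rpred1 ?Dx ?Dy ?Dz //.
  by rewrite rpredM // rpredV rpredB ?rpredX ?rpred1 ?rpred_nat.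
have K_gen x' : exists a : {poly rat}, x' = (map_poly (in_alg K) a).[tk].
  have /Fadjoin_polyP[q /polyOver1P[a ->] ->] : x' \in <<1; tk>>%VS by rewrite full_tk memvf.
  by exists a.
have g_gt1 : (1 < size g)%N.
  rewrite ltnNge; apply/negP=> /size1_polyC Dg.
  move: gt0 lead_g; rewrite Dg map_polyC hornerC /= => /eqP; rewrite intr_eq0 => /eqP ->.
  by rewrite lead_coef0 dvdz0.
have dim_K : (\dim {:K} <= (size g).-1)%N.
  have gk_root : root (map_poly intr g : {poly K}) tk by apply/rootP.
  have g_over : (map_poly intr g : {poly K}) \is a polyOver 1%VS.
    by apply/polyOverP=> i; rewrite coef_map /= rpred_int.
  have sz_g : size (map_poly intr g : {poly K}) = size g.
    apply: size_map_inj_poly => // c d.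
    by rewrite -!(rmorph_int (in_alg K)) => /fmorph_inj/intr_inj.
  have g0 : map_poly intr g != 0 :> {poly K} by rewrite -size_poly_gt0 sz_g ltnW.
  have := dvdp_leq g0 (minPoly_dvdp g_over gk_root); rewrite size_minPoly sz_g => le_deg.
  by rewrite -full_tk dim_Fadjoin dimv1 muln1 -ltnS prednK ?(ltnW g_gt1).
have dim_gt0 : (0 < \dim {:K})%N by apply: adim_gt0.
pose h := gcdp (map_poly intr g) (Ubar m ^+ 2 - 1).
have g_q := good_factor_Qbar good_gt; rewrite -/m in g_q.
have sep_q := separable_Qbar (half_period_ndvd4 k); rewrite -/m in sep_q.
have q0 : Qbar m != 0.
  have m_gt0 : (0 < m)%N := ltnW (half_period_gt1 k).
  rewrite -size_poly_gt0 (size_Qbar m_gt0) -(prednK m_gt0).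
  by rewrite (size_lead_qpol m.-1).1.
have sep_dvd (a : {poly 'F_3}) : a %| Qbar m -> coprimep a a^`().
  move=> a_q; have := dvdp_separable a_q; rewrite separable.separable_poly.unlock.
  by apply.
have h_g : h %| map_poly intr g by apply: dvdp_gcdl.
have h_q : h %| Qbar m by apply: dvdp_trans g_q.
have h0 : h != 0 by apply: contraNneq q0 => h0; rewrite -dvd0p -h0.
have [L [uniqL LP sumL]] := separable_monic_irreducible_divisors h0 (sep_dvd h h_q).
have place psi : exists v : K -> int, psi \in L ->
    [/\ finite_places v, residue_card v = (3 ^ (size psi).-1)%N, v 3%:R = 1 &
      forall a : {poly int}, let x := (map_poly intr a).[tk] in
      [/\ 0 <= v x, ~~ (psi %| map_poly intr a) -> v x = 0
         & psi %| map_poly intr a -> x != 0 -> 0 < v x]].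
  have [Lpsi|_] := boolP (psi \in L); last by exists (fun=> 0).
  have [mi psi_h] := LP psi Lpsi.
  have /dvdpP[chi Dg] := dvdp_trans psi_h h_g; rewrite mulrC in Dg.
  have cop : coprimep psi chi.
    have := sep_dvd _ g_q; rewrite Dg derivM => sep.
    rewrite irreducible_poly_coprime ?mi.1 //; last exact: mi.1.
    apply/negP=> psi_chi; have := coprimepP _ _ sep psi (dvdp_mulr _ (dvdpp _)).
    rewrite dvdp_add ?(dvdp_mull _ psi_chi) ?dvdp_mulIl // => /(_ isT).
    by have [[/gtn_eqF psi1 _] _] := mi; rewrite -size_poly_eq1 psi1.
  have [v Pv] := place_of_residue_factor (isT : prime 3) mi Dg cop lead_g gk0 gk_min K_gen.
  by exists v.
have /choice[pl Ppl] := place.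
(* A lift of [a] has positive value at [pl a] if it is nonzero at [tk], but value 0 at [pl b] unless
   [b] divides [a]. *)
have uniq_pl : uniq (map pl L).
  rewrite map_inj_in_uniq // => a b La Lb eq_ab.
  have [_ _ _ va] := Ppl a La; have [_ _ _ vb] := Ppl b Lb.
  have [mi_a a_h] := LP a La; have [mi_b b_h] := LP b Lb.
  suff b_a : b %| a.
    apply/eqP; rewrite -eqp_monic ?mi_a.2 ?mi_b.2 // eqp_sym.
    apply: mi_a.1.2 => //; have [[/gtn_eqF -> _] _] := mi_b; done.
  apply: contrapT => /negP nba.
  have := va (lift_Fp_poly a); have := vb (lift_Fp_poly a); rewrite lift_Fp_polyK //= eq_ab.
  move=> [_ /(_ nba) v0 _] [_ _ /(_ (dvdpp _))]; rewrite v0 ltxx => v_a.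
  have [a0|/v_a //] := eqVneq (map_poly intr (lift_Fp_poly a)).[tk] 0.
  have := dvdp_map_of_root (isT : prime 3) (dvdp_trans b_h h_g) lead_g gk0 gk_min a0.
  by rewrite lift_Fp_polyK // (negPf nba).
have h_gt1 : (1 < size h)%N.
  by move: le_g g_gt1; rewrite -/h; move: (size h) (size g); clear; lia.
(* If the numerator vanished, [g] and hence every factor of [h] would divide it modulo 3, against
   [residue_qZ]. *)
have z_num0 : evK (qZ m j.+1) != 0.
  apply/eqP=> /(dvdp_map_of_root (isT : prime 3) (dvdpp _) lead_g gk0 gk_min) g_Z.
  have [psi mi psi_h] := monic_irreducible_divisor h_gt1.
  have := residue_qZ j.+1 mi (dvdp_trans psi_h h_q) (dvdp_trans psi_h (dvdp_gcdr _ _)).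
  by rewrite (dvdp_trans psi_h (dvdp_trans h_g g_Z)).
have z0 : z != 0 by rewrite Dz mulf_neq0 // invr_eq0.
have vz v : v \in map pl L -> [/\ finite_places v, (0 < residue_card v)%N & v z <= - k.+1%:Z].
  case/mapP=> psi Lpsi ->; have [pv -> v3 vP] := Ppl psi Lpsi.
  split; rewrite ?expn_gt0 //; have [mi psi_h] := LP psi Lpsi.
  have [_ /(_ _) vZ _] := vP (qZ m j.+1).
  rewrite Dz placeM ?invr_eq0 // placeV // [pl psi _]vZ; last first.
    exact: residue_qZ (dvdp_trans psi_h h_q) (dvdp_trans psi_h (dvdp_gcdr _ _)).
  rewrite add0r lerN2; have [c Dc] := dvd_pow2_half_period k.
  have DN : 2 ^+ m.*2 - 1 = 3%:R ^+ k.+1 * c%:R :> K.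
    by rewrite -!natrX -natrM -Dc natrB ?expn_gt0.
  move: N0; rewrite DN mulf_eq0 negb_or => /andP[N3 c0].
  by rewrite placeM // placeX // v3 natz lerDl place_nat_ge0.
have le_h := @height_over_ge R K s s_one z k.+1 (map pl L) s_z z0 uniq_pl vz.
apply: le_trans le_h.
rewrite big_map big_seq.
rewrite (eq_bigr (fun psi : {poly 'F_3} => (size psi).-1%:R * ln 3)) => [|psi Lpsi]; last first.
  have [_ -> _ _] := Ppl psi Lpsi.
  by rewrite natrX lnXn // mulr_natl.
rewrite -big_seq -mulr_suml -natr_sum sumL.
have dim_gt0R : 0 < (\dim {:K})%:R :> R by rewrite ltr0n.
rewrite ler_pdivlMl //.
have ln3 : 0 <= ln 3 :> R by rewrite ln_ge0 // ler1n.
have -> : (\dim {:K})%:R * (2 / 3 * ln 3 * k.+1%:R) =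
    (\dim {:K})%:R * 2 / 3 * (k.+1%:R * ln 3) :> R by field.
have -> : k.+1%:R * ((size h).-1%:R * ln 3) = (size h).-1%:R * (k.+1%:R * ln 3) :> R by ring.
apply: ler_wpM2r; first by rewrite mulr_ge0.
rewrite ler_pdivrMr // -!natrM ler_nat.
by move: dim_K le_g; rewrite -/h; move: (\dim _) (size h) (size g); clear; lia.
Qed.

End OrbitPointHeight.

(** * Zariski density *)

Section CurveDensity.

Variables (L : closedFieldType) (emb : {rmorphism 'F_3 -> L}).

Let char3 : 3%:R = 0 :> L.
Proof. by rewrite -(rmorph_nat emb); apply/eqP; rewrite fmorph_eq0; apply/eqP; apply: val_inj. Qed.

Let y (z : L) k := (map_poly emb (Qbar k)).[z].

Let y_henon z : henon_seq (y z).
Proof. by move=> k; rewrite /y Qbar_henon !(rmorphB, rmorphD, rmorphXn) /= !hornerE. Qed.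

Let y0 z : y z 0%N = 0.
Proof. by rewrite /y /Qbar qpol0 !rmorph0 horner0. Qed.

Let y1 z : y z 1%N = z.
Proof. by rewrite /y /Qbar qpol1 !map_polyX hornerX. Qed.

Lemma Qbar_eval_sub z w k : y (z - w) k = y z k - y w k.
Proof.
suff: y (z - w) k = y z k - y w k /\ y (z - w) k.+1 = y z k.+1 - y w k.+1 by case.
elim: k => [|k [IHk IHk1]]; first by rewrite !y0 !y1 subr0.
split=> //; rewrite !(y_henon _ k) IHk IHk1 char3_cubeD //; ring.
Qed.

(** By additivity it is enough that two consecutive zeros force the parameter to be 0; they
    propagate back to [y z 1], which is z. *)
Lemma Qbar_pair_inj z w k : y z k = y w k -> y z k.+1 = y w k.+1 -> z = w.
Proof.
move=> /eqP; rewrite -subr_eq0 -Qbar_eval_sub => yk /eqP.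
rewrite -subr_eq0 -Qbar_eval_sub => yk1; apply/eqP; rewrite -subr_eq0.
move: (z - w) yk yk1 => {w}z; elim: k => [|k IHk] /eqP yk /eqP yk1.
  by rewrite -(y1 z) yk1.
apply: IHk; last by apply/eqP.
by have := y_henon z k; rewrite yk yk1 addr0 expr0n subr0 => <-.
Qed.

Lemma closed_poly_eq0 (q : {poly L}) : (forall b, q.[b] = 0) -> q = 0.
Proof.
move=> q0; have : size (q + 1) == 1%N.
  apply: contraT => /closed_rootP[b]; rewrite rootE hornerD q0 hornerC add0r.
  by rewrite oner_eq0.
case/size_poly1P=> c _ Dc; have Dq : q = (c - 1)%:P by rewrite polyCB -Dc addrK.
by have := q0 0; rewrite Dq hornerC => ->.
Qed.

(* On each fibre of [q_(j+1)], which is separable of degree [3 ^ j], the values of [q_j] are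
   distinct. *)
Lemma Qbar_curve_dense (r : {poly {poly 'F_3}}) j : r != 0 -> (size r <= 3 ^ j)%N ->
  ~~ (4 %| j.+1)%N -> (map_poly (fun q => q \Po Qbar j.+1) r).[Qbar j] != 0.
Proof.
move=> r0 sz_r ndvd; apply: contraNneq r0 => R0.
(* [r] is a polynomial in the first variable with coefficients in the second; [rb b] specializes the
   second variable to [b]. *)
pose rb b : {poly L} := map_poly (fun q => (map_poly emb q).[b]) r.
have szQ : size (map_poly emb (Qbar j.+1)) = (3 ^ j).+1.
  by rewrite size_map_poly size_Qbar // (size_lead_qpol j).1.
have rb_root z : (rb (y z j.+1)).[y z j] = 0.
  pose ev : {rmorphism {poly 'F_3} -> L} := horner_eval z \o map_poly emb.
  rewrite -(rmorph0 ev) -R0 -horner_map -map_poly_comp; congr _.[_].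
  by apply: eq_map_poly => q /=; rewrite /horner_eval map_comp_poly horner_comp.
have rb0 b : rb b = 0.
  apply: contrapT => /eqP rb_neq0.
  pose G := map_poly emb (Qbar j.+1) - b%:P.
  have szG : size G = (3 ^ j).+1.
    rewrite size_polyDl szQ // size_polyN (leq_ltn_trans (size_polyC_leq1 _)) // ltnS expn_gt0 //.
  have [rs DG] := closed_field_poly_normal G.
  have G0 : G != 0 by rewrite -size_poly_gt0 szG.
  have sz_rs : size rs = (3 ^ j)%N.
    by apply: succn_inj; rewrite -szG DG size_scale ?lead_coef_eq0 // size_prod_XsubC.
  have uniq_rs : uniq rs.
    have [c c0 Dc] := deriv_Qbar ndvd.
    rewrite -separable_prod_XsubC separable.separable_poly.unlock.
    rewrite -(coprimepZl _ _ (_ : lead_coef G != 0)) ?lead_coef_eq0 //.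
    rewrite -(coprimepZr _ _ (_ : lead_coef G != 0)) ?lead_coef_eq0 // -derivZ -DG.
    rewrite derivB derivC subr0 deriv_map Dc map_polyC /= -alg_polyC coprimepZr ?coprimep1 //.
    by rewrite fmorph_eq0.
  have rsP z : z \in rs -> y z j.+1 = b.
    move=> rs_z; have : root G z by rewrite DG rootZ ?lead_coef_eq0 // root_prod_XsubC.
    by rewrite rootE !hornerE subr_eq0 => /eqP.
  have uniq_rs' : uniq [seq y z j | z <- rs].
    by rewrite map_inj_in_uniq // => z w /rsP zb /rsP wb /Qbar_pair_inj; apply; rewrite zb wb.
  have roots : all (root (rb b)) [seq y z j | z <- rs].
    by apply/allP=> _ /mapP[z /rsP <- ->]; apply/rootP.
  have := max_poly_roots rb_neq0 roots uniq_rs'.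
  rewrite size_map sz_rs ltnNge (leq_trans _ sz_r) //.
  by rewrite /rb map_polyE (leq_trans (size_Poly _)) // size_map.
apply/eqP/polyP=> a; rewrite coef0; apply: (map_poly_inj emb); rewrite rmorph0.
apply: closed_poly_eq0 => b; have := congr1 (fun q : {poly L} => q`_a) (rb0 b).
by rewrite coef0 coef_map_id0 // rmorph0 horner0.
Qed.

End CurveDensity.

(** * Reduction to rational coefficients *)

Lemma poly_nat_nonroot (F : numDomainType) (q : {poly F}) : q != 0 ->
  exists a : nat, q.[a%:R] != 0.
Proof.
move=> q0; apply: contrapT => no_a; pose rs : seq F := [seq a%:R | a <- iota 0 (size q)].
suff: (size rs < size q)%N by rewrite size_map size_iota ltnn.
apply: max_poly_roots => //.
  apply/allP=> _ /mapP[a _ ->]; apply: contrapT => /negP qa.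
  by apply: no_a; exists a.
by rewrite map_inj_uniq ?iota_uniq // => a b /eqP; rewrite eqr_nat => /eqP.
Qed.

Lemma big_prod3 (R : comPzSemiRingType) (F : 'I_3 -> R) : \prod_i F i = F 0 * F 1 * F 2.
Proof.
rewrite !big_ord_recl big_ord0 mulr1 mulrA; congr (_ * F _ * F _); exact: val_inj.
Qed.

(* Kronecker substitution. *)
Lemma mpoly3_nat_nonroot (p : {mpoly algC[3]}) : p != 0 ->
  exists a : 'I_3 -> nat, p.@[fun i => (a i)%:R] != 0.
Proof.
move=> p0; pose B := msize p.
have ltB (m : 'X_{1..3}) i : m \in msupp p -> (m i < B)%N.
  by move=> /msize_mdeg_lt; apply: leq_ltn_trans; rewrite mdegE (bigD1 i) //= leq_addr.
pose code (m : 'X_{1..3}) := (m 0%R + B * (m 1%R + B * m 2%R))%N.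
have code_inj : {in msupp p &, injective code}.
  have digit u u' b b' : (b < B)%N -> (b' < B)%N -> (b + B * u = b' + B * u')%N -> b = b' /\ u = u'.
    move=> ltb ltb' E; have B0 : (0 < B)%N by apply: leq_ltn_trans ltb.
    have Du : u = u'.
      have := congr1 (divn^~ B) E.
      by rewrite /= ![(B * _)%N]mulnC ![(_ + _ * B)%N]addnC !divnMDl // !divn_small // !addn0.
    by move: E; rewrite Du => /addIn.
  move=> m m' pm pm' /(digit _ _ _ _ (ltB _ _ pm) (ltB _ _ pm'))[E0].
  move=> /(digit _ _ _ _ (ltB _ _ pm) (ltB _ _ pm'))[E1 E2].
  by apply/mnmP; elim/ord3_ind.
pose Q : {poly algC} := \sum_(m <- msupp p) p@_m *: 'X^(code m).
have Q0 : Q != 0.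
  have := msupp_eq0 p; rewrite (negPf p0); case Dp: (msupp p) => [//|m0 s] _.
  have pm0 : m0 \in msupp p by rewrite Dp mem_head.
  apply/eqP => /(congr1 (fun q : {poly algC} => q`_(code m0))).
  rewrite coef0 coef_sum (bigD1_seq m0) ?msupp_uniq //= coefZ coefXn eqxx mulr1.
  rewrite big_seq_cond big1 ?addr0 => [/eqP|m /andP[pm neq_m]].
    by apply/negP; rewrite -mcoeff_msupp.
  rewrite coefZ coefXn; case: eqP => [E|_]; last by rewrite mulr0.
  by case/eqP: neq_m; rewrite (code_inj _ _ pm0 pm E).
have [a Qa] := poly_nat_nonroot Q0.
exists (fun i : 'I_3 => a ^ (B ^ i))%N; apply: contraNneq Qa => <-.
rewrite mevalE horner_sum; apply/eqP; apply: eq_bigr => m _.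
rewrite hornerZ hornerXn big_prod3; congr (_ * _).
rewrite !natrX -!exprM -!exprD; congr (_ ^+ _).
by rewrite /code -[nat_of_ord 2%R]/2%N expn0 expn1; ring.
Qed.

(* [r] is the norm of [p] from the number field of its coefficients, computed with the companion
   matrix of a primitive element. *)
Lemma rational_multiple (p : {mpoly algC[3]}) : p != 0 ->
  exists2 r : {mpoly rat[3]}, r != 0 &
    forall v : 'I_3 -> algC, p.@[v] = 0 -> (map_mpoly ratr r).@[v] = 0.
Proof.
move=> p0; have [beta _ [ps Dps]] := algC_PET [seq p@_m | m <- msupp p].
have [g [Dg mon_g] g_min] := minCpolyP beta.
pose c m := ps`_(index m (msupp p)).
have Dc m : m \in msupp p -> p@_m = (map_poly ratr (c m)).[beta].
  move=> pm; have lt_m : (index m (msupp p) < size (msupp p))%N by rewrite index_mem.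
  have := congr1 (fun s => s`_(index m (msupp p))) Dps.
  rewrite (nth_map 0%MM) // nth_index // => ->; rewrite (nth_map 0) //.
  by rewrite -(size_map (fun q => (map_poly ratr q).[beta])) -Dps size_map.
have [n [C char_C]] : exists n (C : 'M[rat]_n.+1), char_poly C = g.
  have [n [C char_C]] : exists n (C : 'M[rat]_n), char_poly C = g.
    by exists (size g).-1, (companionmx g); apply: companionmxK.
  case: n C char_C => [|n] C char_C; last by exists n, C.
  have g1 : g = 1 by rewrite -char_C /char_poly det_mx00.
  have := root_minCpoly beta.
  by rewrite Dg g1 rmorph1 => /rootP; rewrite hornerC => /eqP; rewrite oner_eq0.
pose N : 'M[{mpoly rat[3]}]_n.+1 :=
  \matrix_(i1, i2) \sum_(m <- msupp p) (horner_mx C (c m) i1 i2) *: 'X_[m].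
(* One computation serves twice: over Q at a point with natural coordinates, to see that [\det N] is
   nonzero, and over [algC], to see that it vanishes where [p] does. *)
have evN (S : fieldType) (f : {rmorphism rat -> S}) (v : 'I_3 -> S) (ev : {rmorphism {mpoly rat[3]} -> S}) :
    (forall q, ev q = (map_mpoly f q).@[v]) ->
  ev (\det N) = \det (horner_mx (map_mx f C)
    (\sum_(m <- msupp p) (\prod_i v i ^+ m i) *: map_poly f (c m))).
  move=> Dev; rewrite -det_map_mx; congr (\det _); apply/matrixP=> i1 i2.
  rewrite !mxE rmorph_sum linear_sum summxE; apply: eq_bigr => m _ /=.
  rewrite Dev map_mpolyZ mevalZ map_mpolyX mevalX linearZ /= mxE mulrC.
  by rewrite -map_horner_mx mxE.
exists (\det N).
  have [a pa] := mpoly3_nat_nonroot p0.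
  pose v : 'I_3 -> rat := fun k => (a k)%:R.
  apply: contraNneq pa => detN0.
  pose f0 := \sum_(m <- msupp p) (\prod_i v i ^+ m i) *: c m.
  have Df0 : (map_poly ratr f0).[beta] = p.@[fun k => (a k)%:R].
    rewrite mevalE rmorph_sum horner_sum; apply: eq_big_seq => m pm.
    rewrite /= map_polyZ hornerZ -Dc // mulrC; congr (_ * _).
    by rewrite rmorph_prod; apply: eq_bigr => k _; rewrite rmorphXn rmorph_nat.
  rewrite -Df0; apply/eqP; apply: contrapT => /eqP f0_neq0.
  have : \det (horner_mx C f0) = 0.
    have := evN _ idfun v (meval v) _; rewrite detN0 rmorph0 => ->.
      congr (\det (horner_mx _ _)); first by apply/matrixP=> k l; rewrite mxE.
      by apply: eq_bigr => m _; rewrite map_poly_id.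
    by move=> q; congr meval; apply/mpolyP=> m; rewrite mcoeff_map_mpoly.
  (* [f0] is nonzero at [beta], hence prime to its minimal polynomial [g], and [horner_mx C f0] is
     invertible. *)
  apply/eqP; have [[u w] /= Dd] := Bezoutp g f0; set d := gcdp g f0 in Dd.
  have d_beta : ~~ root (map_poly ratr d) beta.
    apply: contraNN f0_neq0 => rd; have /dvdpP[h ->] : d %| f0 by apply: dvdp_gcdr.
    by rewrite rmorphM hornerM (rootP rd) mulr0.
  have d1 : size d = 1%N.
    have /dvdpP[h Dh] : d %| g by apply: dvdp_gcdl.
    have g0 := monic_neq0 mon_g.
    have : root (map_poly ratr h) beta.
      have : root (map_poly ratr g) beta by rewrite -Dg root_minCpoly.
      by rewrite Dh rmorphM rootM (negPf d_beta) orbF.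
    rewrite g_min => g_h; have h0 : h != 0 by apply: contraNneq g0 => h0; rewrite Dh h0 mul0r.
    have d0 : d != 0 by apply: contraNneq g0 => d0; rewrite Dh d0 mulr0.
    have := dvdp_leq h0 g_h; rewrite {1}Dh size_mul //; move: h0 d0; rewrite -!size_poly_gt0.
    by move: (size h) (size d); clear; lia.
  have /size_poly1P[k k0 Dk] : size (u * g + w * f0) == 1%N by rewrite (eqp_size Dd) d1.
  have := congr1 (fun q => \det (horner_mx C q)) Dk.
  have Cg : horner_mx C g = 0 by rewrite -char_C Cayley_Hamilton.
  rewrite rmorphD !rmorphM /= Cg mulr0 add0r horner_mx_C det_scalar.
  rewrite -mulmxE det_mulmx => E; apply/eqP => det0; move: E; rewrite det0 mulr0 => /esym/eqP.
  by rewrite expf_eq0 (negPf k0).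
move=> v pv; pose ev : {rmorphism {mpoly rat[3]} -> algC} := meval v \o map_mpoly ratr.
rewrite -[LHS]/(ev _) (evN _ ratr v ev) //; set f := \sum_(m <- _) _.
(* At a zero of [p] the polynomial [f] is divisible by ['X - beta%:P], and [beta] is an eigenvalue
   of [C]. *)
have /factor_theorem[h ->] : root f beta.
  apply/rootP; rewrite horner_sum -[RHS]pv mevalE; apply: eq_big_seq => m pm.
  by rewrite hornerZ -Dc // mulrC.
rewrite rmorphM /= -mulmxE det_mulmx.
have : eigenvalue (map_mx ratr C) beta.
  by rewrite eigenvalue_root_char -map_char_poly char_C -Dg root_minCpoly.
rewrite /eigenvalue /eigenspace kermx_eq0 row_free_unit unitmxE unitfE negbK => /eqP det0.
by rewrite rmorphB /= horner_mx_X horner_mx_C det0 mulr0.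
Qed.

Lemma size_seq_irreducible_divisors (F : fieldType) (L : seq {poly F}) (r : {poly F}) :
    uniq L -> {in L, forall q, monic_irreducible_poly q /\ q %| r} -> r != 0 ->
  (size L < size r)%N.
Proof.
elim: L r => [|q L IHL] r /=; first by rewrite size_poly_gt0.
case/andP=> qL uniqL LP r0; have [mi_q /dvdpP[r' Dr]] := LP q (mem_head _ _).
have [q_gt1 _] := mi_q.1.
have r'0 : r' != 0 by apply: contraNneq r0 => r'0; rewrite Dr r'0 mul0r.
have q0 : q != 0 by rewrite -size_poly_gt0 ltnW.
have : (size L < size r')%N.
  apply: IHL => // s sL; have [mi_s s_r] := LP s (mem_behead (s := q :: L) sL); split=> //.
  rewrite Dr in s_r; rewrite -(Gauss_dvdpl _ (_ : coprimep s q)) // irreducible_poly_coprime; last exact: mi_s.1.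
  apply: contra qL => s_q; suff <- : s = q by [].
  apply/eqP; rewrite -eqp_monic ?mi_q.2 ?mi_s.2 //; apply: mi_q.1.2 => //.
  by have [[/gtn_eqF -> _] _] := mi_s.
rewrite Dr size_mul //; move: q_gt1 r'0; rewrite -size_poly_gt0.
by move: (size q) (size r') (size L); clear; lia.
Qed.

Lemma clear_denominators (F : fieldType) (c d x y z n : F) e D :
    d != 0 -> n != 0 -> (e <= D)%N ->
  c * (x * y * z ^+ e * n ^+ (D - e)) = d * n ^+ D * (c / d * (x * y * (z / n) ^+ e)).
Proof.
move=> d0 n0 le_eD; rewrite -{2}(subnK le_eD) exprD expr_div_n.
by field; rewrite d0 expf_neq0.
Qed.

(** * Density of the orbit points *)

Section OrbitPointsDense.

Variables (g : nat -> {poly int}) (t : nat -> algC).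
Hypothesis good_gt : forall k, good_factor k (g k) (t k).

Lemma residue_divisor_exists k : exists psi : {poly 'F_3},
  [/\ monic_irreducible_poly psi, psi %| map_poly intr (g k)
    & psi %| Ubar (half_period k) ^+ 2 - 1].
Proof.
have [_ lead_g gt0 _ le_g] := good_gt k.
have g_gt1 : (1 < size (g k))%N.
  rewrite ltnNge; apply/negP=> /size1_polyC Dg.
  move: gt0 lead_g; rewrite Dg map_polyC hornerC /= => /eqP; rewrite intr_eq0 => /eqP ->.
  by rewrite lead_coef0 dvdz0.
have [|psi mi psi_h] := @monic_irreducible_divisor _ (gcdp (map_poly intr (g k)) (Ubar (half_period k) ^+ 2 - 1)).
  by move: le_g g_gt1; move: (size (gcdp _ _)) (size (g k)); clear; lia.
by exists psi; split=> //; apply: dvdp_trans psi_h _; rewrite ?dvdp_gcdl ?dvdp_gcdr.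
Qed.

(** [T] carries side conditions on the level. Each new level is taken above all earlier ones, so its
    factor is new by [divisor_distinct]. *)
Lemma infinitely_many_residue_divisors (T : nat -> Prop) n :
    (forall k0, exists2 k, (k0 <= k)%N & T k) ->
  exists (L : seq {poly 'F_3}) (k1 : nat), [/\ uniq L, size L = n
    & {in L, forall psi, exists k, [/\ (k < k1)%N, T k, monic_irreducible_poly psi,
         psi %| map_poly intr (g k) & psi %| Ubar (half_period k) ^+ 2 - 1]}].
Proof.
move=> infT; elim: n => [|n [L [k1 [uniqL szL LP]]]]; first by exists [::], 0%N.
have [k le_k1 Tk] := infT k1; have [psi [mi psi_g psi_V]] := residue_divisor_exists k.
exists (psi :: L), k.+1; split=> [||phi].
- rewrite /= uniqL andbT; apply/negP=> /LP[l [lt_l _ _ psi_gl _]].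
  have := @divisor_distinct l k psi (leq_trans lt_l le_k1) mi.
  by rewrite psi_V (dvdp_trans psi_gl (good_factor_Qbar (good_gt l))) => /(_ isT).
- by rewrite /= szL.
rewrite inE => /predU1P[->|/LP[l [lt_l Tl mi_l l_g l_V]]]; first by exists k.
by exists l; split=> //; apply: leq_trans lt_l _; apply: leqW.
Qed.

(** The index j depends on the polynomial to be excluded, and for that j unboundedly many levels k
    are used; hence the order of quantifiers in the hypothesis. *)
Lemma orbit_points_dense (S : set (affine 3)) :
    (forall j k0, exists2 k, (k0 <= k)%N & S (orbit_point (t k) k j)) ->
  zariski_dense S.
Proof.
move=> infS; apply/seteqP; split=> // P _ p pS.
have [->|p0] := eqVneq p 0; first exact: meval0.
have [r r0 rp] := rational_multiple p0.
have rS Q : S Q -> (map_mpoly ratr r).@[Q 0] = 0 by move=> /pS; apply: rp.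
have [m0 m0r] : exists m0, m0 \in msupp r.
  by have := msupp_eq0 r; rewrite (negPf r0); case: (msupp r) => // m s _; exists m; rewrite mem_head.
have [q [d d0 Dq]] := rat_poly_scale (Poly [seq r@_m | m <- msupp r]).
pose a (m : 'X_{1..3}) := q`_(index m (msupp r)).
have Da m : m \in msupp r -> r@_m = (a m)%:~R / d%:~R.
  move=> rm; have := congr1 (fun s : {poly rat} => s`_(index m (msupp r))) Dq.
  rewrite coef_Poly (nth_map 0%MM) ?index_mem // nth_index // coefZ coef_map /= => ->.
  by rewrite mulrC.
have a0 m : m \in msupp r -> a m != 0.
  move=> rm; have := rm; rewrite mcoeff_msupp Da //; apply: contraNneq => ->.
  by rewrite mul0r.
have [D [mt mt_r mt2] le_D] : exists2 D, exists2 mt : 'X_{1..3}, mt \in msupp r & mt 2%R = D &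
    forall m : 'X_{1..3}, m \in msupp r -> (m 2%R <= D)%N.
  pose PD d := has (fun m : 'X_{1..3} => m 2%R == d) (msupp r).
  have exD : exists d, PD d by exists (m0 2%R); apply/hasP; exists m0.
  have ubD e : PD e -> (e <= msize r)%N.
    case/hasP=> m rm /eqP <-; apply: leq_trans (ltnW (msize_mdeg_lt rm)).
    by rewrite mdegE (bigD1 2%R) //= leq_addr.
  case: (ex_maxnP exD ubD) => D /hasP[mt mt_r /eqP mt2] maxD; exists D; first by exists mt.
  by move=> m rm; apply: maxD; apply/hasP; exists m.
pose s := [seq m : 'X_{1..3} <- msupp r | m 2%R == D].
have sP (m : 'X_{1..3}) : m \in s -> m \in msupp r /\ m 2%R = D.
  by rewrite mem_filter => /andP[/eqP].
have mt_s : mt \in s by rewrite mem_filter mt2 eqxx.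
(* 3^c is the 3-part of the content of the coefficient of z^D, which is divided by it before
   reduction modulo 3. The other coefficients may be less divisible by 3; the denominator of z will
   make up for this. *)
have [c [m1 m1_s m1c] le_c] : exists2 c, exists2 m, m \in s & logn 3 `|a m| = c &
    forall m, m \in s -> (c <= logn 3 `|a m|)%N.
  pose Pc d := has (fun m => logn 3 `|a m| == d) s.
  have exc : exists d, Pc d by exists (logn 3 `|a mt|); apply/hasP; exists mt.
  case: (ex_minnP exc) => c /hasP[m1 m1_s /eqP m1c] minc; exists c; first by exists m1.
  by move=> m sm; apply: minc; apply/hasP; exists m.
have dvd_a m : m \in s -> ((3 ^ c)%N %| a m)%Z.
  move=> sm; rewrite /dvdz /=; apply: (dvdn_trans _ (pfactor_dvdnn 3 `|a m|)).
  exact: dvdn_exp2l (le_c m sm).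
pose b m := (a m %/ (3 ^ c)%N)%Z.
have Db m : m \in s -> a m = (3 ^ c)%N%:Z * b m by move=> sm; rewrite mulrC divzK ?dvd_a.
have b_m1 : ~~ (3 %| b m1)%Z.
  apply/negP=> dvd_b; have m1_r := (sP _ m1_s).1.
  have : (3 ^ c.+1 %| `|a m1|)%N.
    by rewrite (Db _ m1_s) abszM expnSr dvdn_mul.
  by rewrite pfactor_dvdn ?absz_gt0 ?a0 // m1c ltnn.
pose r' : {poly {poly 'F_3}} := \sum_(m <- s) ((b m)%:~R *: 'X^(m 1%R)) *: 'X^(m 0%R).
have r'0 : r' != 0.
  apply/eqP=> /(congr1 (fun q : {poly {poly 'F_3}} => q`_(m1 0%R)`_(m1 1%R))).
  rewrite !coef0 coef_sum coef_sum (bigD1_seq m1) ?filter_uniq ?msupp_uniq //=.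
  rewrite coefZ coefXn eqxx mulr1 coefZ coefXn eqxx mulr1.
  rewrite big_seq_cond big1 ?addr0 => [/eqP|m /andP[sm neq_m]].
    by apply/negP; rewrite intr_Fp_eq0.
  rewrite coefZ coefXn; case: eqP => [E0|_]; last by rewrite mulr0 coef0.
  rewrite mulr1 coefZ coefXn; case: eqP => [E1|_]; last by rewrite mulr0.
  case/eqP: neq_m; apply/mnmP; elim/ord3_ind; rewrite ?E0 ?E1 //.
  by rewrite (sP _ sm).2 (sP _ m1_s).2.
(* With this j the size of [r'] is at most 3^j, and j + 1 is not divisible by 4. *)
pose j := (4 * size r')%N.
have [L [emb _]] := countable_algebraic_closure 'F_3.
have R0 : (map_poly (fun q => q \Po Qbar j.+1) r').[Qbar j] != 0.
  apply: (Qbar_curve_dense emb r'0).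
    by apply: (leq_trans (ltnW (ltn_expl _ (isT : (1 < 3)%N)))); rewrite leq_exp2l // /j leq_pmull.
  by rewrite -[j.+1]addn1 /j dvdn_addr ?dvdn_mulr.
set R := (_).[_] in R0.
pose Rhat : {poly int} := \sum_(m <- s) (b m)%:~R * (qpol j ^+ m 0%R * qpol j.+1 ^+ m 1%R).
have DR : map_poly intr Rhat = R.
  rewrite /R -[map_poly _ r']/(map_poly (comp_poly (Qbar j.+1)) r') /r' /Rhat !rmorph_sum /=.
  rewrite horner_sum; apply: eq_bigr => m _.
  rewrite map_polyZ map_polyXn hornerZ hornerXn /= comp_polyZ comp_Xn_poly scaler_int.
  by rewrite !(rmorphM, rmorphXn, rmorph_int) /= mulrzl mulrzAl mulrC.
(* For c <= k the denominator, a multiple of 3^(k+1), supplies the factor 3^c and one further factor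
   3. *)
pose T k := (c <= k)%N /\ S (orbit_point (t k) k j).
have infT k0 : exists2 k, (k0 <= k)%N & T k.
  have [k] := infS j (maxn k0 c); rewrite geq_max => /andP[? ?] ?.
  by exists k.
have [Lp [k1 [uniqL szL LP]]] := infinitely_many_residue_divisors (size R) infT.
suff : (size Lp < size R)%N by rewrite szL ltnn.
apply: size_seq_irreducible_divisors => // psi /LP[k [_ [le_ck Sk] mi psi_g psi_V]].
split=> //; have [_ lead_g gt0 g_min _] := good_gt k.
have psi_q := dvdp_trans psi_g (good_factor_Qbar (good_gt k)).
have := residue_qZ j.+1 mi psi_q psi_V.
set hp := half_period k in psi_q psi_V *; set Z := qZ hp j.+1 => nZ.
pose ev : {rmorphism {poly int} -> algC} := horner_eval (t k) \o map_poly intr.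
have [w Dw] := dvd_pow2_half_period k; rewrite -/hp in Dw.
pose N : {poly int} := 2 ^+ hp.*2 - 1.
have DN : N = (3 ^ k.+1 * w)%N%:R by rewrite /N -natrX -Dw natrB ?expn_gt0.
have evN : ev N = 2 ^+ hp.*2 - 1 by rewrite rmorphB rmorphXn rmorph_nat rmorph1.
have N0 : ev N != 0 by rewrite evN pow2_sub1_neq0 // double_gt0 ltnW ?half_period_gt1.
pose term (m : 'X_{1..3}) : {poly int} :=
  (a m)%:~R * (qpol j ^+ m 0%R * qpol j.+1 ^+ m 1%R * Z ^+ m 2%R * N ^+ (D - m 2%R)).
have sum0 : ev (\sum_(m <- msupp r) term m) = 0.
  pose v := orbit_point (t k) k j 0.
  have v0 : v 0 = ev (qpol j) by rewrite /v mxE.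
  have v1 : v 1 = ev (qpol j.+1) by rewrite /v mxE.
  have v2 : v 2 = ev Z / ev N by rewrite /v mxE evN.
  have r_v0 : \sum_(m <- msupp r) ratr r@_m * \prod_i v i ^+ m i = 0.
    rewrite -[RHS](rS _ Sk) -/v.
    have -> : map_mpoly ratr r = \sum_(m <- msupp r) ratr r@_m *: 'X_[m] :> {mpoly algC[3]}.
      rewrite {1}(mpolyE r) raddf_sum; apply: eq_bigr => m _.
      by rewrite /= map_mpolyZ map_mpolyX.
    by rewrite raddf_sum; apply: eq_bigr => m _; rewrite /= mevalZ mevalX.
  rewrite rmorph_sum -[RHS](mulr0 (d%:~R * ev N ^+ D)) -[in RHS]r_v0 mulr_sumr.
  apply: eq_big_seq => m rm; rewrite big_prod3 v0 v1 v2 Da //.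
  have -> : ratr ((a m)%:~R / d%:~R) = (a m)%:~R / d%:~R :> algC.
    by rewrite fmorph_div /= !ratr_int.
  have ev_term (A : int) (x y z n : {poly int}) e1 e2 e3 e4 :
      ev (A%:~R * (x ^+ e1 * y ^+ e2 * z ^+ e3 * n ^+ e4)) =
      A%:~R * (ev x ^+ e1 * ev y ^+ e2 * ev z ^+ e3 * ev n ^+ e4).
    by rewrite !rmorphM !rmorphXn rmorph_int.
  rewrite -[LHS]/(ev (term m)) /term ev_term.
  by apply: clear_denominators => //; [rewrite intr_eq0 | apply: le_D].
pose W : {poly int} := \sum_(m <- msupp r | m 2%R != D)
  (a m)%:~R * (qpol j ^+ m 0%R * qpol j.+1 ^+ m 1%R * Z ^+ m 2%R *
    ((3 ^ (k - c) * w)%N%:R * N ^+ (D - m 2%R).-1)).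
(* Terms of lower degree in z retain a factor N, so after division by 3^c they vanish modulo 3. *)
have Dsum : \sum_(m <- msupp r) term m = (3 ^ c)%N%:R * (Rhat * Z ^+ D + 3%:R * W).
  rewrite (bigID (fun m : 'X_{1..3} => m 2%R == D)) /= -big_filter -/s mulrDr; congr (_ + _).
    rewrite /Rhat mulr_suml mulr_sumr; apply: eq_big_seq => m sm.
    rewrite /term (Db _ sm) (sP _ sm).2 subnn expr0 mulr1 intrM.
    by rewrite -[(Posz _)%:~R]/((3 ^ c)%N%:R) !mulrA.
  rewrite /W !mulr_sumr [LHS]big_seq_cond [RHS]big_seq_cond; apply: eq_bigr => m /andP[rm neq_mD].
  have lt_mD : (m 2%R < D)%N by rewrite ltn_neqAle neq_mD le_D.
  have DN' : N = (3 ^ c)%N%:R * (3%:R * (3 ^ (k - c) * w)%N%:R).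
    by rewrite DN -(subnKC (leqW le_ck)) subSn // expnD expnS -!mulnA !natrM.
  rewrite /term; have -> : N ^+ (D - m 2%R) = N * N ^+ (D - m 2%R).-1.
    by rewrite -exprS prednK // subn_gt0.
  have reorder (x1 x2 x3 x4 x5 x6 : {poly int}) :
      x1 * (x2 * (x3 * (x4 * x5) * x6)) = x3 * (x4 * (x1 * (x2 * (x5 * x6)))) by ring.
  by rewrite {1}DN' reorder.
have : ev (Rhat * Z ^+ D + 3%:R * W) = 0.
  apply/eqP; move/eqP: sum0; rewrite Dsum rmorphM mulf_eq0 rmorph_nat pnatr_eq0.
  by rewrite expn_eq0.
move=> /(dvdp_map_of_root (isT : prime 3) psi_g lead_g gt0 g_min).
rewrite rmorphD !rmorphM rmorph_nat Fp3_char mul0r addr0 /= DR rmorphXn /=.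
rewrite Gauss_dvdpl // coprimep_expr // irreducible_poly_coprime //.
exact: mi.1.
Qed.

End OrbitPointsDense.

(** * Dynamical degrees *)

Notation X0 := ('X_(lshift 3 0) : {mpoly algC[1 + 3]}).
Notation XA k := ('X_(rshift 1 k) : {mpoly algC[1 + 3]}).

Definition dominant_forms (phi : affine 3 -> affine 3) (e : 'I_3) (D : nat)
    (c : algC) (R H : 'I_3 -> {mpoly algC[1 + 3]}) :=
  [/\ c != 0, forall k, R k \is D.-1.-homog,
    forall k, H k = (if k == e then c *: XA e ^+ D else 0) + X0 * R k
    & forall P k, phi P 0 k = (H k).@[homog_coords P 0]].

(** The common shape of the map and its inverse: [e] is the coordinate that gets cubed, and [o] the
    one that receives its old value. *)
Definition skew_step (e o : 'I_3) (s la mu : algC) (P : affine 3) : affine 3 :=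
  \row_k (if k == e then P 0 o + s * (P 0 e - P 0 e ^+ 3)
          else if k == o then P 0 e else la * P 0 2 + mu * P 0 e).

Lemma dhomogM_eq n (R : comNzRingType) (p q : {mpoly R[n]}) d1 d2 d :
  p \is d1.-homog -> q \is d2.-homog -> (d1 + d2)%N = d -> p * q \is d.-homog.
Proof. by move=> homp homq <-; apply: dhomogM. Qed.

Lemma homog_coords0 (P : affine 3) : homog_coords P 0 (lshift 3 0) = 1.
Proof. by rewrite row_mxEl mxE eqxx. Qed.

Lemma homog_coordsS (P : affine 3) k : homog_coords P 0 (rshift 1 k) = P 0 k.
Proof. by rewrite row_mxEr. Qed.

(** Only [H e] is required to be a power of [XA e] modulo [X0]; this admits the identity as a start,
    although its other coordinates do not vanish at infinity. *)
Lemma skew_step_dominant (phi psi : affine 3 -> affine 3) (e o : 'I_3) (s la mu c : algC)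
    (D : nat) (R : {mpoly algC[1 + 3]}) (H : 'I_3 -> {mpoly algC[1 + 3]}) :
    (0 < D)%N -> s != 0 -> c != 0 ->
    R \is D.-1.-homog -> (forall k, H k \is D.-homog) -> H e = c *: XA e ^+ D + X0 * R ->
    (forall P k, phi P 0 k = (H k).@[homog_coords P 0]) ->
    (forall P, psi P = skew_step e o s la mu (phi P)) ->
  exists c' R' H', dominant_forms psi e (3 * D) c' R' H'.
Proof.
move=> D0 s0 c0 homR homH De Dphi Dpsi.
have homX k : ('X_k : {mpoly algC[1 + 3]}) \is 1.-homog by rewrite dhomogX /= mdeg1.
have homXn k n : ('X_k : {mpoly algC[1 + 3]}) ^+ n \is n.-homog.
  by have := dhomogMn n (homX k); rewrite mul1n.
pose a := c *: XA e ^+ D; pose b := X0 * R.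
have homa : a \is D.-homog by rewrite dhomogZ.
have homb : b \is D.-homog by apply: dhomogM_eq (homX _) homR _; rewrite add1n prednK.
(* [M] homogenizes the terms of lower degree up to one factor [X0], and (a + b)^3 = a^3 + X0 B for
   the [B] below. *)
pose M := X0 ^+ (2 * D).-1.
have homM G : G \is D.-homog -> M * G \is (3 * D).-1.-homog.
  move=> homG; apply: dhomogM_eq (homXn _ _) homG _.
  by move: D0; clear; lia.
pose B := R * ((a * a + a * b) *+ 3 + b * b).
have homB : B \is (3 * D).-1.-homog.
  apply: (@dhomogM_eq _ _ _ _ D.-1 (D + D)); rewrite // ?dhomogD ?rpredMn ?dhomogD ?dhomogM //.
  by move: D0; clear; lia.
pose R' (k : 'I_3) := if k == e then M * H o + s *: (M * H e) - s *: B
   else if k == o then M * H e else la *: (M * H 2) + mu *: (M * H e).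
pose c' := - s * c ^+ 3.
exists c', R', (fun k => (if k == e then c' *: XA e ^+ (3 * D) else 0) + X0 * R' k).
split=> // [|k|P k].
- by rewrite mulf_neq0 ?oppr_eq0 ?expf_neq0.
- rewrite /R'; case: ifP => _; last case: ifP => _.
  + by rewrite -scaleNr !dhomogD ?dhomogZ ?homM.
  + exact: homM.
  + by rewrite dhomogD ?dhomogZ ?homM.
have ev0 : X0.@[homog_coords P 0] = 1 by rewrite mevalXU homog_coords0.
have evM : M.@[homog_coords P 0] = 1 by rewrite rmorphXn /= ev0 expr1n.
have eva : a.@[homog_coords P 0] = c * P 0 e ^+ D.
  by rewrite mevalZ rmorphXn /= mevalXU homog_coordsS.
have evb : b.@[homog_coords P 0] = R.@[homog_coords P 0] by rewrite mevalM ev0 mul1r.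
have eve : phi P 0 e = c * P 0 e ^+ D + R.@[homog_coords P 0].
  by rewrite Dphi De mevalD eva evb.
rewrite {homa homb homB homM}/R' /B {R' B}; clearbody a b M.
rewrite Dpsi [LHS]mxE mevalD mevalM ev0 mul1r; case: (k == e); last first.
  rewrite meval0 add0r; case: ifP => _; first by rewrite mevalM evM mul1r Dphi.
  by rewrite mevalD !mevalZ !mevalM evM !mul1r !Dphi.
rewrite mevalB mevalD !mevalZ !(mevalM, mevalD, mevalMn) eva evb evM -!Dphi eve.
rewrite rmorphXn /= mevalXU homog_coordsS mulnC exprM /c'.
by set u := P 0 e ^+ D; ring.
Qed.

Lemma dominant_homog (phi : affine 3 -> affine 3) e D c R H k : (0 < D)%N ->
  dominant_forms phi e D c R H -> H k \is D.-homog.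
Proof.
move=> D0 [_ homR -> _].
have homX i : ('X_i : {mpoly algC[1 + 3]}) \is 1.-homog by rewrite dhomogX /= mdeg1.
apply: rpredD; last by apply: dhomogM_eq (homX _) (homR k) _; rewrite add1n prednK.
case: ifP => _; last exact: rpred0.
by rewrite dhomogZ //; have := dhomogMn D (homX (rshift 1 e)); rewrite mul1n.
Qed.

Lemma iter_skew_step_dominant (e o : 'I_3) (s la mu : algC) n : s != 0 -> (0 < n)%N ->
  exists c R H, dominant_forms (iter n (skew_step e o s la mu)) e (3 ^ n) c R H.
Proof.
move=> s0; case: n => // n _; elim: n => [|n [c [R [H domH]]]].
  apply: (@skew_step_dominant id _ e o s la mu 1 1%N 0 (fun k => XA k)) => //.
  - exact: oner_neq0.
  - exact: rpred0.
  - by move=> k; rewrite dhomogX /= mdeg1.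
  - by rewrite mulr0 addr0 scale1r.
  - by move=> P k; rewrite mevalXU homog_coordsS.
have D0 : (0 < 3 ^ n.+1)%N by rewrite expn_gt0.
have [c0 homR DH Dphi] := domH.
rewrite [X in dominant_forms _ _ X]expnS.
apply: (@skew_step_dominant (iter n.+1 (skew_step e o s la mu)) _ e o s la mu c (3 ^ n.+1) (R e) H) => //.
  by move=> k; apply: dominant_homog domH.
by rewrite DH eqxx.
Qed.

Section Polynomials.

Lemma rmorph_mmap n (R : nzRingType) (S S' : comNzRingType) (g : {rmorphism S -> S'})
    (f : R -> S) (h : 'I_n -> S) p : g (mmap f h p) = mmap (g \o f) (g \o h) p.
Proof.
rewrite /mmap rmorph_sum; apply: eq_bigr => m _; rewrite rmorphM /mmap1 rmorph_prod.
by congr (_ * _); apply: eq_bigr => j _; rewrite rmorphXn.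
Qed.

Lemma homog_meval_scale n (R : comNzRingType) d (p : {mpoly R[n]}) (v : 'I_n -> R) t :
  p \is d.-homog -> p.@[fun i => t * v i] = t ^+ d * p.@[v].
Proof.
move=> homp; rewrite !mevalE mulr_sumr [LHS]big_seq [RHS]big_seq; apply: eq_bigr => m m_p.
rewrite mulrCA; congr (_ * _); under eq_bigr do rewrite exprMn.
by rewrite big_split /= prodrXr -mdegE (dhomog_mf homp m_p).
Qed.

Lemma size_homog_mmap n (R : nzRingType) (T : idomainType) (f : R -> T) (h : 'I_n -> {poly T})
    d (p : {mpoly R[n]}) : p \is d.-homog -> (forall i, size (h i) <= 2)%N ->
  (size (mmap (polyC \o f) h p) <= d.+1)%N.
Proof.
move=> homp size_h; rewrite /mmap big_seq; apply: (big_ind (fun q : {poly T} => size q <= d.+1)%N).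
- by rewrite size_poly0.
- by move=> p1 p2 s1 s2; rewrite (leq_trans (size_polyD _ _)) // geq_max s1.
move=> m m_p; rewrite /= mul_polyC (leq_trans (size_scale_leq _ _)) //.
have <- : mdeg m = d := dhomog_mf homp m_p.
rewrite mdegE.
apply: (big_ind2 (fun (q : {poly T}) k => size q <= k.+1)%N).
- by rewrite size_poly1.
- move=> p1 k1 p2 k2 s1 s2; apply: (leq_trans (size_polyMleq _ _)).
  by move: s1 s2; clear; lia.
move=> i _; apply: (leq_trans (size_poly_exp_leq _ _)).
rewrite ltnS -[X in (_ <= X)%N]mul1n leq_mul2r; apply/orP; right.
by move: (size_h i); clear; lia.
Qed.

(** The Sylvester matrix keeps its size when neither leading coefficient is killed. *)
Lemma rmorph_resultant (S S' : nzRingType) (f : {rmorphism S -> S'}) (p q : {poly S}) :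
    f (lead_coef p) != 0 -> f (lead_coef q) != 0 ->
  f (resultant p q) = resultant (map_poly f p) (map_poly f q).
Proof.
move=> fp fq; rewrite /resultant /Sylvester_mx !size_map_poly_id0 // -det_map_mx map_col_mx.
by congr (\det (col_mx _ _)); apply: map_lin1_mx => v; rewrite map_poly_rV rmorphM /= map_rVpoly.
Qed.

Lemma lead_coef_deriv (T : nzRingType) (p : {poly T}) : lead_coef p *+ (size p).-1 != 0 ->
  lead_coef p^`() = lead_coef p *+ (size p).-1.
Proof.
move=> lp; have p0 : p != 0 by apply: contraNneq lp => ->; rewrite lead_coef0 mul0rn.
have : (1 < size p)%N.
  by rewrite ltnNge; apply: contraNN lp => sz; rewrite (_ : _.-1 = 0%N) ?mulr0n //; move: sz; clear; lia.
case sz: (size p) lp => [|[|n]] // lp _.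
have cn : p^`()`_n = lead_coef p *+ n.+1 by rewrite coef_deriv lead_coefE sz.
have sz' : size p^`() = n.+1.
  apply/eqP; rewrite eqn_leq -ltnS -sz lt_size_deriv //= ltnNge; apply: contraNN lp => sz'.
  by rewrite -cn nth_default.
by rewrite lead_coefE sz' /= cn.
Qed.

Lemma deriv_neq0 (p : {poly algC}) : (1 < size p)%N -> p^`() != 0.
Proof.
move=> szp; rewrite -lead_coef_eq0 lead_coef_deriv mulrn_eq0 negb_or lead_coef_eq0.
all: by rewrite -size_poly_gt0 (ltn_trans _ szp) //; move: szp; case: (size p) => [|[]].
Qed.

End Polynomials.

(** * The preimage of a general plane on a general line *)

Section LineSection.
Variables (phi : affine 3 -> affine 3) (e o z : 'I_3) (D : nat) (c : algC).
Variables (R H : 'I_3 -> {mpoly algC[1 + 3]}).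
Hypotheses (uniq_eoz : uniq [:: e; o; z]) (D0 : (0 < D)%N) (domH : dominant_forms phi e D c R H).
Variables ra rb rc : 'I_3.

Let x0 : 'I_(1 + 3) := lshift 3 0.
Let xe : 'I_(1 + 3) := rshift 1 e.
Let xo : 'I_(1 + 3) := rshift 1 o.
Let xz : 'I_(1 + 3) := rshift 1 z.

Lemma coord_cases (k : 'I_(1 + 3)) : [\/ k = x0, k = xe, k = xo | k = xz].
Proof.
case: (split_ordP k) => [j ->|j ->]; first by rewrite ord1; constructor 1.
have : [|| j == e, j == o | j == z].
  by move: uniq_eoz; move: e o z j; do 4![elim/ord3_ind].
by case/or3P => /eqP ->; [constructor 2|constructor 3|constructor 4].
Qed.

Lemma coord_neq : [/\ xe != x0, xo != x0, xz != x0, xo != xe & xz != xe /\ xz != xo].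
Proof.
move: uniq_eoz; rewrite /= !inE negb_or => /andP[/andP[eo ez] /andP[oz _]].
by rewrite !(inj_eq (@rshift_inj _ _)) [o == e]eq_sym [z == e]eq_sym [z == o]eq_sym.
Qed.

Lemma sum_coords (V : nmodType) (F : 'I_(1 + 3) -> V) :
  \sum_k F k = F x0 + F xe + F xo + F xz.
Proof.
have [e0 o0 z0 oe [ze zo]] := coord_neq.
rewrite (bigD1 x0) // (bigD1 xe) //= (bigD1 xo) /= ?o0 // (big_pred1 xz) ?addrA // => k /=.
case: (coord_cases k) => ->; rewrite ?eqxx /= ?andbF //.
- by rewrite eq_sym (negPf ze).
- by rewrite eq_sym (negPf zo).
- by rewrite ze zo.
Qed.

Definition proj_form (k : 'I_(1 + 3)) : {mpoly algC[1 + 3]} :=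
  match fintype.split k with inl _ => X0 ^+ D | inr j => H j end.

Lemma proj_form0 : proj_form x0 = X0 ^+ D.
Proof. by rewrite /proj_form (unsplitK (inl _)). Qed.

Lemma proj_formS k : proj_form (rshift 1 k) = H k.
Proof. by rewrite /proj_form (unsplitK (inr _)). Qed.

Lemma proj_form_homog k : proj_form k \is D.-homog.
Proof.
rewrite /proj_form; case: (fintype.split k) => j; last exact: dominant_homog domH.
have homX : X0 \is 1.-homog by rewrite dhomogX /= mdeg1.
by have := dhomogMn D homX; rewrite mul1n.
Qed.

Lemma meval_proj_form P k : (proj_form k).@[homog_coords P 0] = homog_coords (phi P) 0 k.
Proof.
case: (split_ordP k) => [j ->|j ->]; last by rewrite proj_formS homog_coordsS; case: domH.
by rewrite ord1 proj_form0 rmorphXn /= mevalXU !homog_coords0 expr1n.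
Qed.

Section Generic.
Variables (T : idomainType) (f : {rmorphism algC -> T}) (A : 'M[T]_(3, 1 + 3)).

Definition minor j k := A rb j * A rc k - A rb k * A rc j.

(* The line cut out by the rows [rb] and [rc] of [A], parametrized by the coordinate [e] and scaled
   by [minor xo xz]; at [y] the polynomial [line_poly] is the equation of row [ra] at the image. *)
Definition line_point (k : 'I_(1 + 3)) : {poly T} :=
  if k == x0 then (minor xo xz)%:P else
  if k == xe then (minor xo xz)%:P * 'X else
  if k == xo then (minor xz x0)%:P + (minor xz xe)%:P * 'X
  else (minor x0 xo)%:P + (minor xe xo)%:P * 'X.

Definition line_poly : {poly T} :=
  \sum_k (A ra k)%:P * mmap (polyC \o f) line_point (proj_form k).

Lemma size_line_point k : (size (line_point k) <= 2)%N.
Proof.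
have szC (a : T) : (size a%:P <= 2)%N by rewrite (leq_trans (size_polyC_leq1 _)).
have szX (a : T) : (size (a%:P * 'X)%R <= 2)%N.
  by rewrite (leq_trans (size_polyMleq _ _)) // size_polyX addn2 /= ltnS size_polyC_leq1.
have szD (a b : T) : (size (a%:P + b%:P * 'X)%R <= 2)%N.
  by rewrite (leq_trans (size_polyD _ _)) // geq_max szC szX.
by rewrite /line_point; do 3?[case: ifP => _].
Qed.

Lemma line_polyE : exists2 q : {poly T}, (size q <= D)%N &
  line_poly = (A ra xe * f c * minor xo xz ^+ D) *: 'X^D + q.
Proof.
pose S k := mmap (polyC \o f) line_point (R k); pose dl := minor xo xz.
have sizeS k : (size (S k) <= D)%N.
  have [_ homR _ _] := domH.
  by have := size_homog_mmap f (homR k) size_line_point; rewrite prednK.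
have pt0 : line_point x0 = dl%:P by rewrite /line_point eqxx.
have pte : line_point xe = dl%:P * 'X.
  by have [e0 _ _ _ _] := coord_neq; rewrite /line_point (negPf e0) eqxx.
have HE k : mmap (polyC \o f) line_point (proj_form (rshift 1 k)) =
    (if k == e then (f c * dl ^+ D) *: 'X^D else 0) + dl *: S k.
  have [_ _ -> _] : dominant_forms phi e D c R (fun k => proj_form (rshift 1 k)).
    by case: domH => ? ? DH Dphi; split=> // *; rewrite proj_formS.
  rewrite rmorphD rmorphM /= mmapX mmap1U pt0 mul_polyC; congr (_ + _).
  case: ifP => _; last by rewrite raddf0.
  by rewrite mmapZ rmorphXn /= mmapX mmap1U pte exprMn -polyC_exp mulrA -polyCM mul_polyC.
exists ((A ra x0 * dl ^+ D)%:P + \sum_k (A ra (rshift 1 k) * dl) *: S k).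
  rewrite (leq_trans (size_polyD _ _)) // geq_max (leq_trans (size_polyC_leq1 _)) //=.
  rewrite (leq_trans (size_sum _ _ _)) //; apply/bigmax_leqP => k _.
  by rewrite (leq_trans (size_scale_leq _ _)).
rewrite /line_poly big_split_ord big_ord1 /= proj_form0 rmorphXn /= mmapX mmap1U pt0.
rewrite -polyC_exp -polyCM addrCA; congr (_ + _).
under eq_bigr do rewrite HE mulrDr !mul_polyC scalerA.
rewrite big_split /= (bigD1 e) //= eqxx big1 ?addr0; last by move=> k /negPf->; rewrite scaler0.
by rewrite scalerA mulrA.
Qed.

Lemma size_line_poly : A ra xe != 0 -> minor xo xz != 0 -> f c != 0 ->
  size line_poly = D.+1.
Proof.
move=> a0 d0 c0; have [q szq ->] := line_polyE; set l := _ * _.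
have l0 : l != 0 by rewrite !mulf_neq0 ?expf_neq0.
have szX : size (l *: 'X^D) = D.+1 by rewrite size_scale // size_polyXn.
by rewrite size_polyDl ?szX.
Qed.

End Generic.

Lemma map_line_poly (T T' : idomainType) (f : {rmorphism algC -> T}) (g : {rmorphism T -> T'})
    (A : 'M[T]_(3, 1 + 3)) :
  map_poly g (line_poly f A) = line_poly (g \o f) (map_mx g A).
Proof.
rewrite /line_poly rmorph_sum; apply: eq_bigr => k _; rewrite rmorphM /= map_polyC mxE.
rewrite rmorph_mmap; congr (_ * _).
have gm j l : g (minor A j l) = minor (map_mx g A) j l by rewrite /minor rmorphB !rmorphM !mxE.
have -> : map_poly g \o line_point A = line_point (map_mx g A).
  apply/funext => j; rewrite /line_point /=.
  case: ifP => _; first by rewrite map_polyC /= gm.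
  case: ifP => _; first by rewrite rmorphM /= map_polyC map_polyX /= gm.
  by case: ifP => _; rewrite rmorphD rmorphM /= !map_polyC map_polyX /= !gm.
by congr (mmap _ _ _); apply/funext => x /=; rewrite map_polyC.
Qed.

Lemma horner_line_poly (A : 'M[algC]_(3, 1 + 3)) y :
  (line_poly idfun A).[y] = \sum_k A ra k * (proj_form k).@[fun j => (line_point A j).[y]].
Proof.
rewrite -horner_evalE rmorph_sum; apply: eq_bigr => k _; rewrite rmorphM /= horner_evalE hornerC.
by rewrite rmorph_mmap; congr (_ * mmap _ _ _); apply/funext => x; rewrite /= horner_evalE hornerC.
Qed.

Definition generic_matrix : 'M[{mpoly algC[3 * (1 + 3)]}]_(3, 1 + 3) :=
  \matrix_(i, j) 'X_(mxvec_index i j).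

(** The factors ensure that the line is parametrized by the coordinate [e], that the equation on it
    has degree exactly [D], and that this equation is separable. The generic matrix turns these
    conditions into a polynomial in the entries. *)
Definition line_disc : {mpoly algC[3 * (1 + 3)]} :=
  let G := line_poly (@mpolyC _ algC) generic_matrix in
  minor generic_matrix xo xz * generic_matrix ra xe * resultant G G^`().

Lemma meval_generic_matrix (A : 'M[algC]_(3, 1 + 3)) i j :
  (generic_matrix i j).@[mxvec A 0] = A i j.
Proof. by rewrite mxE mevalXU mxvecE. Qed.

Lemma meval_generic_minor (A : 'M[algC]_(3, 1 + 3)) j k :
  (minor generic_matrix j k).@[mxvec A 0] = minor A j k.
Proof. by rewrite /minor mevalB !mevalM !meval_generic_matrix. Qed.

(** Under the two conditions the leading coefficients survive specialization, so the resultant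
    commutes with it. *)
Lemma meval_line_disc (A : 'M[algC]_(3, 1 + 3)) : let G := line_poly idfun A in
    minor A xo xz != 0 -> A ra xe != 0 ->
  line_disc.@[mxvec A 0] = minor A xo xz * A ra xe * resultant G G^`().
Proof.
move=> G d0 a0; pose ev : {rmorphism _ -> _} := meval (mxvec A 0).
have c0 : c != 0 by case: domH.
have evA : map_mx ev generic_matrix = A.
  by apply/matrixP => i j; rewrite mxE [LHS]meval_generic_matrix.
have evd : ev (minor generic_matrix xo xz) = minor A xo xz by exact: meval_generic_minor.
have eva : ev (generic_matrix ra xe) = A ra xe by exact: meval_generic_matrix.
have evG : map_poly ev (line_poly (@mpolyC _ algC) generic_matrix) = G.
  rewrite map_line_poly evA /G /line_poly.
  apply: eq_bigr => k _; congr (_ * mmap _ _ _).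
  by apply/funext => x; rewrite /= mevalC.
rewrite /line_disc !rmorphM /= evd eva; congr (_ * _).
have gd0 : minor generic_matrix xo xz != 0 by apply: contraNneq d0 => d0; rewrite -evd d0 rmorph0.
have ga0 : generic_matrix ra xe != 0 by apply: contraNneq a0 => a0; rewrite -eva a0 rmorph0.
have szg : size (line_poly (@mpolyC _ algC) generic_matrix) = D.+1.
  by apply: (@size_line_poly _ (@mpolyC _ algC)) => //; rewrite mpolyC_eq0.
have szG := @size_line_poly _ idfun A a0 d0 c0.
move: evG szg; set g := line_poly _ _ => evG szg.
have evlead : ev (lead_coef g) = lead_coef G.
  by rewrite !lead_coefE szg szG -evG coef_map.
have lG0 : lead_coef G != 0 by rewrite lead_coef_eq0 -size_poly_eq0 szG.
have lG'0 : lead_coef G *+ D != 0 by rewrite mulrn_eq0 negb_or -lt0n D0.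
have lg' : ev (lead_coef g^`()) = lead_coef G *+ D.
  rewrite lead_coef_deriv szg /= ?rmorphMn ?evlead //.
  by apply: contraNneq lG'0 => g'0; rewrite -evlead -rmorphMn g'0 rmorph0.
by rewrite -[LHS]/(ev _) rmorph_resultant ?evlead ?lg' // evG -deriv_map evG.
Qed.

Hypothesis uniq_rows : uniq [:: ra; rb; rc].

(** The line X_o = X_z = 0 and the plane a X_0 + X_e = 0 in the target yield the equation a + q,
    which is separable when -a is not a critical value of q. *)
Lemma line_disc_neq0 : line_disc != 0.
Proof.
have [e0 o0 z0 oe [ze zo]] := coord_neq.
have [ba ca cb] : [/\ rb != ra, rc != ra & rc != rb].
  by move: uniq_rows; rewrite /= !inE ![_ == ra]eq_sym [rc == rb]eq_sym; case/and3P => /norP[].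
pose A a : 'M[algC]_(3, 1 + 3) := \matrix_(i, j)
  if i == ra then if j == x0 then a else (j == xe)%:R
  else if i == rb then (j == xo)%:R else (j == xz)%:R.
have Ab a k : A a rb k = (k == xo)%:R by rewrite mxE (negPf ba) eqxx.
have Ac a k : A a rc k = (k == xz)%:R by rewrite mxE (negPf ca) (negPf cb).
have Aa a k : A a ra k = if k == x0 then a else (k == xe)%:R by rewrite mxE eqxx.
have Ad a : minor (A a) xo xz = 1.
  by rewrite /minor !Ab !Ac !eqxx (negPf zo) mul0r mulr1 subr0.
have c0 : c != 0 by case: domH.
have pt a : line_point (A a) = line_point (A 0).
  by apply/funext => k; rewrite /line_point /minor !Ab !Ac.
pose q := line_poly idfun (A 0).
have Eq a : line_poly idfun (A a) = a%:P + q.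
  rewrite /q /line_poly !sum_coords !pt !Aa eqxx mul0r add0r -!addrA; congr (_ + _).
    rewrite proj_form0 rmorphXn /= mmapX mmap1U /line_point eqxx.
    by rewrite Ad expr1n mulr1.
have szq : size q = D.+1.
  by apply: size_line_poly; rewrite ?Ad ?Aa ?(negPf e0) ?eqxx ?oner_neq0.
have q'0 : q^`() != 0 by apply: deriv_neq0; rewrite szq ltnS.
have [rs Drs] := closed_field_poly_normal q^`().
have [a a_rs] : exists a : nat, (\prod_(r <- rs) ('X + q.[r]%:P)).[a%:R] != 0.
  apply: poly_nat_nonroot; rewrite prodf_seq_neq0; apply/allP => r _ /=.
  by rewrite -size_poly_gt0 size_XaddC.
suff : line_disc.@[mxvec (A a%:R) 0] != 0 by apply: contraNneq => ->; rewrite meval0.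
have Aae : A a%:R ra xe = 1 by rewrite Aa (negPf e0) eqxx.
rewrite meval_line_disc ?Ad ?Aae ?oner_neq0 // !mul1r resultant_eq0 -leqNgt.
rewrite Eq derivD derivC add0r leq_eqVlt; apply/orP; left.
apply/negP => /negP /closed_rootP[x]; rewrite root_gcd => /andP[Gx q'x].
have x_rs : x \in rs.
  by move: q'x; rewrite Drs rootZ ?root_prod_XsubC // lead_coef_eq0.
move: a_rs; rewrite horner_prod prodf_seq_neq0 => /allP/(_ x x_rs)/=/negP; apply.
by move: Gx; rewrite rootE !hornerE.
Qed.

Section Points.
Variable A : 'M[algC]_(3, 1 + 3).
Hypothesis discA : line_disc.@[mxvec A 0] != 0.

Let G := line_poly idfun A.
Let dl := minor A xo xz.
Let dot r (w : 'rV[algC]_(1 + 3)) := \sum_k A r k * w 0 k.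

Let c0 : c != 0. Proof. by case: domH. Qed.

Let disc_parts : [/\ dl != 0, A ra xe != 0 & resultant G G^`() != 0].
Proof.
have d0 : dl != 0.
  apply: contraNneq discA => dl0.
  by rewrite /line_disc !mevalM meval_generic_minor -/dl dl0 !mul0r.
have a0 : A ra xe != 0.
  apply: contraNneq discA => ae0.
  by rewrite /line_disc !mevalM meval_generic_matrix ae0 mulr0 mul0r.
by move: discA; rewrite meval_line_disc // mulf_eq0 negb_or => /andP[_].
Qed.

Definition line_param y : affine 3 := \row_k ((line_point A (rshift 1 k)).[y] / dl).

Lemma homog_line_param y k : dl * homog_coords (line_param y) 0 k = (line_point A k).[y].
Proof.
have [d0 _ _] := disc_parts.
case: (split_ordP k) => [j ->|j ->]; last by rewrite homog_coordsS mxE mulrC divfK.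
by rewrite ord1 homog_coords0 mulr1 /line_point eqxx hornerC.
Qed.

Lemma line_param_e y : line_param y 0 e = y.
Proof.
have [d0 _ _] := disc_parts; have [e0 _ _ _ _] := coord_neq.
by rewrite mxE /line_point (negPf e0) eqxx !hornerE mulrC mulKf.
Qed.

Lemma horner_line_param y : G.[y] = dl ^+ D * dot ra (homog_coords (phi (line_param y))).
Proof.
rewrite horner_line_poly mulr_sumr; apply: eq_bigr => k _.
rewrite -meval_proj_form mulrCA -(homog_meval_scale _ _ (proj_form_homog k)).
by congr (_ * meval _ _); apply/funext => j; rewrite homog_line_param.
Qed.

Lemma root_line_poly y : root G y = (dot ra (homog_coords (phi (line_param y))) == 0).
Proof.
have [d0 _ _] := disc_parts.
by rewrite rootE horner_line_param mulf_eq0 expf_eq0 (negPf d0) andbF.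
Qed.

Lemma dot_line_param y : dot rb (homog_coords (line_param y)) = 0 /\
  dot rc (homog_coords (line_param y)) = 0.
Proof.
have [d0 _ _] := disc_parts.
suff dot0 r : r \in [:: rb; rc] -> dot r (homog_coords (line_param y)) = 0.
  by split; apply: dot0; rewrite !inE eqxx ?orbT.
move=> r_bc; apply: (mulfI d0); rewrite mulr0 mulr_sumr.
under eq_bigr do rewrite mulrCA homog_line_param.
have [e0 o0 z0 oe [ze zo]] := coord_neq.
rewrite sum_coords /line_point eqxx (negPf e0) (negPf o0) (negPf z0) eqxx (negPf oe) (negPf ze).
rewrite eqxx (negPf zo) !(hornerD, hornerM, hornerC, hornerX) /minor.
by move: r_bc; rewrite !inE => /orP[] /eqP->; ring.
Qed.

Lemma line_poly_roots : exists rs : seq algC, [/\ uniq rs, size rs = D & forall x, root G x = (x \in rs)].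
Proof.
have [d0 a0] := disc_parts; rewrite resultant_eq0 -leqNgt => gcdG.
have szG : size G = D.+1 by apply: size_line_poly.
have G0 : G != 0 by rewrite -size_poly_gt0 szG.
have [rs DG] := closed_field_poly_normal G.
have lG0 : lead_coef G != 0 by rewrite lead_coef_eq0.
exists rs; split=> [||x].
- rewrite -separable_prod_XsubC unlock.
  rewrite -(coprimepZl _ _ lG0) -DG -(coprimepZr _ _ lG0) -derivZ -DG /coprimep.
  by rewrite eqn_leq gcdG size_poly_gt0 gcdp_eq0 negb_and G0.
- by apply: succn_inj; rewrite -szG DG size_scale // size_prod_XsubC.
- by rewrite [in LHS]DG rootZ // root_prod_XsubC.
Qed.

(** At infinity the forms reduce to c X_e^D, so [w2] would be the coordinate point of [e], which is
    off the plane because [A ra xe] is not 0. Elsewhere Cramer's rule puts [w1] on the parametrized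
    line. *)
Lemma on_line_param (w1 w2 : 'rV[algC]_(1 + 3)) : w1 != 0 -> w2 != 0 ->
    (forall k l, w2 0 k * (proj_form l).@[w1 0] = w2 0 l * (proj_form k).@[w1 0]) ->
    dot ra w2 = 0 -> dot rb w1 = 0 -> dot rc w1 = 0 ->
  exists y t s, [/\ root G y, t != 0, s != 0, w1 = t *: homog_coords (line_param y)
    & w2 = s *: homog_coords (phi (line_param y))].
Proof.
move=> w10 w20 rel aw bw cw; have [d0 a0 _] := disc_parts.
have [e0 o0 z0 oe [ze zo]] := coord_neq.
have wo : dl * w1 0 xo = minor A xz x0 * w1 0 x0 + minor A xz xe * w1 0 xe.
  apply/eqP; rewrite -subr_eq0; set u := _ - _.
  have -> : u = A rc xz * dot rb w1 - A rb xz * dot rc w1.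
    by rewrite /u /dot !sum_coords /dl /minor; ring.
  by rewrite bw cw !mulr0 subr0.
have wz : dl * w1 0 xz = minor A x0 xo * w1 0 x0 + minor A xe xo * w1 0 xe.
  apply/eqP; rewrite -subr_eq0; set u := _ - _.
  have -> : u = A rb xo * dot rc w1 - A rc xo * dot rb w1.
    by rewrite /u /dot !sum_coords /dl /minor; ring.
  by rewrite bw cw !mulr0 subr0.
set t := w1 0 x0 in wo wz.
have t0 : t != 0.
  apply/eqP => t0; rewrite t0 !mulr0 !add0r in wo wz.
  have we0 : w1 0 xe != 0.
    apply: contraNneq w10 => we; rewrite we !mulr0 in wo wz; apply/eqP/rowP => k; rewrite mxE.
    case: (coord_cases k) => -> //; [move/eqP: wo|move/eqP: wz];
      by rewrite mulf_eq0 (negPf d0) => /eqP.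
  have form_w1 k : (proj_form k).@[w1 0] = if k == xe then c * w1 0 xe ^+ D else 0.
    case: (split_ordP k) => [j ->|j ->].
      by rewrite ord1 proj_form0 rmorphXn /= mevalXU -/x0 -/t t0 expr0n eqn0Ngt D0.
    have [_ _ DH _] := domH; rewrite proj_formS DH mevalD mevalM mevalXU -/x0 -/t t0 mul0r addr0.
    rewrite (inj_eq (@rshift_inj _ _)); case: ifP => _; last by rewrite meval0.
    by rewrite mevalZ rmorphXn /= mevalXU.
  have w2k k : k != xe -> w2 0 k = 0.
    move=> k_e; have /eqP := rel k xe; rewrite !form_w1 eqxx (negPf k_e) mulr0.
    by rewrite !mulf_eq0 (negPf c0) expf_eq0 (negPf we0) andbF !orbF => /eqP.
  have w2e : w2 0 xe = 0.
    move/eqP: aw; rewrite /dot sum_coords (w2k x0) 1?(w2k xo) 1?(w2k xz) //.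
    by rewrite !mulr0 !addr0 add0r mulf_eq0 (negPf a0) => /eqP.
  case/eqP: w20; apply/rowP => k; rewrite mxE.
  by have [->//|/w2k] := eqVneq k xe.
pose y := w1 0 xe / t.
have Dw1 : w1 = t *: homog_coords (line_param y).
  apply/rowP => k; apply: (mulfI d0); rewrite mxE mulrCA homog_line_param /line_point.
  have ty : t * y = w1 0 xe by rewrite mulrC divfK.
  case: (coord_cases k) => ->.
  - by rewrite eqxx hornerC mulrC.
  - by rewrite (negPf e0) eqxx hornerM hornerC hornerX mulrCA ty.
  - rewrite (negPf o0) (negPf oe) eqxx wo hornerD hornerM !hornerC hornerX -ty; ring.
  - rewrite (negPf z0) (negPf ze) (negPf zo) wz hornerD hornerM !hornerC hornerX -ty; ring.
have Dw2 : w2 = w2 0 x0 *: homog_coords (phi (line_param y)).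
  have formt k : (proj_form k).@[w1 0] = t ^+ D * homog_coords (phi (line_param y)) 0 k.
    rewrite -meval_proj_form -(homog_meval_scale _ _ (proj_form_homog k)).
    by apply: meval_eq => j; rewrite Dw1 mxE.
  apply/rowP => k; apply: (mulfI (expf_neq0 D t0)); have := rel k x0.
  by rewrite !formt homog_coords0 mulr1 mulrC => ->; rewrite [in RHS]mxE mulrCA.
have s0 : w2 0 x0 != 0 by apply: contraNneq w20 => s0; rewrite Dw2 s0 scale0r.
exists y, t, (w2 0 x0); split => //.
rewrite root_line_poly -(mulrI_eq0 _ (mulfI s0)) mulr_sumr -[X in _ == X]aw; apply/eqP/eq_bigr => k _.
by rewrite mulrCA; congr (_ * _); move/rowP: Dw2 => /(_ k) ->; rewrite [RHS]mxE.
Qed.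

End Points.

End LineSection.

(** * Bihomogeneous equations and the graph *)

Section Bihomogeneous.
Variable d : nat.
Implicit Types F G : {mpoly algC[(1 + d) + (1 + d)]}.

Lemma bihomogeneousM a b a' b' F G : bihomogeneous a b F -> bihomogeneous a' b' G ->
  bihomogeneous (a + a') (b + b') (F * G).
Proof.
move=> homF homG m /msuppM_le /allpairsP[[m1 m2] /= [/homF[m1a m1b] /homG[m2a m2b] ->]].
by rewrite -m1a -m1b -m2a -m2b -!big_split; split; apply: eq_bigr => k _; rewrite mnmDE.
Qed.

Lemma bihomogeneousD a b F G : bihomogeneous a b F -> bihomogeneous a b G ->
  bihomogeneous a b (F + G).
Proof. by move=> homF homG m /msuppD_le; rewrite mem_cat => /orP[/homF|/homG]. Qed.

Lemma bihomogeneousZ a b (t : algC) F : bihomogeneous a b F -> bihomogeneous a b (t *: F).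
Proof. by move=> homF m /msuppZ_le /homF. Qed.

Lemma bihomogeneous1 : bihomogeneous 0 0 (1 : {mpoly algC[(1 + d) + (1 + d)]}).
Proof. by move=> m; rewrite msupp1 inE => /eqP->; split; rewrite big1 // => k _; rewrite mnm0E. Qed.

Lemma bihomogeneous_lshift i : bihomogeneous 1 0 ('X_(lshift (1 + d) i) : {mpoly algC[_]}).
Proof.
move=> m; rewrite msuppX inE => /eqP->; split.
  rewrite (bigD1 i) //= mnm1E eqxx big1 // => j /negPf ji.
  by rewrite mnm1E (inj_eq (@lshift_inj _ _)) eq_sym ji.
by rewrite big1 // => j _; rewrite mnm1E eq_lrshift.
Qed.

Lemma bihomogeneous_rshift i : bihomogeneous 0 1 ('X_(rshift (1 + d) i) : {mpoly algC[_]}).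
Proof.
move=> m; rewrite msuppX inE => /eqP->; split.
  by rewrite big1 // => j _; rewrite mnm1E eq_rlshift.
rewrite (bigD1 i) //= mnm1E eqxx big1 // => j /negPf ji.
by rewrite mnm1E (inj_eq (@rshift_inj _ _)) eq_sym ji.
Qed.

(* [b] tells whether the source coordinates are those of the second factor. *)
Definition bihomogeneous_for (b : bool) n m F :=
  if b then bihomogeneous m n F else bihomogeneous n m F.

Definition source_var (b : bool) i : 'I_((1 + d) + (1 + d)) :=
  if b then rshift (1 + d) i else lshift (1 + d) i.

Lemma bihomogeneous_source b n (p : {mpoly algC[1 + d]}) : p \is n.-homog ->
  bihomogeneous_for b n 0 (p \mPo [tuple 'X_(source_var b i) | i < 1 + d]).
Proof.
move=> homp; rewrite comp_mpolyE big_seq.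
apply: (big_ind (bihomogeneous_for b n 0)) => [|F G|m /(dhomog_mf homp) Dm].
- by case: b => m; rewrite msupp0.
- by case: b; apply: bihomogeneousD.
suff : bihomogeneous_for b n 0 (\prod_i tnth [tuple 'X_(source_var b i) | i < 1 + d] i ^+ m i).
  by case: b; apply: bihomogeneousZ.
rewrite -Dm /= mdegE; apply: (big_ind2 (fun F k => bihomogeneous_for b k 0 F)).
- by case: b; apply: bihomogeneous1.
- by move=> F j G k; case: b; apply: bihomogeneousM.
move=> i _; rewrite tnth_mktuple; elim: (m i) => [|k].
  by rewrite expr0; case: b; apply: bihomogeneous1.
rewrite exprS; case: b => homk.
  exact: (@bihomogeneousM 0 1 0 k _ _ (@bihomogeneous_rshift i)).
exact: (@bihomogeneousM 1 0 k 0 _ _ (@bihomogeneous_lshift i)).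
Qed.

End Bihomogeneous.

Lemma homog_coords_neq0 d (P : affine d) : homog_coords P != 0.
Proof.
apply/eqP => /rowP/(_ (lshift d 0)) /eqP.
by rewrite row_mxEl !mxE eqxx oner_eq0.
Qed.

Lemma homog_coords_line_inj d : injective (fun P : affine d => <[homog_coords P]>%VS).
Proof.
move=> P Q /= PQ; have : homog_coords P \in <[homog_coords Q]>%VS by rewrite -PQ memv_line.
case/vlineP => t DP; have t1 : t = 1.
  move/rowP: DP => /(_ (lshift d 0)).
  by rewrite /homog_coords scale_row_mx !row_mxEl !mxE eqxx mulr1 => <-.
move: DP; rewrite t1 scale1r => DP; apply/rowP => k.
by move/rowP: DP => /(_ (rshift 1 k)); rewrite !row_mxEr.
Qed.

Lemma vline_scale (K : fieldType) (V : vectType K) (t : K) (v : V) :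
  t != 0 -> <[t *: v]>%VS = <[v]>%VS.
Proof.
move=> t0; apply/eqP; rewrite eqEsubv -!memvE memvZ ?memv_line //=.
by rewrite -[X in X \in _](scalerK t0) memvZ ?memv_line.
Qed.

Lemma row_dot_eq0 m n (A : 'M[algC]_(m, n)) i (v : 'rV[algC]_n) :
  row i A *m v^T = 0 <-> \sum_k A i k * v 0 k = 0.
Proof.
have dotE : (row i A *m v^T) 0 0 = \sum_k A i k * v 0 k.
  by rewrite mxE; apply: eq_bigr => k _; rewrite !mxE.
by rewrite -dotE; split=> [->|v0]; [rewrite mxE|apply/matrixP => j l; rewrite !ord1 v0 mxE].
Qed.

Section GraphSection.
Variables (b : bool) (phi : affine 3 -> affine 3) (e o z : 'I_3) (D : nat) (c : algC).
Variables (R H : 'I_3 -> {mpoly algC[1 + 3]}).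
Hypotheses (uniq_eoz : uniq [:: e; o; z]) (D0 : (0 < D)%N) (domH : dominant_forms phi e D c R H).

Notation coords := ('rV[algC]_(1 + 3)).
(** Swapping the two factors exchanges the graph of a bijection with that of its inverse. *)
Definition orient (T : Type) (u : T * T) := if b then (u.2, u.1) else u.
Let G : set (coords * coords) :=
  biproj_closure (range (fun P => orient (homog_coords P, homog_coords (phi P)))).

(** These equations are bihomogeneous and hold on the affine graph, hence on its closure. They need
    not define the closure, but they suffice to locate its points on the linear section. *)
Lemma graph_relation w k l : G w -> let u := orient w in
  u.2 0 k * (proj_form D H l).@[u.1 0] = u.2 0 l * (proj_form D H k).@[u.1 0].
Proof.
pose sub := [tuple 'X_(source_var (d := 3) b i) | i < 1 + 3] : (1 + 3).-tuple {mpoly algC[_]}.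
pose F i j := 'X_(source_var (~~ b) i) * (proj_form D H j \mPo sub).
have homF i j : bihomogeneous_for b D 1 (F i j).
  have := bihomogeneous_source b (proj_form_homog D0 domH j); rewrite -/sub /F /sub.
  case: b => homj; first exact: (bihomogeneousM (@bihomogeneous_lshift 3 i) homj).
  exact: (bihomogeneousM (@bihomogeneous_rshift 3 i) homj).
have evF i j w' : (F i j).@[(row_mx w'.1 w'.2) 0] =
    (orient w').2 0 i * (proj_form D H j).@[(orient w').1 0].
  rewrite mevalM mevalXU comp_mpoly_meval; congr (_ * _).
    by rewrite /orient; case: b; rewrite /source_var (row_mxEl, row_mxEr).
  apply: meval_eq => n; rewrite tnth_mktuple mevalXU.
  by rewrite /orient; case: b; rewrite /source_var (row_mxEl, row_mxEr).
case=> _ _ van; apply/eqP; rewrite -subr_eq0 -!evF -mevalB; apply/eqP.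
have hom : bihomogeneous_for b D 1 (F k l - F l k).
  move: (homF k l) (homF l k); rewrite -scaleN1r; case: b => homkl homlk.
    exact: (bihomogeneousD homkl (bihomogeneousZ homlk)).
  exact: (bihomogeneousD homkl (bihomogeneousZ homlk)).
have van' u : range (fun P => orient (homog_coords P, homog_coords (phi P))) u ->
    (F k l - F l k).@[(row_mx u.1 u.2) 0] = 0.
  move=> [P _ <-]; rewrite mevalB !evF.
  have -> : orient (orient (homog_coords P, homog_coords (phi P))) =
    (homog_coords P, homog_coords (phi P)) by rewrite /orient; case: b.
  by rewrite /= !(meval_proj_form domH) mulrC subrr.
by move: hom; rewrite /bihomogeneous_for; case: b => hom; apply: van hom van'.
Qed.

(** Row [ra] constrains the target, [rb] and [rc] the source. In [linear_section] the first i rows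
    act on the second factor, which is the source when [b] holds. *)
Let ra : 'I_3 := if b then 2 else 0.
Let rb : 'I_3 := if b then 0 else 1.
Let rc : 'I_3 := if b then 1 else 2.

Lemma linear_section_rows (A : 'M[algC]_(3, 1 + 3)) (w : coords * coords) :
  let u := orient w in
  (forall j : 'I_3, row j A *m (if (j < (if b then 2 else 1))%N then w.2 else w.1)^T = 0) <->
  [/\ \sum_k A ra k * u.2 0 k = 0, \sum_k A rb k * u.1 0 k = 0 & \sum_k A rc k * u.1 0 k = 0].
Proof.
rewrite /orient /ra /rb /rc; case: b => /=; split.
- by move=> dots; move: (dots 0) (dots 1) (dots 2) => /row_dot_eq0 d0 /row_dot_eq0 d1 /row_dot_eq0 d2.
- by case=> /row_dot_eq0 d2 /row_dot_eq0 d0 /row_dot_eq0 d1; elim/ord3_ind.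
- by move=> dots; move: (dots 0) (dots 1) (dots 2) => /row_dot_eq0 d0 /row_dot_eq0 d1 /row_dot_eq0 d2.
- by case=> /row_dot_eq0 d2 /row_dot_eq0 d0 /row_dot_eq0 d1; elim/ord3_ind.
Qed.

(** The points of the section correspond to the [D] roots of the line polynomial and are told apart
    by their coordinate [e]. *)
Lemma intersection_number_dominant : intersection_number G (if b then 2 else 1) D.
Proof.
have urows : uniq [:: ra; rb; rc] by rewrite /ra /rb /rc; case: b.
exists (line_disc e o z D H ra rb rc) => [|A discA].
  exact: (line_disc_neq0 uniq_eoz D0 domH urows).
have [rs [uniq_rs size_rs root_rs]] := line_poly_roots uniq_eoz D0 domH discA.
pose P y := line_param e o z rb rc A y.
pose L y := orient (<[homog_coords (P y)]>%VS, <[homog_coords (phi (P y))]>%VS).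
have -> : linear_section G (if b then 2 else 1) A = (fun n => L (nth 0 rs n)) @` `I_D.
  apply/seteqP; split=> [_ [w [Gw /linear_section_rows[aw bw cw]] <-]|_ [n lt_n <-]].
    have [w10 w20] : (orient w).1 != 0 /\ (orient w).2 != 0.
      by case: Gw; rewrite /orient; case: b.
    have [y [t [s [Gy t0 s0 D1 D2]]]] := on_line_param uniq_eoz D0 domH discA w10 w20
      (fun k l => graph_relation k l Gw) aw bw cw.
    have y_rs : y \in rs by rewrite -root_rs.
    exists (index y rs); first by rewrite /= -size_rs index_mem.
    rewrite nth_index // /L -(vline_scale _ t0) -(vline_scale (homog_coords (phi _)) s0).
    by rewrite -D1 -D2 /orient; case: b {D1 D2}.
  have Gn : root (line_poly e o z D H ra rb rc idfun A) rs`_n.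
    by rewrite root_rs mem_nth // size_rs.
  pose u := (homog_coords (P rs`_n), homog_coords (phi (P rs`_n))).
  have uK : orient (orient u) = u by rewrite /orient; case: b.
  exists (orient u); last by rewrite /L /orient; case: b.
  split.
    split; try by rewrite /orient; case: b; apply: homog_coords_neq0.
    by move=> a a' F _; apply; exists (P rs`_n).
  apply/linear_section_rows; rewrite uK.
  have [bn cn] := dot_line_param uniq_eoz D0 domH discA rs`_n; split=> //.
  by move: Gn; rewrite (root_line_poly uniq_eoz D0 domH discA) => /eqP.
apply: inj_card_eq => m n; rewrite !inE /= => lt_m lt_n Lmn.
have Pmn : P rs`_m = P rs`_n.
  apply: homog_coords_line_inj => /=; move: (congr1 fst (congr1 (@orient _) Lmn)).
  by rewrite /L /orient; case: b.
apply/eqP; rewrite -(nth_uniq 0 _ _ uniq_rs) ?size_rs //; apply/eqP.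
rewrite -(line_param_e uniq_eoz D0 domH discA rs`_m).
by rewrite -(line_param_e uniq_eoz D0 domH discA rs`_n) -/(P _) Pmn.
Qed.

End GraphSection.

(** * The dynamical degrees of f *)

Lemma endo_app_skew_step P : endo_app henon_skew P = skew_step 1 0 1 2 (-1) P.
Proof.
by rewrite endo_app_henon_skew; apply/rowP; elim/ord3_ind; rewrite !mxE /tnth //=; ring.
Qed.

Lemma skew_stepK :
  cancel (skew_step 0 1 (-1) 2^-1 2^-1) (skew_step 1 0 1 2 (-1)).
Proof. by move=> P; apply/rowP; elim/ord3_ind; rewrite !mxE /= ?mxE /=; field. Qed.

Lemma skew_step_invK :
  cancel (skew_step 1 0 1 2 (-1)) (skew_step 0 1 (-1) 2^-1 2^-1).
Proof. by move=> P; apply/rowP; elim/ord3_ind; rewrite !mxE /= ?mxE /=; field. Qed.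

Lemma cvg_pow3_root (R : realType) : (fun n => (3 ^ n)%:R `^ n%:R^-1 : R) @ \oo --> (3 : R).
Proof.
apply: cvg_near_cst; exists 1%N => // n /= n0.
by rewrite natrX -powR_mulrn // -powRrM mulfV ?powRr1 // pnatr_eq0 -lt0n.
Qed.

(** The graph of f^n is the swapped graph of f^-n, so two hyperplanes in the target and one in the
    source for f^n become one in the target and two in the source for f^-n. *)
Lemma henon_skew_dynamical_degree (R : realType) (b : bool) :
  is_dynamical_degree henon_skew (if b then 2 else 1) (3 : R).
Proof.
exists (fun n => (3 ^ n)%N); split=> [n n0|]; last exact: cvg_pow3_root.
pose e : 'I_3 := if b then 0 else 1; pose o : 'I_3 := if b then 1 else 0.
pose phi := if b then iter n (skew_step 0 1 (-1) 2^-1 2^-1) else iter n (skew_step 1 0 1 2 (-1)).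
have uniq_eo : uniq [:: e; o; 2] by rewrite /e /o; case: (b).
have [c [Q [H domH]]] : exists c Q H, dominant_forms phi e (3 ^ n) c Q H.
  by rewrite /phi /e; case: (b); apply: iter_skew_step_dominant; rewrite ?oppr_eq0 ?oner_neq0.
have D0 : (0 < 3 ^ n)%N by rewrite expn_gt0.
have := intersection_number_dominant b uniq_eo D0 domH.
congr (intersection_number (biproj_closure _) _ _).
have iterf P : iter n (endo_app henon_skew) P = iter n (skew_step 1 0 1 2 (-1)) P.
  exact: eq_iter endo_app_skew_step _ _.
rewrite /phi /orient; case: (b) => /=; last by apply: eq_imagel => P _; rewrite iterf.
have iterK : cancel (iter n (endo_app henon_skew)) (iter n (skew_step 0 1 (-1) 2^-1 2^-1)).
  elim: (n) => // m IHm P; rewrite iterSr [iter m.+1 _ P]iterS endo_app_skew_step skew_step_invK; exact: IHm.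
have iterK' : cancel (iter n (skew_step 0 1 (-1) 2^-1 2^-1)) (iter n (endo_app henon_skew)).
  elim: (n) => // m IHm P; rewrite iterSr [iter m.+1 _ P]iterS endo_app_skew_step skew_stepK; exact: IHm.
apply/seteqP; split=> _ [P _ <-] /=.
  by exists (iter n (skew_step 0 1 (-1) 2^-1 2^-1) P); rewrite ?iterK'.
by exists (iter n (endo_app henon_skew) P); rewrite ?iterK.
Qed.

Unset Implicit Arguments.

Theorem theorem2p1 (R : realType) :
  [/\ [/\ is_automorphism henon_skew,
          is_dynamical_degree henon_skew 1 (3 : R) &
          is_dynamical_degree henon_skew 2 (3 : R)],
      (forall n : nat, (1 <= n)%N -> finite_set (Per_n henon_skew n)) /\
      (forall P : affine 3, Per henon_skew P -> isolated_periodic henon_skew P) &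
      exists P : nat -> affine 3,
        [/\ forall i : nat, Per henon_skew (P i),
            (fun i : nat => height R (P i)) @ \oo --> +oo &
            zariski_dense (range P)]].
Proof.
split; first by split; [exact: henon_skew_automorphism|
  exact: (henon_skew_dynamical_degree R false)|exact: (henon_skew_dynamical_degree R true)].
  split=> [n|P _]; first exact: Per_henon_skew_finite.
  exact/finite_Per_isolated/Per_henon_skew_finite.
have [g good_g] := choice good_factor_exists; have [t good_gt] := choice good_g.
(* The 2-adic valuation of k + 1 takes every value infinitely often, so each orbit index occurs at
   unboundedly many levels, while the height bound depends on k alone. *)
exists (fun k => orbit_point (t k) k (logn 2 k.+1)); split=> [k||].
- apply: orbit_point_Per; have [[r ->] _ gt _ _] := good_gt k.
  by rewrite rmorphM hornerM gt mul0r.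
- have c0 : 0 < 2 / 3 * ln 3 :> R by rewrite mulr_gt0 ?ln_gt0 ?ltr1n // divr_gt0.
  apply: ger_cvgy (cvg_arithmetic (2 / 3 * ln 3) c0); near=> k.
  have := height_orbit_point_ge R (logn 2 k.+1) (good_gt k).
  by rewrite mulr_natr mulrS.
- apply: (orbit_points_dense good_gt) => j k0.
  have odd_part : logn 2 (2 ^ j * (2 * k0).+1) = j.
    by rewrite lognM ?expn_gt0 // pfactorK // logn_coprime ?addn0 // coprime2n /= mul2n odd_double.
  exists (2 ^ j * (2 * k0).+1).-1.
    have := expn_gt0 2 j; rewrite /=; nia.
  by exists (2 ^ j * (2 * k0).+1).-1; rewrite // prednK ?odd_part // muln_gt0 expn_gt0.
Unshelve. all: by end_near.
Qed.
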